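(* Let $(M,G,J,C,\star)$ be reduction data as described in the context, with $\star$ strongly invariant and Hermitian, and let $\star_{\mathrm{red}}$ be the reduced star product on $M_{\mathrm{red}}=C/G$. Then $\star_{\mathrm{red}}$ is Hermitian, i.e. $$\overline{u\star_{\mathrm{red}}v}=\overline{v}\star_{\mathrm{red}}\overline{u}\qquad\text{for all }u,v\in C^\infty(M_{\mathrm{red}})[[\lambda]].$$
   Context: Conventions: $C^\infty(X)$ denotes complex-valued smooth functions; $\lambda$ is a formal parameter with $\overline\lambda=\lambda$; maps are extended $\mathbb C[[\lambda]]$-linearly; repeated indices are summed. Reduction data: $(M,\{\cdot,\cdot\})$ is a Poisson manifold (real Poisson tensor), $G$ a connected Lie group with Lie algebra $\mathfrak g$ (basis $e_a$, dual basis $e^a$), $L:G\times M\to M$ a smooth proper left action by Poisson diffeomorphisms, $\xi_M(p)=\frac{d}{dt}|_{t=0}L_{\exp(t\xi)}(p)$, and $J:M\to\mathfrak g^*$ an equivariant momentum map: with $J_\xi=\langle J,\xi\rangle$, $J_a=J_{e_a}$, one has $\{\cdot,J_\xi\}=\xi_M$ and $\{J_\xi,J_\eta\}=J_{[\xi,\eta]}$. Assume $0$ is a value and a regular value of $J$; put $C=J^{-1}(\{0\})$ with inclusion $\iota:C\to M$; $G$ acts freely and properly on $C$, and $\pi:C\to M_{\mathrm{red}}=C/G$ is the quotient map. As a standing assumption $M$ coincides with a tubular neighbourhood of $C$: there is a $G$-equivariant diffeomorphism $\Phi$ of $M$ onto an open neighbourhood $U$ of $C\times\{0\}$ in $C\times\mathfrak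 g^*$ (product of the action on $C$ and the coadjoint action), with $\Phi(c)=(c,0)$ for $c\in C$, $U\cap(\{c\}\times\mathfrak g^* )$ star-shaped around $(c,0)$, and $J=\mathrm{pr}_2\circ\Phi$. Classical maps: $\mathrm{prol}(\phi)=\phi\circ\mathrm{pr}_1\circ\Phi$ for $\phi\in C^\infty(C)$; $(h_0f)(p)=e_a\int_0^1\frac{\partial(f\circ\Phi^{-1})}{\partial\mu_a}(c,t\mu)\,dt$ for $\Phi(p)=(c,\mu)$; $\partial_1(f^a\otimes e_a)=f^aJ_a$. Quantum data: $\star$ is a star product on $M$: a $\mathbb C[[\lambda]]$-bilinear associative product $f\star g=\sum_r\lambda^rC_r(f,g)$ with bidifferential $C_r$, $C_0(f,g)=fg$, $C_1(f,g)-C_1(g,f)=i\{f,g\}$, $1\star f=f=f\star1$. It is strongly invariant: $J_\xi\star f-f\star J_\xi=i\lambda\{J_\xi,f\}$, and Hermitian: $\overline{f\star g}=\overline g\star\overline f$. With $\Delta(\xi)=\mathrm{tr}\,\mathrm{ad}_\xi$ put $\boldsymbol\partial_1(f^a\otimes e_a)=f^a\star J_a+\frac{i\lambda}{2}\Delta(e_a)f^a$ and $\boldsymbol\iota^*=\iota^*\circ(\mathrm{id}+(\boldsymbol\partial_1-\partial_1)h_0)^{-1}:C^\infty(M)[[\lambda]]\to C^\infty(C)[[\lambda]]$. The reduced star product is defined by $\pi^*(u\star_{\mathrm{red}}v)=\boldsymbol\iota^*(\mathrm{prol}(\pi^*u)\star\mathrm{prol}(\pi^*v))$ for $u,v\in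 C^\infty(M_{\mathrm{red}})[[\lambda]]$. *)

(* Defs.v *)
From HB Require Import structures.
From mathcomp Require Import all_boot all_order all_algebra.
From mathcomp Require Import all_classical all_reals all_analysis.
From mathcomp Require Import complex.
Set Implicit Arguments.
Unset Strict Implicit.
Unset Printing Implicit Defensive.
Import Order.TTheory GRing.Theory Num.Theory numFieldNormedType.Exports.
Local Open Scope classical_set_scope.
Local Open Scope complex_scope.
Local Open Scope ring_scope.

Section Euclidean.
Variables (R : realType) (n : nat).
Implicit Types (U : set 'rV[R]_n) (f : 'rV[R]_n -> R).

Definition partial (i : 'I_n) f : 'rV[R]_n -> R := 'D_(delta_mx 0 i) f.

Fixpoint Ck (k : nat) U f : Prop :=
  (forall x, U x -> {for x, continuous f}) /\
  (if k is k'.+1 then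
     forall i, (forall x, U x -> derivable f x (delta_mx 0 i)) /\
               Ck k' U (partial i f)
   else True).

(* meaningful for U open *)
Definition Csmooth U f : Prop := forall k, Ck k U f.

Definition partials (s : seq 'I_n) f : 'rV[R]_n -> R := foldr partial f s.

End Euclidean.

Section ComplexValued.
Variable R : realType.

Definition reF (X : Type) (f : X -> R[i]) : X -> R := fun x => complex.Re (f x).
Definition imF (X : Type) (f : X -> R[i]) : X -> R := fun x => complex.Im (f x).
Definition toC (X : Type) (f : X -> R) : X -> R[i] := fun x => (f x)%:C.

Definition extC (X Y : Type) (T : (X -> R) -> Y -> R) (f : X -> R[i]) : Y -> R[i] :=
  fun y => T (reF f) y +i* T (imF f) y.

End ComplexValued.

Record chart (R : realType) (T : Type) (n : nat) := Chart {
  cdom : set T;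
  cmap : T -> 'rV[R]_n;
  cinv : 'rV[R]_n -> T }.

(* A topological space with charts; the axioms are in [is_manifold].  Keeping
   them apart makes products available before anything is proved about them. *)
Record premanifold (R : realType) := Premanifold {
  mdim : nat;
  mcarrier :> topologicalType;
  matlas : set (chart R mcarrier mdim) }.

Arguments matlas {R} p.

Section Manifolds.
Variable R : realType.
Implicit Types M N : premanifold R.

Definition cimg (T : Type) (n : nat) (phi : chart R T n) : set 'rV[R]_n :=
  cmap phi @` cdom phi.

Definition is_chart (T : topologicalType) (n : nat) (phi : chart R T n) : Prop :=
  [/\ open (cdom phi), open (cimg phi),
      forall x, cdom phi x -> cinv phi (cmap phi x) = x,
      forall x, cdom phi x -> {for x, continuous (cmap phi)} &
      forall y, cimg phi y -> {for y, continuous (cinv phi)}].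

Definition is_manifold M : Prop :=
  [/\ hausdorff_space M, @second_countable M,
      forall phi, matlas M phi -> is_chart phi,
      forall x : M, exists2 phi, matlas M phi & cdom phi x &
      forall phi psi, matlas M phi -> matlas M psi -> forall i,
        Csmooth (cmap phi @` (cdom phi `&` cdom psi))
                (fun y => cmap psi (cinv phi y) 0 i)].

Definition smooth_on M N (U : set M) (F : M -> N) : Prop :=
  (forall x, U x -> {for x, continuous F}) /\
  forall phi psi, matlas M phi -> matlas N psi -> forall i,
    Csmooth (cmap phi @` (cdom phi `&` U `&` F @^-1` cdom psi))
            (fun y => cmap psi (F (cinv phi y)) 0 i).

Definition smooth_map M N (F : M -> N) : Prop := smooth_on setT F.

Definition smoothR M (f : M -> R) : Prop :=
  forall phi, matlas M phi -> Csmooth (cimg phi) (fun y => f (cinv phi y)).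

Definition smoothC M (f : M -> R[i]) : Prop := smoothR (reF f) /\ smoothR (imF f).

Definition Rn (n : nat) : premanifold R :=
  @Premanifold R n 'rV[R]_n [set Chart setT id id].

Definition prod_chart (S T : Type) (m n : nat) (phi : chart R S m) (psi : chart R T n) :
    chart R (S * T) (m + n) :=
  Chart [set x | cdom phi x.1 /\ cdom psi x.2]
        (fun x => row_mx (cmap phi x.1) (cmap psi x.2))
        (fun y => (cinv phi (lsubmx y), cinv psi (rsubmx y))).

Definition prodm M N : premanifold R :=
  @Premanifold R (mdim M + mdim N) (M * N)%type
    [set chi | exists phi psi,
       [/\ matlas M phi, matlas N psi & chi = prod_chart phi psi]].

(* Tangent vectors at p are the derivations of C^oo(M, R) at p; the values of D
   at non-smooth functions are irrelevant, so equality of tangent vectors is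
   [tangent_eq], not Leibniz equality. *)
Definition is_tangent M (p : M) (D : (M -> R) -> R) : Prop :=
  (forall (a : R) f g, smoothR f -> smoothR g ->
     D (fun x => a * f x + g x) = a * D f + D g) /\
  (forall f g, smoothR f -> smoothR g ->
     D (fun x => f x * g x) = D f * g p + f p * D g).

Definition tangent_eq M (D D' : (M -> R) -> R) : Prop :=
  forall f, smoothR f -> D f = D' f.

Definition tangent_map M N (F : M -> N) (D : (M -> R) -> R) : (N -> R) -> R :=
  fun f => D (fun x => f (F x)).

Definition immersive_at M N (F : M -> N) (p : M) : Prop :=
  forall D, is_tangent p D ->
    tangent_eq (tangent_map F D) (fun=> 0) -> tangent_eq D (fun=> 0).

Definition submersive_at M N (F : M -> N) (p : M) : Prop :=
  forall D', is_tangent (F p) D' ->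
    exists2 D, is_tangent p D & tangent_eq (tangent_map F D) D'.

Definition embedding M N (F : M -> N) : Prop :=
  [/\ smooth_map F, injective F, forall p, immersive_at F p &
      forall U : set M, open U -> exists2 V : set N, open V & U = F @^-1` V].

Definition regular_value M N (F : M -> N) (q : N) : Prop :=
  forall p, F p = q -> submersive_at F p.

End Manifolds.

Record lie_group (R : realType) := LieGroup {
  lgM :> premanifold R;
  gmul : lgM -> lgM -> lgM;
  gone : lgM;
  ginv : lgM -> lgM;
  lg_manifold : is_manifold lgM;
  gmulA : forall x y z, gmul x (gmul y z) = gmul (gmul x y) z;
  gmul1 : forall x, gmul gone x = x /\ gmul x gone = x;
  gmulV : forall x, gmul (ginv x) x = gone /\ gmul x (ginv x) = gone;
  gmul_smooth : @smooth_map R (prodm lgM lgM) lgM (fun x => gmul x.1 x.2);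
  ginv_smooth : smooth_map ginv }.

Arguments gone {R l}.

(* The Lie algebra is T_1 G; with a basis e_a it is identified with 'rV_(dim G),
   xi standing for \sum_a xi_a e_a, and its dual with 'rV_(dim G) through the
   dual basis. *)
Section LieAlgebra.
Variables (R : realType) (G : lie_group R).
Local Notation d := (mdim G).
Variable e : 'I_d -> (G -> R) -> R.

Definition vec (xi : 'rV[R]_d) : (G -> R) -> R := fun f => \sum_a xi 0 a * e a f.

Definition tangent_basis : Prop :=
  (forall a, is_tangent (@gone R G) (e a)) /\
  (forall D, is_tangent (@gone R G) D -> exists! xi, tangent_eq D (vec xi)).

Definition coords (D : (G -> R) -> R) : 'rV[R]_d :=
  xget 0 [set xi | tangent_eq D (vec xi)].

(* the left-invariant vector field with value xi at the unit *)
Definition left_field (xi : 'rV[R]_d) (f : G -> R) : G -> R :=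
  fun g => vec xi (fun h => f (gmul g h)).

Definition bracket (xi eta : 'rV[R]_d) : 'rV[R]_d :=
  coords (fun f => vec xi (left_field eta f) - vec eta (left_field xi f)).

Definition Delta (xi : 'rV[R]_d) : R :=
  \tr (\matrix_(a, b) bracket xi (delta_mx 0 b) 0 a).

Definition Ad (g : G) (xi : 'rV[R]_d) : 'rV[R]_d :=
  coords (tangent_map (fun h => gmul (gmul g h) (ginv g)) (vec xi)).

(* <coAd g mu, xi> = <mu, Ad (g^-1) xi> *)
Definition coAd (g : G) (mu : 'rV[R]_d) : 'rV[R]_d :=
  \row_a \sum_b mu 0 b * Ad (ginv g) (delta_mx 0 a) 0 b.

(* t |-> exp (t xi) is the integral curve through the unit of the left-invariant
   vector field of xi *)
Definition is_exp (exp : 'rV[R]_d -> G) : Prop :=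
  exp 0 = gone /\
  forall xi f t, smoothR f ->
    is_derive (t : R) 1 (fun s => f (exp (s *: xi))) (left_field xi f (exp (t *: xi))).

End LieAlgebra.

Section Actions.
Variables (R : realType) (G : lie_group R) (X : premanifold R).
Variable L : G -> X -> X.

Definition smooth_left_action : Prop :=
  [/\ @smooth_map R (prodm G X) X (fun z => L z.1 z.2),
      forall x, L gone x = x &
      forall g h x, L (gmul g h) x = L g (L h x)].

Definition proper_action : Prop :=
  forall K : set (X * X), compact K ->
    compact [set z : G * X | K (L z.1 z.2, z.2)].

Definition free_action : Prop := forall g x, L g x = x -> g = gone.

End Actions.

Section Poisson.
Variables (R : realType) (M : premanifold R).
Variable pb : (M -> R) -> (M -> R) -> M -> R.

Definition is_poisson : Prop :=
  [/\ forall f g, smoothR f -> smoothR g -> smoothR (pb f g),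
      forall f g, smoothR f -> smoothR g -> forall p, pb f g p = - pb g f p,
      forall (a : R) f g h, smoothR f -> smoothR g -> smoothR h -> forall p,
        pb (fun x => a * f x + g x) h p = a * pb f h p + pb g h p,
      forall f g h, smoothR f -> smoothR g -> smoothR h -> forall p,
        pb f (fun x => g x * h x) p = pb f g p * h p + g p * pb f h p &
      forall f g h, smoothR f -> smoothR g -> smoothR h -> forall p,
        pb f (pb g h) p + pb g (pb h f) p + pb h (pb f g) p = 0].

Definition pbC (f g : M -> R[i]) : M -> R[i] := fun p =>
  (pb (reF f) (reF g) p - pb (imF f) (imF g) p)
  +i* (pb (reF f) (imF g) p + pb (imF f) (reF g) p).

End Poisson.

Record reduction_data (R : realType) := ReductionData {
  rdM : premanifold R;
  rd_pb : (rdM -> R) -> (rdM -> R) -> rdM -> R;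
  rdG : lie_group R;
  rd_e : 'I_(mdim rdG) -> (rdG -> R) -> R;
  rd_exp : 'rV[R]_(mdim rdG) -> rdG;
  rd_L : rdG -> rdM -> rdM;
  rd_J : rdM -> 'rV[R]_(mdim rdG);    (* J p = \sum_a J_a(p) e^a *)
  rdC : premanifold R;
  rd_iota : rdC -> rdM;
  rd_LC : rdG -> rdC -> rdC;
  rdMred : premanifold R;
  rd_pi : rdC -> rdMred;
  rd_Phi : rdM -> rdC * 'rV[R]_(mdim rdG);
  rd_Psi : rdC * 'rV[R]_(mdim rdG) -> rdM;    (* Phi^-1, meaningful on U *)

  rd_M_manifold : is_manifold rdM;
  rd_poisson : is_poisson rd_pb;

  rd_connected : connected [set: rdG];
  rd_basis : tangent_basis rd_e;
  rd_expP : is_exp rd_e rd_exp;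

  rd_action : smooth_left_action rd_L;
  rd_proper : proper_action rd_L;
  rd_poisson_action : forall g f h, smoothR f -> smoothR h -> forall p,
    rd_pb (fun x => f (rd_L g x)) (fun x => h (rd_L g x)) p = rd_pb f h (rd_L g p);

  rd_J_smooth : @smooth_map R rdM (Rn R (mdim rdG)) rd_J;
  rd_J_equivariant : forall g p, rd_J (rd_L g p) = coAd rd_e g (rd_J p);
  rd_J_hamiltonian : forall (xi : 'rV[R]_(mdim rdG)) f, smoothR f -> forall p,
    rd_pb f (fun x => \sum_a xi 0 a * rd_J x 0 a) p
    = derive1 (fun t : R => f (rd_L (rd_exp (t *: xi)) p)) 0;
  rd_J_bracket : forall (xi eta : 'rV[R]_(mdim rdG)) p,
    rd_pb (fun x => \sum_a xi 0 a * rd_J x 0 a)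
          (fun x => \sum_a eta 0 a * rd_J x 0 a) p
    = \sum_a bracket rd_e xi eta 0 a * rd_J p 0 a;
  rd_0_value : exists p, rd_J p = 0;
  rd_0_regular : @regular_value R rdM (Rn R (mdim rdG)) rd_J 0;

  (* C = J^-1(0) with its submanifold structure and the restricted action *)
  rd_C_manifold : is_manifold rdC;
  rd_iota_embedding : embedding rd_iota;
  rd_iota_range : range rd_iota = rd_J @^-1` [set 0];
  rd_LC_restr : forall g c, rd_iota (rd_LC g c) = rd_L g (rd_iota c);
  rd_LC_action : smooth_left_action rd_LC;
  rd_LC_free : free_action rd_LC;
  rd_LC_proper : proper_action rd_LC;

  (* Mred = C / G with the manifold structure making pi a submersion *)
  rd_Mred_manifold : is_manifold rdMred;
  rd_pi_smooth : smooth_map rd_pi;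
  rd_pi_submersion : forall c, submersive_at rd_pi c;
  rd_pi_surj : forall x, exists c, rd_pi c = x;
  rd_pi_orbits : forall c c', rd_pi c = rd_pi c' <-> exists g, c' = rd_LC g c;

  (* the tubular neighbourhood, with U = range Phi *)
  rd_U_open : open (range rd_Phi);
  rd_Phi_smooth : @smooth_map R rdM (prodm rdC (Rn R (mdim rdG))) rd_Phi;
  rd_PhiK : cancel rd_Phi rd_Psi;
  rd_Psi_smooth :
    @smooth_on R (prodm rdC (Rn R (mdim rdG))) rdM (range rd_Phi) rd_Psi;
  rd_Phi_equivariant : forall g p,
    rd_Phi (rd_L g p) = (rd_LC g (rd_Phi p).1, coAd rd_e g (rd_Phi p).2);
  rd_Phi_C : forall c, rd_Phi (rd_iota c) = (c, 0);
  rd_U_star : forall c mu (t : R), range rd_Phi (c, mu) -> 0 <= t <= 1 ->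
    range rd_Phi (c, t *: mu);
  rd_J_Phi : forall p, rd_J p = (rd_Phi p).2 }.

(* F : formal_series R X is \sum_n lambda^n F n *)
Definition formal_series (R : realType) (X : Type) := nat -> X -> R[i].

Section Series.
Variables (R : realType) (M : premanifold R).
Implicit Types F G : formal_series R M.

Definition smoothS F : Prop := forall n, smoothC (F n).

Definition constS (f : M -> R[i]) : formal_series R M :=
  fun n => if n is 0%N then f else fun=> 0.

Definition lambdaS F : formal_series R M := fun n => if n is m.+1 then F m else fun=> 0.

Definition addS F G : formal_series R M := fun n p => F n p + G n p.
Definition subS F G : formal_series R M := fun n p => F n p - G n p.
Definition scaleS (a : R[i]) F : formal_series R M := fun n p => a * F n p.

Definition conjS F : formal_series R M := fun n p => (F n p)^*%C.

Definition hermitian_product (op : formal_series R M -> formal_series R M -> formal_series R M) : Prop :=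
  forall F G, smoothS F -> smoothS G -> conjS (op F G) = op (conjS G) (conjS F).

(* In every chart B is a sum of terms c_{s,t} (d_s f) (d_t g) with smooth
   coefficients, s and t running over the index sequences of length at most k. *)
Definition bidifferential (B : (M -> R[i]) -> (M -> R[i]) -> M -> R[i]) : Prop :=
  exists k : nat, forall phi, matlas M phi ->
  exists c : seq 'I_(mdim M) -> seq 'I_(mdim M) -> 'rV[R]_(mdim M) -> R[i],
    (forall s t, Csmooth (cimg phi) (reF (c s t)) /\
                 Csmooth (cimg phi) (imF (c s t))) /\
    (forall f g, smoothC f -> smoothC g -> forall y, cimg phi y ->
       B f g (cinv phi y) =
         \sum_(i < k.+1) \sum_(s : i.-tuple 'I_(mdim M))
         \sum_(j < k.+1) \sum_(t : j.-tuple 'I_(mdim M))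
           c s t y * extC (partials s) (fun z => f (cinv phi z)) y
                   * extC (partials t) (fun z => g (cinv phi z)) y).

Variable Cr : nat -> (M -> R[i]) -> (M -> R[i]) -> M -> R[i].

(* the C[[lambda]]-bilinear extension of \sum_r lambda^r Cr r *)
Definition star F G : formal_series R M := fun n p =>
  \sum_(r < n.+1) \sum_(j < (n - r).+1) Cr r (F j) (G (n - r - j)%N) p.

Definition is_star_product (pb : (M -> R) -> (M -> R) -> M -> R) : Prop :=
  [/\ forall r, bidifferential (Cr r),
      forall F G H, smoothS F -> smoothS G -> smoothS H ->
        star F (star G H) = star (star F G) H,
      forall f g, smoothC f -> smoothC g -> forall p, Cr 0 f g p = f p * g p,
      forall f g, smoothC f -> smoothC g -> forall p,
        Cr 1 f g p - Cr 1 g f p = 'i%C * pbC pb f g p &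
      forall F, smoothS F ->
        star (constS (fun=> 1)) F = F /\ star F (constS (fun=> 1)) = F].

End Series.

Section Reduction.
Variables (R : realType) (D : reduction_data R).
Local Notation M := (rdM D).
Local Notation C := (rdC D).
Local Notation Mred := (rdMred D).
Local Notation d := (mdim (rdG D)).
Local Notation mu01 := (@lebesgue_measure R).

Definition Jfun (xi : 'rV[R]_d) : M -> R := fun p => \sum_a xi 0 a * rd_J p 0 a.

Definition Jbasis (a : 'I_d) : M -> R := Jfun (delta_mx 0 a).

Definition prol (phi : formal_series R C) : formal_series R M :=
  fun n p => phi n (rd_Phi p).1.

Definition restr (F : formal_series R M) : formal_series R C :=
  fun n c => F n (rd_iota c).

Definition pullpi (u : formal_series R Mred) : formal_series R C :=
  fun n c => u n (rd_pi c).

(* the component along e_a of the homotopy h_0, on real-valued functions *)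
Definition h0R (a : 'I_d) (f : M -> R) (p : M) : R :=
  \int[mu01]_(t in `[0, 1])
    'D_(delta_mx 0 a) (fun mu : 'rV[R]_d => f (rd_Psi ((rd_Phi p).1, mu)))
       (t *: (rd_Phi p).2).

Definition h0 (F : formal_series R M) : 'I_d -> formal_series R M :=
  fun a n => extC (h0R a) (F n).

Definition koszul (f : 'I_d -> formal_series R M) : formal_series R M :=
  fun n p => \sum_a f a n p * toC (Jbasis a) p.

Variable Cr : nat -> (M -> R[i]) -> (M -> R[i]) -> M -> R[i].
Local Notation "F ** G" := (star Cr F G) (at level 40).

Definition strongly_invariant : Prop :=
  forall xi F, smoothS F ->
    subS (constS (toC (Jfun xi)) ** F) (F ** constS (toC (Jfun xi)))
    = scaleS 'i%C (lambdaS (fun n => pbC (@rd_pb R D) (toC (Jfun xi)) (F n))).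

Definition qkoszul (f : 'I_d -> formal_series R M) : formal_series R M :=
  fun n p => \sum_a
    ((f a ** constS (toC (Jbasis a))) n p
     + 'i%C / 2 * (Delta (@rd_e R D) (delta_mx 0 a))%:C * lambdaS (f a) n p).

(* id + (qkoszul - koszul) h0, as an operator on C^oo(M)[[lambda]] *)
Definition deformation (F : formal_series R M) : formal_series R M :=
  addS F (subS (qkoszul (h0 F)) (koszul (h0 F))).

Definition deformation_inv (F : formal_series R M) : formal_series R M :=
  xget (fun _ _ => 0) [set H | smoothS H /\ deformation H = F].

Definition qrestr (F : formal_series R M) : formal_series R C := restr (deformation_inv F).

(* the w in C^oo(Mred)[[lambda]] with
   pi^* w = qrestr (prol (pi^* u) ** prol (pi^* v)) *)
Definition star_red (u v : formal_series R Mred) : formal_series R Mred :=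
  xget (fun _ _ => 0)
    [set w | smoothS w /\
       pullpi w = qrestr (prol (pullpi u) ** prol (pullpi v))].

End Reduction.

(* Main.v *)
Require Import Defs.
From mathcomp Require Import all_boot all_order all_algebra.
From mathcomp Require Import all_classical all_reals all_analysis.
From mathcomp Require Import complex.
From mathcomp Require Import ring zify.

(** Write xi_M = {., J_xi}, X_a for the components of X = h_0 H, and S for the
    operator id + (qkoszul - koszul) h_0, so that qrestr = iota^* S^-1.

    The product F of two pullbacks from M_red is killed by every xi_M, because
    strong invariance and associativity make xi_M a derivation of the star
    product.  The homotopy h_0 intertwines xi_M up to the coadjoint action, so S
    commutes with xi_M; being id + O(lambda), S is injective, and hence
    H = S^-1 F is killed by every xi_M as well.  For such an H the components
    satisfy \sum_a {J_a, X_a} = \sum_a Delta(e_a) X_a.  This is exactly what is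
    needed to turn the conjugate of X_a * J_a + (i lambda / 2) Delta(e_a) X_a,
    that is J_a * conj X_a - (i lambda / 2) Delta(e_a) conj X_a, into the same
    expression for conj X = h_0 (conj H), after summation over a.  So
    S (conj H) = conj (S H), whence qrestr (conj F) = conj (qrestr F), and the
    hermiticity of the star product concludes.

    The intertwining relation is the derivative at t = 0, along g = exp (t xi),
    of h_0^a (f o L_g) = \sum_b Ad(g^-1)(e_b)_a (h_0^b f) o L_g, where Ad(g^-1)
    can be read off J because the values of J contain a multiple of each e^a.
    All structure constants and the invariance of Delta come from the Poisson
    bracket in the same way. *)

Set Implicit Arguments.
Unset Strict Implicit.
Unset Printing Implicit Defensive.
Import Order.TTheory GRing.Theory Num.Theory numFieldNormedType.Exports.
Local Open Scope classical_set_scope.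
Local Open Scope ring_scope.

(** The inverse in [deformation_inv] and the reduced product in [star_red] are values of [xget]: a
    solution of an equation where one exists, and 0 otherwise. Commutation with conjugation is
    therefore proved for solution sets: conjugation carries the solutions for F to those for conj F
    and back, each equation has at most one solution, and the default 0 is real. Uniqueness is the
    injectivity of S for the first equation and the surjectivity of pi for the second. The analysis
    sits in one exchange of limits. h_0 f integrates over s in [0, 1] a fibre derivative of f at (c,
    s mu), and the flow of xi_M must be differentiated through both. This takes differentiation
    under the integral sign, symmetry of second partials and a chain rule along exp (t xi), for
    functions known to be regular only near certain points of a chart; hence the pointwise notion
    [Cnear]. The trace identity rests on X transforming in the representation dual to that of J:
    contracting X with J gives an invariant, while putting xi = e_a and summing over a leaves the
    trace of ad. *)

Lemma near_forall (I : finType) (T : topologicalType) (y : T) (P : I -> T -> Prop) :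
  (forall i, \forall z \near y, P i z) -> \forall z \near y, forall i, P i z.
Proof. exact: filter_forall. Qed.

Lemma near_all (T : topologicalType) (y : T) (P : T -> Prop) :
  (forall z, P z) -> \forall z \near y, P z.
Proof. by move=> HP; apply: nearW. Qed.

Lemma near_imp (T : topologicalType) (y : T) (P Q : T -> Prop) :
  (\forall z \near y, P z) -> (forall z, P z -> Q z) -> \forall z \near y, Q z.
Proof. by move=> HP PQ; apply: filterS HP. Qed.

Lemma near_imp2 (T : topologicalType) (y : T) (P Q S : T -> Prop) :
  (\forall z \near y, P z) -> (\forall z \near y, Q z) ->
  (forall z, P z -> Q z -> S z) -> \forall z \near y, S z.
Proof. by move=> HP HQ PQ; apply: filterS2 HP HQ. Qed.

Lemma continuous_pair (S T U : topologicalType) (f : S -> T) (g : S -> U) (z : S) :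
  {for z, continuous f} -> {for z, continuous g} ->
  {for z, continuous (fun t => (f t, g t))}.
Proof.
move=> cf cg A [[B C] [/= fB gC] BC].
have NB : \forall t \near z, B (f t) by exact: cf.
have NC : \forall t \near z, C (g t) by exact: cg.
by apply: (near_imp2 NB NC) => t Bt Ct; exact: (BC (f t, g t)).
Qed.

Lemma continuous_dist (R : realType) (T : topologicalType) (f : T -> R) (z : T) :
  (forall e : R, 0 < e -> \forall t \near z, `|f z - f t| <= e) -> {for z, continuous f}.
Proof. by move=> H; apply/cvgrPdist_le. Qed.

(** * C^k functions near a point of R^n *)

Section Euclid.
Variable R : realType.

Lemma cvg_rV (T : Type) (F : set_system T) (FF : Filter F) n (c : T -> 'rV[R]_n) (l : 'rV[R]_n) :
  (forall j, (fun t => c t 0 j) @ F --> l 0 j) -> c @ F --> l.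
Proof.
move=> cl A [P Pl sPA]; rewrite /nbhs /=.
apply: (@filterS _ F _ (fun t => forall i j, P i j (c t i j))).
  by move=> t Pt; apply: sPA.
apply: filter_forall => i; apply: filter_forall => j.
by have := Pl i j; rewrite (ord1 i); apply: cl.
Qed.

Lemma continuous_rV (T : topologicalType) n (c : T -> 'rV[R]_n) (z : T) :
  (forall j, {for z, continuous (fun t => c t 0 j)}) -> {for z, continuous c}.
Proof. by move=> H; apply: cvg_rV. Qed.

Lemma line_is_derive n (f : 'rV[R]_n -> R) (a v : 'rV[R]_n) (t : R) :
  derivable f (a + t *: v) v ->
  is_derive t 1 (fun s : R => f (a + s *: v)) ('D_v f (a + t *: v)).
Proof.
move=> df.
have E : (fun h : R => h^-1 *: (f (a + (h *: 1 + t) *: v) - f (a + t *: v))) =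
    (fun h => h^-1 *: (f (h *: v + (a + t *: v)) - f (a + t *: v))).
  apply/funext => h; rewrite [h *: 1]mulr1 scalerDl.
  by congr (_ *: (f _ - _)); rewrite addrCA.
by apply: DeriveDef; rewrite /derivable /derive/= E.
Qed.

(** The segment is parametrised by s * r with s in [0, 1], so that r may have either sign and the
    point found still satisfies |t| <= |r|. *)
Lemma MVT_line n (f : 'rV[R]_n -> R) (a v : 'rV[R]_n) (r : R) :
  (forall t : R, `|t| <= `|r| -> derivable f (a + t *: v) v) ->
  exists2 t : R, `|t| <= `|r| & f (a + r *: v) - f a = r * 'D_v f (a + t *: v).
Proof.
move=> df.
have le1 (s : R) : s \in `[0, 1] -> `|s * r| <= `|r|.
  rewrite in_itv/= => /andP[s0 s1].
  by rewrite normrM ger0_norm// ler_piMl.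
have dg (s : R) : s \in `[0, 1] ->
    is_derive s 1 (fun s : R => f (a + (s * r) *: v)) (r * 'D_v f (a + (s * r) *: v)).
  move=> s01; have ds := line_is_derive (df _ (le1 _ s01)).
  have dm : is_derive s 1 (fun s : R => s * r) r.
    rewrite -[X in is_derive _ _ _ X]mulr1.
    rewrite (_ : (fun s : R => s * r) = (fun s => r * s)); last by apply/funext => x; rewrite mulrC.
    exact: is_deriveZ.
  have := @is_derive1_comp _ (fun t => f (a + t *: v)) (fun s : R => s * r) s _ _ ds dm.
  by rewrite mulrC.
have dg' (s : R) : s \in `]0, 1[ ->
    is_derive s 1 (fun s : R => f (a + (s * r) *: v)) (r * 'D_v f (a + (s * r) *: v)).
  by move=> s01; apply: dg; exact: subset_itv_oo_cc s01.
have cg : {within `[0, 1], continuous (fun s : R => f (a + (s * r) *: v))}.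
  by apply: derivable_within_continuous => s s01; apply: ex_derive; exact: dg.
have [s s01] := MVT_segment ler01 dg' cg.
rewrite mul1r mul0r scale0r addr0 subr0 mulr1 => ->.
by exists (s * r) => //; exact: le1.
Qed.

(* [Ck k U f] asks for derivatives at the points of [U] only, so on an open
   set it amounts to this condition at every point. *)
Fixpoint Cnear n k (f : 'rV[R]_n -> R) (y : 'rV[R]_n) : Prop :=
  (\forall z \near y, {for z, continuous f}) /\
  (if k is k'.+1 then
     forall i, (\forall z \near y, derivable f z (delta_mx 0 i)) /\
               Cnear k' (partial i f) y
   else True).

Lemma Csmooth_Cnear n (U : set 'rV[R]_n) f y k : nbhs y U -> Csmooth U f -> Cnear k f y.
Proof.
move=> Uy sf; have := sf k; elim: k f {sf} => [|k IH] f /= [cf df].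
  by split=> //; move: Uy; exact: filterS.
split; first by move: Uy; exact: filterS.
move=> i; have [di Di] := df i; split; last exact: IH.
by move: Uy; exact: filterS.
Qed.

Lemma Cnear_Csmooth n (U : set 'rV[R]_n) f :
  (forall y, U y -> forall k, Cnear k f y) -> Csmooth U f.
Proof.
move=> cf k; have {}cf y : U y -> Cnear k f y by move=> Uy; exact: cf.
elim: k f cf => [|k IH] f cf /=; split.
- by move=> x /cf[/nbhs_singleton].
- by [].
- by move=> x /cf[/nbhs_singleton].
- move=> i; split; first by move=> x /cf[_ /(_ i)[/nbhs_singleton]].
  by apply: IH => y /cf[_ /(_ i)[]].
Qed.

Section Cnear_theory.
Variable n : nat.
Implicit Types (f g : 'rV[R]_n -> R) (y : 'rV[R]_n).

Lemma Cnear_cont k f y : Cnear k f y -> {for y, continuous f}.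
Proof. by case: k => [|k] [/nbhs_singleton]. Qed.

(** Each clause of [Cnear] is a condition near y, and [nbhs_interior] turns such a condition into
    one near every point close to y. *)
Lemma Cnear_near k f y : Cnear k f y -> \forall z \near y, Cnear k f z.
Proof.
elim: k f => [|k IH] f /= [cf df].
  by have := nbhs_interior cf; apply: filterS => z; split.
have H : \forall z \near y, forall i,
    (\forall z0 \near z, derivable f z0 (delta_mx 0 i)) /\ Cnear k (partial i f) z.
  apply: (near_forall (P := fun i z => (\forall z0 \near z, derivable f z0 (delta_mx 0 i)) /\
    Cnear k (partial i f) z)) => i; have [di /IH Di] := df i.
  have di' := nbhs_interior di.
  by near=> z; split; [near: z|near: z].
have cf' := nbhs_interior cf.
by near=> z; split; near: z.
Unshelve. all: end_near. Qed.

(** Every clause depends on the germ of f at y only. This is the tool for replacing a function by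
    its expression through another chart. *)
Lemma Cnear_eq k f g y : (\forall z \near y, f z = g z) -> Cnear k f y -> Cnear k g y.
Proof.
elim: k f g => [|k IH] f g fg /= [cf df].
  split=> //; have fg' := nbhs_interior fg.
  near=> z.
  have cfz : {for z, continuous f} by near: z.
  have fgz : \forall w \near z, f w = g w by near: z.
  rewrite /prop_for /continuous_at -(nbhs_singleton fgz).
  by apply: cvg_trans cfz; exact: (near_eq_cvg fgz).
have fg' := nbhs_interior fg.
split.
  near=> z.
  have cfz : {for z, continuous f} by near: z.
  have fgz : \forall w \near z, f w = g w by near: z.
  rewrite /prop_for /continuous_at -(nbhs_singleton fgz).
  by apply: cvg_trans cfz; exact: (near_eq_cvg fgz).
move=> i; have [di Di] := df i; split.
  near=> z; apply: (@near_eq_derivable _ _ _ f); first by near: z.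
  by near: z.
apply: IH Di; near=> z; apply: near_eq_derive; near: z; exact: fg'.
Unshelve. all: end_near. Qed.

Lemma CnearS k f y : Cnear k.+1 f y -> Cnear k f y.
Proof.
elim: k f => [|k IH] f; first by move=> [].
move=> [cf df]; split=> // i; have [di Di] := df i; split => //.
exact: IH.
Qed.

Lemma Cnear_partial k f y i : Cnear k.+1 f y -> Cnear k (partial i f) y.
Proof. by move=> [_ /(_ i)[]]. Qed.

Lemma Cnear_derivable k f y i : Cnear k.+1 f y -> derivable f y (delta_mx 0 i).
Proof. by move=> [_ /(_ i)[/nbhs_singleton]]. Qed.

Lemma Cnear_cst k (c : R) y : Cnear k (fun=> c) y.
Proof.
elim: k c => [|k IH] c /=; (split=> //; first by apply: near_all => z; exact: cst_continuous).
move=> i; split; first by apply: near_all => z; exact: derivable_cst.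
apply: (@Cnear_eq _ (fun=> 0)) => //; apply: near_all => z.
by rewrite /partial derive_cst.
Unshelve. all: end_near. Qed.

Lemma CnearD k f g y : Cnear k f y -> Cnear k g y -> Cnear k (fun x => f x + g x) y.
Proof.
elim: k f g => [|k IH] f g /= [cf df] [cg dg].
  by split=> //; apply: (near_imp2 cf cg) => z cfz cgz; exact: continuousD.
split; first by apply: (near_imp2 cf cg) => z cfz cgz; exact: continuousD.
move=> i; have [di Di] := df i; have [ei Ei] := dg i; split.
  by apply: (near_imp2 di ei) => z diz eiz; exact: derivableD.
apply: (Cnear_eq _ (IH _ _ Di Ei)); apply: (near_imp2 di ei) => z diz eiz.
by rewrite /partial -deriveD.
Unshelve. all: end_near. Qed.

Lemma CnearM k f g y : Cnear k f y -> Cnear k g y -> Cnear k (fun x => f x * g x) y.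
Proof.
elim: k f g => [|k IH] f g.
  move=> [cf df] [cg dg].
  by split=> //; apply: (near_imp2 cf cg) => z cfz cgz; exact: continuousM.
move=> Cf Cg; have [cf df] := Cf; have [cg dg] := Cg.
split; first by apply: (near_imp2 cf cg) => z cfz cgz; exact: continuousM.
move=> i; have [di Di] := df i; have [ei Ei] := dg i; split.
  by apply: (near_imp2 di ei) => z diz eiz; exact: (derivableM diz eiz).
apply: (Cnear_eq _ (CnearD (IH _ _ (CnearS Cf) Ei) (IH _ _ (CnearS Cg) Di))).
apply: (near_imp2 di ei) => z diz eiz; rewrite /partial.
by rewrite -[LHS]/(f z *: 'D_(delta_mx 0 i) g z + g z *: 'D_(delta_mx 0 i) f z) (deriveM diz eiz).
Unshelve. all: end_near. Qed.

Lemma CnearN k f y : Cnear k f y -> Cnear k (fun x => - f x) y.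
Proof.
move=> Cf; apply: (@Cnear_eq _ (fun x => (-1) * f x)).
  by apply: near_all => z; rewrite mulN1r.
by apply: CnearM => //; exact: Cnear_cst.
Unshelve. all: end_near. Qed.

Lemma Cnear_sum k (I : Type) (r : seq I) (P : pred I) (F : I -> 'rV[R]_n -> R) y :
  (forall i, Cnear k (F i) y) -> Cnear k (fun x => \sum_(i <- r | P i) F i x) y.
Proof.
move=> CF; elim: r => [|i r IH].
  apply: (@Cnear_eq _ (fun=> 0)); last exact: Cnear_cst.
  by apply: near_all => z; rewrite big_nil.
case: (boolP (P i)) => Pi.
  apply: (@Cnear_eq _ (fun x => F i x + \sum_(i <- r | P i) F i x)).
    by apply: near_all => z; rewrite big_cons Pi.
  exact: CnearD.
apply: (Cnear_eq _ IH).
by apply: near_all => z; rewrite big_cons (negbTE Pi).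
Unshelve. all: end_near. Qed.

Lemma derive_coord (y v : 'rV[R]_n) j :
  is_derive y v (fun x : 'rV[R]_n => x 0 j) (v 0 j).
Proof.
have E : \forall h \near 0^', h^-1 *: ((h *: v + y) 0 j - y 0 j) = v 0 j.
  near=> h; rewrite !mxE addrK [_ *: _]mulrA mulVf ?mul1r//.
  by near: h; exact: nbhs_dnbhs_neq.
apply: DeriveDef.
  by apply: (is_cvg_near_cst (v 0 j)).
exact: lim_near_cst.
Unshelve. all: end_near. Qed.

Lemma Cnear_coord k y j : Cnear k (fun x => x 0 j) y.
Proof.
case: k => [|k] /=; (split=> //; first by apply: near_all => z; exact: coord_continuous).
move=> i; split; first by apply: near_all => z; apply: ex_derive; exact: derive_coord.
apply: (@Cnear_eq _ (fun=> (delta_mx 0 i : 'rV[R]_n) 0 j)); last exact: Cnear_cst.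
apply: near_all => z; apply/esym; have := derive_coord z (delta_mx 0 i) j.
by case=> _; rewrite /partial.
Unshelve. all: end_near. Qed.

(** One coordinate is changed at a time, and the mean value theorem is applied to each edge of the
    path from y to y + h. The points p j differ from edge to edge but stay within |h| of y, which
    suffices for a chain rule once the partials are continuous. *)
Lemma increment_partials f y : Cnear 1 f y ->
  \forall h \near (0 : 'rV[R]_n), exists p : 'I_n -> 'rV[R]_n,
    (forall j, `|p j - y| <= `|h|) /\
    f (y + h) - f y = \sum_j h 0 j * partial j f (p j).
Proof.
move=> [_ df].
have : \forall z \near y, forall i, derivable f z (delta_mx 0 i).
  by apply: (near_forall (P := fun i z => derivable f z (delta_mx 0 i))) => i; have [] := df i.
move=> /nbhs_normP[e /= e0 De].
near=> h.
have he : `|h| < e by near: h; exact: (@nbhs0_lt R 'rV[R]_n e e0).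
(* The first k coordinates of h: hk runs from 0 at k = 0 to h at k = n, so the increments
   telescope. *)
pose hk k : 'rV[R]_n := \row_j (if (j < k)%N then h 0 j else 0).
have normle (w : 'rV[R]_n) : (forall j, `|w 0 j| <= `|h 0 j|) -> `|w| <= `|h|.
  move=> wh; rewrite [leLHS]/Num.Def.normr/= mx_normrE.
  apply/bigmax_leP; split=> //= -[i j] _ /=; rewrite (ord1 i).
  apply: (le_trans (wh j)).
  rewrite [leRHS]/Num.Def.normr/= mx_normrE.
  by rewrite (le_trans _ (le_bigmax _ _ (0, j))).
have Hj (j : 'I_n) : exists q : 'rV[R]_n, `|q - y| <= `|h| /\
    f (y + hk j.+1) - f (y + hk j) = h 0 j * partial j f q.
  have hkS : hk j.+1 = hk j + h 0 j *: delta_mx 0 j.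
    apply/rowP => i; rewrite !mxE eqxx/= ltnS leq_eqVlt.
    case: eqP => [/val_inj ->|ij]; first by rewrite ltnn eqxx/= add0r mulr1.
    have -> : (i == j) = false by apply/eqP => E; apply: ij; rewrite E.
    by rewrite /= mulr0 addr0.
  have nle (t : R) : `|t| <= `|h 0 j| -> `|y + hk j + t *: delta_mx 0 j - y| <= `|h|.
    move=> th; rewrite -(addrA y) (addrC y) addrK; apply: normle => i.
    rewrite !mxE eqxx/=; case: (eqVneq i j) => [->|ij].
      by rewrite ltnn add0r mulr1.
    by rewrite mulr0 addr0; case: ifP => // _; rewrite normr0.
  have [t th E] := @MVT_line n f (y + hk j) (delta_mx 0 j) (h 0 j) (fun t th =>
    De _ (le_lt_trans (eq_ind _ (fun x => x <= `|h|) (nle t th) _ (distrC _ _)) he) j).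
  exists (y + hk j + t *: delta_mx 0 j); split; first exact: nle.
  by rewrite hkS addrA.
have /choice[p Hp] := Hj; exists p; split; first by move=> j; have [] := Hp j.
under eq_bigr => j _ do rewrite -(Hp j).2.
have hn : hk n = h by apply/rowP => j; rewrite mxE ltn_ord.
have h0 : hk 0%N = 0 by apply/rowP => j; rewrite !mxE.
rewrite -(big_mkord xpredT (fun j => f (y + hk j.+1) - f (y + hk j))).
by rewrite telescope_sumr// hn h0 addr0.
Unshelve. all: end_near. Qed.

(** By [increment_partials] the difference quotient of f o c is a sum of difference quotients of the
    coordinates of c times partials of f at points tending to c t; continuity of the partials gives
    the limit. *)
Lemma chain_curve f (c : R -> 'rV[R]_n) (t : R) (dc : 'I_n -> R) :
  Cnear 1 f (c t) -> (forall j, is_derive t 1 (fun s => c s 0 j) (dc j)) ->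
  is_derive t 1 (fun s => f (c s)) (\sum_j dc j * partial j f (c t)).
Proof.
move=> Cf dcj.
have cc : {for t, continuous c}.
  apply: cvg_rV => j; apply: differentiable_continuous; apply/derivable1_diffP.
  exact: ex_derive.
have c0 : (fun h => c (h + t)) @ (0 : R) --> c t.
  have ct : {for (0 : R), continuous (fun h : R => h + t)}.
    by apply: continuousD; [exact: cvg_id|exact: cst_continuous].
  by move: ct; rewrite /prop_for /continuous_at add0r => ct; exact: (cvg_comp _ _ ct cc).
have /= incr := increment_partials Cf.
have incr' : \forall h \near (0 : R), exists p : 'I_n -> 'rV[R]_n,
    (forall j, `|p j - c t| <= `|c (h + t) - c t|) /\
    f (c (h + t)) - f (c t) = \sum_j (c (h + t) - c t) 0 j * partial j f (p j).
  have : (fun h => c (h + t) - c t) @ (0 : R) --> (0 : 'rV[R]_n).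
    rewrite -(subrr (c t)); apply: cvgB => //; exact: cvg_cst.
  move=> /(_ _ incr) incr1; apply: (near_imp incr1) => h [p [pc pE]]; exists p; split => //.
  by rewrite -pE (addrC (c t)) subrK.
pose P h (p : 'I_n -> 'rV[R]_n) := (forall j, `|p j - c t| <= `|c (h + t) - c t|) /\
    f (c (h + t)) - f (c t) = \sum_j (c (h + t) - c t) 0 j * partial j f (p j).
(* The intermediate points depend on h; they are chosen by [xget], and a solution exists for all h
   near 0. *)
pose p h := xget (fun=> c t) (P h).
have pP : \forall h \near (0 : R), P h (p h).
  by apply: (near_imp incr') => h ex; exact: xgetPex.
have pc j : (fun h => p h j) @ (0 : R) --> c t.
  apply/cvgrPdist_lt => e e0.
  near=> h.
  have [/(_ j) pj _] : P h (p h) by near: h.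
  rewrite distrC (le_lt_trans pj)// distrC.
  by near: h; move/cvgrPdist_lt : c0 => /(_ _ e0).
have pd j : (fun h => partial j f (p h j)) @ (0 : R) --> partial j f (c t).
  have /Cnear_cont cj := Cnear_partial j Cf.
  exact: (cvg_comp _ _ (pc j) cj).
have lim0 : (fun h => \sum_j (h^-1 *: (c (h + t) 0 j - c t 0 j)) * partial j f (p h j)) @ 0^'
    --> \sum_j dc j * partial j f (c t).
  apply: cvg_big => [|j _]; first exact: add_continuous.
  apply: cvgM; last first.
    by apply: cvg_trans (pd j); apply: cvg_app; exact: nbhs_dnbhs.
  have [dj <-] := dcj j; rewrite /derive.
  have E : (fun h : R => h^-1 *: (c (h + t) 0 j - c t 0 j)) =
      (fun h => h^-1 *: (c (h *: 1 + t) 0 j - c t 0 j)).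
    by apply/funext => h; rewrite [h *: 1]mulr1.
  by rewrite E; exact: dj.
have lim1 : (fun h => h^-1 *: (f (c (h *: 1 + t)) - f (c t))) @ 0^'
    --> \sum_j dc j * partial j f (c t).
  apply: cvg_trans lim0; apply: near_eq_cvg.
  have pP' : \forall h \near 0^', P h (p h) by apply: nbhs_dnbhs.
  near=> h; rewrite [_ *: 1]mulr1.
  have [_ ->] : P h (p h) by near: h.
  rewrite scaler_sumr; apply: eq_bigr => j _.
  by rewrite !mxE [RHS]mulrA.
apply: DeriveDef; first by apply/cvg_ex; eexists; exact: lim1.
exact/cvg_lim.
Unshelve. all: end_near. Qed.

End Cnear_theory.

Lemma Cnear1 n k (f : 'rV[R]_n -> R) y : Cnear k.+1 f y -> Cnear 1 f y.
Proof. by elim: k => // k IH /CnearS. Qed.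

Lemma Cnear_row_mx k m n1 n2 (A : 'rV[R]_m -> 'rV[R]_n1) (B : 'rV[R]_m -> 'rV[R]_n2) x :
  (forall j, Cnear k (fun z => A z 0 j) x) -> (forall j, Cnear k (fun z => B z 0 j) x) ->
  forall j, Cnear k (fun z => row_mx (A z) (B z) 0 j) x.
Proof.
move=> CA CB j; case: (split_ordP j) => i ->.
  by rewrite (_ : (fun z => _) = (fun z => A z 0 i))//; apply/funext => z; rewrite row_mxEl.
by rewrite (_ : (fun z => _) = (fun z => B z 0 i))//; apply/funext => z; rewrite row_mxEr.
Qed.

Lemma Cnear_lsubmx k n1 n2 (x : 'rV[R]_(n1 + n2)) j : Cnear k (fun z => lsubmx z 0 j) x.
Proof.
rewrite (_ : (fun z => _) = (fun z : 'rV[R]_(n1 + n2) => z 0 (lshift n2 j))).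
  exact: Cnear_coord.
by apply/funext => z; rewrite mxE.
Qed.

Lemma Cnear_rsubmx k n1 n2 (x : 'rV[R]_(n1 + n2)) j : Cnear k (fun z => rsubmx z 0 j) x.
Proof.
rewrite (_ : (fun z => _) = (fun z : 'rV[R]_(n1 + n2) => z 0 (rshift n1 j))).
  exact: Cnear_coord.
by apply/funext => z; rewrite mxE.
Qed.

Lemma row_mx_rshift_line m n (a : 'rV[R]_m) (b : 'rV[R]_n) (x : R) i :
  row_mx a (b + x *: delta_mx 0 i) = row_mx a b + x *: delta_mx 0 (rshift m i).
Proof.
have -> : delta_mx 0 (rshift m i) = row_mx 0 (delta_mx 0 i) :> 'rV[R]_(m + n).
  apply/rowP => j; case: (split_ordP j) => k ->.
    by rewrite row_mxEl mxE eq_lrshift andbF mxE.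
  by rewrite row_mxEr !mxE eq_rshift.
by rewrite scale_row_mx add_row_mx scaler0 addr0.
Qed.

Lemma row_mx_lshift_line m n (a : 'rV[R]_m) (b : 'rV[R]_n) (x : R) i :
  row_mx (a + x *: delta_mx 0 i) b = row_mx a b + x *: delta_mx 0 (lshift n i).
Proof.
have -> : delta_mx 0 (lshift n i) = row_mx (delta_mx 0 i) 0 :> 'rV[R]_(m + n).
  apply/rowP => j; case: (split_ordP j) => k ->.
    by rewrite row_mxEl !mxE eq_lshift.
  by rewrite row_mxEr mxE eq_rlshift andbF mxE.
by rewrite scale_row_mx add_row_mx scaler0 addr0.
Qed.

Lemma derive_row_mxr m n (g : 'rV[R]_(m + n) -> R) (a : 'rV[R]_m) (b : 'rV[R]_n) i :
  partial i (fun u => g (row_mx a u)) b = partial (rshift m i) g (row_mx a b).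
Proof.
rewrite /partial /derive/=.
rewrite (_ : (fun h : R => h^-1 *: (g (row_mx a (h *: delta_mx 0 i + b)) - g (row_mx a b))) =
  (fun h => h^-1 *: (g (h *: delta_mx 0 (rshift m i) + row_mx a b) - g (row_mx a b))))//.
by apply/funext => h; rewrite (addrC _ b) row_mx_rshift_line (addrC (row_mx a b)).
Qed.

Lemma derive_row_mxl m n (g : 'rV[R]_(m + n) -> R) (a : 'rV[R]_m) (b : 'rV[R]_n) i :
  partial i (fun u => g (row_mx u b)) a = partial (lshift n i) g (row_mx a b).
Proof.
rewrite /partial /derive/=.
rewrite (_ : (fun h : R => h^-1 *: (g (row_mx (h *: delta_mx 0 i + a) b) - g (row_mx a b))) =
  (fun h => h^-1 *: (g (h *: delta_mx 0 (lshift n i) + row_mx a b) - g (row_mx a b))))//.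
by apply/funext => h; rewrite (addrC _ a) row_mx_lshift_line (addrC (row_mx a b)).
Qed.

(** Restriction to the line through x in direction v reduces this to [chain_curve]; [lineE] converts
    between the two kinds of derivative. *)
Lemma chain_partial m n (f : 'rV[R]_n -> R) (G : 'rV[R]_m -> 'rV[R]_n) (x v : 'rV[R]_m) :
  Cnear 1 f (G x) -> (forall j, derivable (fun z => G z 0 j) x v) ->
  is_derive x v (fun z => f (G z))
    (\sum_j 'D_v (fun z => G z 0 j) x * partial j f (G x)).
Proof.
move=> Cf dG.
have lineE (g : 'rV[R]_m -> R) d : is_derive (0 : R) 1 (fun s => g (s *: v + x)) d <->
    is_derive x v g d.
  have E : (fun h : R => h^-1 *: (g ((h *: 1 + 0) *: v + x) - g (0 *: v + x))) =
      (fun h => h^-1 *: (g (h *: v + x) - g x)).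
    by apply/funext => h; rewrite [h *: 1]mulr1 addr0 scale0r add0r.
  by split=> -[d1 d2]; apply: DeriveDef; move: d1 d2; rewrite /derivable /derive /= E.
apply/lineE; have := @chain_curve n f (fun s => G (s *: v + x)) 0
  (fun j => 'D_v (fun z => G z 0 j) x).
rewrite scale0r add0r; apply=> // j.
by apply/(lineE (fun z => G z 0 j)); apply: derivableP.
Qed.

(** Induction on k: by the chain rule a partial of f o G is a sum of products of a partial of G with
    a partial of f composed with G, and each of these factors is one degree less regular, where the
    induction hypothesis applies. *)
Lemma Cnear_comp k m n (f : 'rV[R]_n -> R) (G : 'rV[R]_m -> 'rV[R]_n) (x : 'rV[R]_m) :
  Cnear k f (G x) -> (forall j, Cnear k (fun z => G z 0 j) x) ->
  Cnear k (fun z => f (G z)) x.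
Proof.
have contG z : (forall j, {for z, continuous (fun z => G z 0 j)}) -> {for z, continuous G}.
  by move=> cG; exact: continuous_rV.
have contk k' f' z : Cnear k' f' (G z) -> (forall j, Cnear k' (fun z => G z 0 j) z) ->
    \forall w \near z, {for w, continuous (fun z => f' (G z))}.
  move=> Cf CG.
  have cGz : {for z, continuous G} by apply: contG => j; exact: Cnear_cont (CG j).
  have nf : \forall w \near z, Cnear k' f' (G w) by apply: cGz; exact: Cnear_near.
  have nG : \forall w \near z, forall j, Cnear k' (fun z => G z 0 j) w.
    by apply: (near_forall (P := fun j w => Cnear _ (fun z => G z 0 j) w)) => j; exact: Cnear_near.
  near=> w; apply: (@cvg_comp _ _ _ G f').
    apply: contG => j; apply: (@Cnear_cont _ k'); move: j; near: w; exact: nG.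
  by apply: Cnear_cont; near: w; exact: nf.
elim: k f x => [|k IH] f x Cf CG.
  by split=> //; exact: (contk 0%N).
split; first exact: (contk k.+1).
move=> i.
have cGx : {for x, continuous G} by apply: contG => j; exact: Cnear_cont (CG j).
have nf : \forall w \near x, Cnear k.+1 f (G w) by apply: cGx; exact: Cnear_near.
have nG : \forall w \near x, forall j, Cnear k.+1 (fun z => G z 0 j) w.
  by apply: (near_forall (P := fun j w => Cnear _ (fun z => G z 0 j) w)) => j; exact: Cnear_near.
have der : \forall w \near x, is_derive w (delta_mx 0 i) (fun z => f (G z))
    (\sum_j partial i (fun z => G z 0 j) w * partial j f (G w)).
  near=> w; apply: chain_partial.
    by apply: (@Cnear1 _ k); near: w; exact: nf.
  move=> j; apply: (@Cnear_derivable _ k); move: j; near: w; exact: nG.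
split; first by apply: (near_imp der) => w Hw; exact: ex_derive.
apply: (@Cnear_eq _ _ (fun w => \sum_j partial i (fun z => G z 0 j) w * partial j f (G w))).
  by apply: (near_imp der) => w [_ Hw]; rewrite /partial Hw.
apply: Cnear_sum => j; apply: CnearM; first exact: Cnear_partial.
by apply: IH; [exact: Cnear_partial|move=> l; exact: CnearS].
Unshelve. all: end_near. Qed.


End Euclid.

(** * Symmetry of second partial derivatives *)

Section Schwarz.
Variables (R : realType) (n : nat).
Implicit Types (f : 'rV[R]_n -> R) (y : 'rV[R]_n) (i j : 'I_n).

(** The mean value theorem is applied along e_i to phi x = f (x + h e_j) - f x, then along e_j to
    the partial of f that appears. The mixed partial at the resulting point is within e of its value
    at y. *)
Lemma second_difference f y i j (e : R) : Cnear 2 f y -> 0 < e ->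
  \forall h \near (0 : R), 
    `|(f (y + h *: delta_mx 0 i + h *: delta_mx 0 j) - f (y + h *: delta_mx 0 i))
     - (f (y + h *: delta_mx 0 j) - f y)
     - h * (h * partial j (partial i f) y)| <= h * h * e.
Proof.
move=> Cf e0.
pose ei : 'rV[R]_n := delta_mx 0 i; pose ej : 'rV[R]_n := delta_mx 0 j.
have : \forall z \near y, Cnear 2 f z /\
    `|partial j (partial i f) z - partial j (partial i f) y| < e.
  apply: (near_imp2 (Cnear_near Cf)) => [|z]; last by exact: conj.
  have /Cnear_cont cf := Cnear_partial j (Cnear_partial i Cf).
  have cf' : \forall z \near y,
      `|partial j (partial i f) y - partial j (partial i f) z| < e.
    by move/cvgrPdist_lt : cf => /(_ _ e0).
  by apply: (near_imp cf') => z H; rewrite (distrC (partial j (partial i f) z)).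
move=> /(@nbhs_normP R 'rV[R]_n)[d /= d0 Hd].
have {}Hd z : `|z - y| < d -> Cnear 2 f z /\
    `|partial j (partial i f) z - partial j (partial i f) y| < e.
  by move=> zy; apply: Hd; rewrite /= distrC.
(* For |s|, |t| <= |h| the norm of s e_i + t e_j is at most |h| K; the summand 1 makes K
   positive. *)
pose K := `|ei| + `|ej| + 1.
have K0 : 0 < K by rewrite ltr_wpDl// addr_ge0.
near=> h.
have hd : `|h| * K < d.
  rewrite -ltr_pdivlMr//; near: h; apply: (@nbhs0_lt R R^o); exact: divr_gt0.
have inball (s t : R) : `|s| <= `|h| -> `|t| <= `|h| -> `|y + s *: ei + t *: ej - y| < d.
  move=> sh th; rewrite -(addrA y) (addrC y) addrK; apply: le_lt_trans hd.
  apply: (le_trans (ler_normD _ _)); rewrite !normrZ.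
  by rewrite /K 2!mulrDr mulr1 ler_wpDr// lerD// ler_wpM2r.
pose phi (x : 'rV[R]_n) := f (x + h *: ej) - f x.
have dphi (t : R) : `|t| <= `|h| -> is_derive (y + t *: ei) ei phi
    (partial i f (y + t *: ei + h *: ej) - partial i f (y + t *: ei)).
  move=> th; apply: is_deriveB; last first.
    apply: derivableP; apply: (@Cnear_derivable _ _ 1).
    by have := inball t 0 th; rewrite normr0 scale0r addr0 => /(_ (normr_ge0 _))/Hd[].
  have /Hd[Cs _] := inball t h th (lexx _).
  have := @Cnear_derivable _ _ 1 _ _ i Cs.
  have E : (fun h0 : R => h0^-1 *: (f (h0 *: ei + (y + t *: ei + h *: ej)) - f (y + t *: ei + h *: ej))) =
    (fun h0 : R => h0^-1 *: (f (h0 *: ei + (y + t *: ei) + h *: ej) - f (y + t *: ei + h *: ej))).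
    by apply/funext => h0; rewrite [in LHS]addrA.
  move=> dv; apply: DeriveDef; move: dv; rewrite /partial /derivable /derive/= -/ei E //.
have dphi' (t : R) : `|t| <= `|h| -> derivable phi (y + t *: ei) ei.
  by move=> /dphi dt; exact: ex_derive.
have [t th E1] := MVT_line dphi'.
have [s sh E2] := @MVT_line _ _ (partial i f) (y + t *: ei) ej h (fun s sh =>
  Cnear_derivable (i := j) (Cnear_partial i (Hd _ (inball t s th sh)).1)).
have -> : f (y + h *: ei + h *: ej) - f (y + h *: ei) - (f (y + h *: ej) - f y)
    = h * (h * partial j (partial i f) (y + t *: ei + s *: ej)).
  rewrite -[LHS]/(phi (y + h *: ei) - phi y) E1.
  have [_ ->] := dphi _ th.
  by rewrite E2.
rewrite -mulrBr -mulrBr mulrA normrM.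
have /Hd[_ lte] := inball t s th sh.
rewrite (@ger0_norm _ (h * h)) -?expr2 ?sqr_ge0// ler_wpM2l ?sqr_ge0//.
exact: ltW.
Unshelve. all: end_near. Qed.

Lemma near0_pick (P Q : R -> Prop) :
  (\forall h \near (0 : R), P h) -> (\forall h \near (0 : R), Q h) ->
  exists h, h != 0 /\ P h /\ Q h.
Proof.
move=> HP HQ; near (0 : R)^' => h; exists h; split.
  by near: h; exact: nbhs_dnbhs_neq.
split; first by near: h; exact: nbhs_dnbhs.
by near: h; exact: nbhs_dnbhs.
Unshelve. all: end_near. Qed.

(** The second difference is symmetric in i and j, so by [second_difference] the two mixed partials,
    multiplied by h^2, differ by at most h^2 e, for every e > 0 and a suitable nonzero h. *)
Lemma partialC f y i j : Cnear 2 f y ->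
  partial i (partial j f) y = partial j (partial i f) y.
Proof.
move=> Cf; apply/eqP; rewrite -subr_eq0 -normr_le0; apply/ler_addgt0Pl => e e0; rewrite addr0.
have e20 : 0 < e / 2 by rewrite divr_gt0.
have H1 := second_difference i j Cf e20; have H2 := second_difference j i Cf e20.
have [h [h0 [D1 D2]]] := near0_pick H1 H2.
have hh : 0 < h * h by rewrite -expr2 exprn_even_gt0//= h0.
rewrite -(ler_pM2l hh) -[X in X * `|_|](ger0_norm (ltW hh)) -normrM.
move: D1 D2; rewrite (addrAC y (h *: delta_mx 0 j)).
set a := f _; set b := f _; set c := f _; set u := partial j _ _; set v := partial i _ _.
set w := f y.
move=> D1 D2; rewrite (_ : h * h * (v - u) =
   (a - b - (c - w) - h * (h * u)) - (a - c - (b - w) - h * (h * v))); last by ring.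
apply: (le_trans (ler_normB _ _)); apply: (le_trans (lerD D1 D2)).
by rewrite -mulrDr -splitr.
Qed.

End Schwarz.

(** * Integrals depending on parameters *)

Section ParamIntegral.
Variables (R : realType) (n : nat).
Local Notation mu01 := (@lebesgue_measure R).
Implicit Types (K : 'rV[R]_(1 + n) -> R) (w : 'rV[R]_n).

(** The integration variable is stored as the first coordinate, so that joint regularity in (s, w)
    becomes [Cnear] on a single row space. *)
Definition cons_rV (s : R) w : 'rV[R]_(1 + n) := row_mx (s%:M : 'rV_1) w.

Definition integral01 K w : R := \int[mu01]_(s in `[0, 1]) K (cons_rV s w).

Lemma cons_rV_continuous (z : R * 'rV[R]_n) :
  {for z, continuous (fun z : R * 'rV[R]_n => cons_rV z.1 z.2)}.
Proof.
apply: continuous_rV => j; rewrite /cons_rV.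
case: (split_ordP j) => k ->.
  rewrite (_ : (fun t => _) = (fun t : R * 'rV[R]_n => t.1)).
    exact: cvg_fst.
  by apply/funext => t; rewrite row_mxEl (ord1 k) mxE eqxx.
rewrite (_ : (fun t => _) = (fun t : R * 'rV[R]_n => t.2 0 k)).
  apply: (@continuous_comp _ _ _ snd (fun w : 'rV[R]_n => w 0 k)).
    exact: cvg_snd.
  exact: coord_continuous.
by apply/funext => t; rewrite row_mxEr.
Qed.

(** The tube lemma: compactness of [0, 1] lets the neighbourhoods of the points (s, w) share one
    neighbourhood of w. *)
Lemma near01 (P : R -> 'rV[R]_n -> Prop) w :
  (forall s : R, s \in `[0, 1] -> \forall z \near (s, w), P z.1 z.2) ->
  \forall w' \near w, forall s : R, s \in `[0, 1] -> P s w'.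
Proof.
move=> HP.
have /compact_near_coveringP cov := @segment_compact R 0 1.
have := cov _ (nbhs w) (fun w' s => P s w') _.
by apply=> s s01; exact: HP.
Qed.

Lemma tube01 (P : 'rV[R]_(1 + n) -> Prop) w :
  (forall s : R, s \in `[0, 1] -> \forall v \near cons_rV s w, P v) ->
  \forall w' \near w, forall s : R, s \in `[0, 1] -> P (cons_rV s w').
Proof.
move=> HP; apply: (@near01 (fun s w' => P (cons_rV s w'))) => s s01.
exact: (@cons_rV_continuous (s, w)) (HP s s01).
Qed.

Lemma cons_rV_continuous1 (s : R) w : {for s, continuous (fun s => cons_rV s w)}.
Proof.
apply: (@continuous_comp _ _ _ (fun s : R => (s, w)) (fun z : R * 'rV[R]_n => cons_rV z.1 z.2)).
  by apply: continuous_pair; [exact: cvg_id|exact: cst_continuous].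
exact: cons_rV_continuous.
Qed.

Lemma integrable01 (f : R -> R) : (forall s : R, s \in `[0, 1] -> {for s, continuous f}) ->
  mu01.-integrable `[0, 1]%classic (EFin \o f).
Proof.
move=> cf; apply: continuous_compact_integrable; first exact: segment_compact.
apply: continuous_in_subspaceT => s; rewrite inE => s01; exact: cf.
Qed.

Lemma cont_cons K w (s : R) : {for cons_rV s w, continuous K} ->
  {for s, continuous (fun s => K (cons_rV s w))}.
Proof.
move=> cK; apply: (@continuous_comp _ _ _ (fun s => cons_rV s w) K) => //.
exact: cons_rV_continuous1.
Qed.

Lemma Rintegral01_cst (c : R) : \int[mu01]_(s in `[0, 1]) c = c.
Proof.
by rewrite Rintegral_cst//= lebesgue_measure_itv/= lte_fin ltr01 oppr0 adde0 mulr1.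
Qed.

Lemma integral01_cont K w :
  (forall s : R, s \in `[0, 1] -> \forall v \near cons_rV s w, {for v, continuous K}) ->
  {for w, continuous (integral01 K)}.
Proof.
move=> CK; apply: continuous_dist => e e0.
have e20 : 0 < e / 2 by rewrite divr_gt0.
have cw (s : R) : s \in `[0, 1] -> {for cons_rV s w, continuous K}.
  by move=> /CK/nbhs_singleton.
have near1 : \forall w' \near w, forall s : R, s \in `[0, 1] ->
    `|K (cons_rV s w) - K (cons_rV s w')| <= e.
  apply: (@near01 (fun s w' => `|K (cons_rV s w) - K (cons_rV s w')| <= e)) => s s01.
  have c1 := cw _ s01.
  have N : \forall v \near cons_rV s w, `|K (cons_rV s w) - K v| < e / 2.
    by move/cvgrPdist_lt : c1 => /(_ _ e20).
  (* In [near01] both variables move, so the values at (z.1, z.2) and at (z.1, w) are each compared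
     with the value at (s, w). *)
  have N1 : \forall z \near (s, w), `|K (cons_rV s w) - K (cons_rV z.1 z.2)| < e / 2.
    exact: (@cons_rV_continuous (s, w)) N.
  have N2 : \forall z \near (s, w), `|K (cons_rV s w) - K (cons_rV z.1 w)| < e / 2.
    have cc := @cons_rV_continuous1 s w.
    have : \forall z1 \near s, `|K (cons_rV s w) - K (cons_rV z1 w)| < e / 2.
      exact: cc N.
    have cf := @cvg_fst _ _ (nbhs s) (nbhs w) _.
    by move=> H; exact: cf H.
  apply: (near_imp2 N1 N2) => z z1 z2.
  rewrite (_ : K _ - K _ = (K (cons_rV s w) - K (cons_rV z.1 z.2))
     - (K (cons_rV s w) - K (cons_rV z.1 w))); last by ring.
  by rewrite (le_trans (ler_normB _ _))// (splitr e) lerD// ltW.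
have near2 := tube01 CK.
apply: (near_imp2 near1 near2) => w' l1 c2.
have i1 : mu01.-integrable `[0, 1]%classic (EFin \o (fun s => K (cons_rV s w))).
  by apply: integrable01 => s s01; apply: cont_cons; exact: cw.
have i2 : mu01.-integrable `[0, 1]%classic (EFin \o (fun s => K (cons_rV s w'))).
  by apply: integrable01 => s s01; apply: cont_cons; exact: c2.
have i3 : mu01.-integrable `[0, 1]%classic (EFin \o (fun s => K (cons_rV s w) - K (cons_rV s w'))).
  apply: integrable01 => s s01; apply: continuousB; apply: cont_cons; [exact: cw|exact: c2].
have i4 : mu01.-integrable `[0, 1]%classic (EFin \o (fun s => `|K (cons_rV s w) - K (cons_rV s w')|)).
  apply: integrable01 => s s01.
  apply: (@continuous_comp _ _ _ (fun s => K (cons_rV s w) - K (cons_rV s w')) Num.norm).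
    apply: continuousB; apply: cont_cons; [exact: cw|exact: c2].
  exact: norm_continuous.
rewrite /integral01 -RintegralB//.
apply: (le_trans (le_normr_Rintegral _ i3)) => //.
rewrite -[leRHS]Rintegral01_cst; apply: le_Rintegral => //.
by apply: integrable01 => s s01; exact: cst_continuous.
Qed.

(** Dominated differentiation on the line through w in direction e_i. The dominating function is a
    constant B that bounds the partial derivative for all s in [0, 1] and all parameters near w. *)
Lemma integral01_is_derive K w i :
  (forall s : R, s \in `[0, 1] -> Cnear 1 K (cons_rV s w)) ->
  is_derive w (delta_mx 0 i) (integral01 K) (integral01 (partial (rshift 1 i) K) w).
Proof.
move=> CK.
pose K' := partial (rshift 1 i) K.
have CK1 := tube01 (fun s s01 => Cnear_near (CK s s01)).
have CK' (s : R) : s \in `[0, 1] -> {for cons_rV s w, continuous K'}.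
  by move=> s01; apply: (@Cnear_cont _ _ 0%N); apply: Cnear_partial; exact: CK.
have [B B0 HB] : exists2 B : R, 0 <= B & \forall w' \near w, forall s : R, s \in `[0, 1] ->
    `|K' (cons_rV s w')| <= B.
  have /compact_near_coveringP cov := @segment_compact R 0 1.
  (* The bound is a variable of its own, tending to +oo in the product filter; compactness then
     yields one bound valid for all s. *)
  have := cov _ (filter_prod (+oo : set_system R) (nbhs w)) (fun z s => `|K' (cons_rV s z.2)| <= z.1) _.
  move=> covP.
  have : \forall z \near filter_prod (+oo : set_system R) (nbhs w),
     forall s : R, s \in `[0, 1] -> `|K' (cons_rV s z.2)| <= z.1.
    apply: covP => s s01; have cK := CK' s s01.
    have N : \forall v \near cons_rV s w, `|K' v| <= `|K' (cons_rV s w)| + 1.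
      move/cvgrPdist_lt : cK => /(_ _ ltr01) N; apply: (near_imp N) => v vl.
      rewrite -[K' v](subrK (K' (cons_rV s w))) addrC.
      by rewrite (le_trans (ler_normD _ _))// lerD2l distrC ltW.
    have [/= [A1 A2] [A1s A2w] A12] := @cons_rV_continuous (s, w) _ N.
    exists (A1, [set z : R * 'rV[R]_n | `|K' (cons_rV s w)| + 1 <= z.1 /\ A2 z.2]) => /=.
      split=> //; exists ([set r : R | `|K' (cons_rV s w)| + 1 <= r], A2) => //=.
      by split=> //; apply: nbhs_pinfty_ge; rewrite num_real.
    move=> [s' [r w']] /= [A1s' [rl A2w']].
    by apply: le_trans rl; apply: (A12 (s', w')).
  move=> [[A1 A2] /= [[M [_ A1M]] A2w] A12].
  exists (`|M| + 1); first by rewrite addr_ge0.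
  apply: (near_imp A2w) => w' A2w' s s01.
  apply: (A12 (`|M| + 1, w')) => //; split=> //=; apply: A1M.
  by rewrite (le_lt_trans (ler_norm _))// ltrDl.
have [d d0 Hd] : exists2 d : R, 0 < d & forall x : R, `|x| < d -> forall s : R, s \in `[0, 1] ->
    Cnear 1 K (cons_rV s (w + x *: delta_mx 0 i)) /\
    `|K' (cons_rV s (w + x *: delta_mx 0 i))| <= B.
  have cl : {for (0 : R), continuous (fun x : R => w + x *: (delta_mx 0 i : 'rV[R]_n))}.
    apply: continuousD; first exact: cst_continuous.
    exact: scalel_continuous.
  have : \forall x \near (0 : R), forall s : R, s \in `[0, 1] ->
      Cnear 1 K (cons_rV s (w + x *: delta_mx 0 i)) /\
    `|K' (cons_rV s (w + x *: delta_mx 0 i))| <= B.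
    have H : \forall w' \near w + 0 *: (delta_mx 0 i : 'rV[R]_n), forall s : R, s \in `[0, 1] ->
        Cnear 1 K (cons_rV s w') /\ `|K' (cons_rV s w')| <= B.
      rewrite scale0r addr0; apply: (near_imp2 CK1 HB) => w' h1 h2 s s01; split; [exact: h1|exact: h2].
    exact: cl H.
  move=> /nbhs_norm0P[d /= d0 Hd]; exists d => //.
have Hd' (x s : R) : `]- d, d[%classic x -> s \in `[0, 1] ->
    Cnear 1 K (cons_rV s (w + x *: delta_mx 0 i)) /\
    `|K' (cons_rV s (w + x *: delta_mx 0 i))| <= B.
  by rewrite /= in_itv/= -ltr_norml => xd; apply: Hd.
have consE (s x : R) : cons_rV s (w + x *: delta_mx 0 i) =
    cons_rV s w + x *: delta_mx 0 (rshift 1 i) by exact: row_mx_rshift_line.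
pose F (x s : R) := K (cons_rV s (w + x *: delta_mx 0 i)).
have dF (x s : R) : `]- d, d[%classic x -> s \in `[0, 1] -> is_derive x 1 (F ^~ s)
   (K' (cons_rV s (w + x *: delta_mx 0 i))).
  move=> xd s01; have [C1 _] := Hd' _ _ xd s01.
  have := @line_is_derive _ _ K (cons_rV s w) (delta_mx 0 (rshift 1 i)) x.
  rewrite -consE => /(_ (@Cnear_derivable _ _ 0%N _ _ _ C1)).
  by rewrite (_ : (fun s0 : R => _) = F ^~ s)//; apply/funext => s0; rewrite /F consE.
have p1F (x s : R) : `]- d, d[%classic x -> s \in `[0, 1] -> partial1of2 F x s = K' (cons_rV s (w + x *: delta_mx 0 i)).
  by move=> xd s01; have [_ dd] := dF _ _ xd s01; rewrite partial1of2E dd.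
have Id0 : `]- d, d[%classic (0 : R) by rewrite /= in_itv/= oppr_lt0 d0.
have intF (x : R) : `]- d, d[%classic x -> mu01.-integrable `[0, 1]%classic (EFin \o F x).
  move=> xd; apply: integrable01 => s s01; apply: cont_cons.
  by have [C1 _] := Hd' _ _ xd s01; exact: Cnear_cont C1.
have derF (x s : R) : `]- d, d[%classic x -> `[0, 1]%classic s -> derivable (F ^~ s) x 1.
  by move=> xd s01; have dd := dF _ _ xd s01; exact: ex_derive.
have intB : mu01.-integrable `[0, 1]%classic (EFin \o (fun=> B)).
  by apply: integrable01 => s s01; exact: cst_continuous.
have ubF (x s : R) : `]- d, d[%classic x -> `[0, 1]%classic s -> `|partial1of2 F x s| <= B.
  by move=> xd s01; rewrite p1F//; have [] := Hd' _ _ xd s01.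
have := @cvg_differentiation_under_integral R _ _ mu01 F `[0, 1]%classic (measurable_itv _)
  0 (- d) d Id0 intF derF (fun=> B) (fun=> B0) intB ubF.
have -> : \int[mu01]_(y in `[0, 1]) partial1of2 F 0 y = integral01 K' w.
  apply: eq_Rintegral => s; rewrite inE => s01.
  by rewrite p1F// scale0r addr0.
have -> : (fun h : R => h^-1 *: (\int[mu01]_(y in `[0, 1]) F (h + 0) y - \int[mu01]_(y in `[0, 1]) F 0 y))
   = (fun h : R => h^-1 *: (integral01 K (h *: delta_mx 0 i + w) - integral01 K w)).
  apply/funext => h; rewrite addr0; congr (_ *: (_ - _)).
    by apply: eq_Rintegral => s _; rewrite /F addrC.
  by apply: eq_Rintegral => s _; rewrite /F scale0r addr0.
move=> lim0; apply: DeriveDef; first by apply/cvg_ex; eexists; exact: lim0.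
exact/cvg_lim.
Qed.

Lemma Cnear_integral01 k K w :
  (forall s : R, s \in `[0, 1] -> Cnear k K (cons_rV s w)) -> Cnear k (integral01 K) w.
Proof.
elim: k K w => [|k IH] K w CK.
  split=> //; have N := tube01 (fun s s01 => Cnear_near (CK s s01)).
  apply: (near_imp N) => w' CK'; apply: integral01_cont => s s01.
  by have [] := CK' s s01.
have N := tube01 (fun s s01 => Cnear_near (CK s s01)).
split.
  apply: (near_imp N) => w' CK'; apply: integral01_cont => s s01.
  by have [] := CK' s s01.
move=> i.
have der : \forall w' \near w, is_derive w' (delta_mx 0 i) (integral01 K)
     (integral01 (partial (rshift 1 i) K) w').
  by apply: (near_imp N) => w' CK'; apply: integral01_is_derive => s s01; apply: (@Cnear1 _ _ k); exact: CK'.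
split; first by apply: (near_imp der) => w' dw; exact: ex_derive.
apply: (@Cnear_eq _ _ _ (integral01 (partial (rshift 1 i) K))).
  by apply: (near_imp der) => w' [_ dw]; rewrite /partial dw.
by apply: IH => s s01; apply: Cnear_partial; exact: CK.
Qed.

End ParamIntegral.

(** * Smooth functions in charts *)

Section ManifoldCalculus.
Variable R : realType.
Implicit Types M N : premanifold R.

(** The fragment of [is_manifold] on which calculus in charts rests. It passes directly to R^n and
    to products, which are built as bare [premanifold]s. *)
Definition has_charts M : Prop :=
  (forall phi, matlas M phi -> is_chart phi) /\
  (forall x : M, exists2 phi, matlas M phi & cdom phi x).

Lemma manifold_has_charts M : is_manifold M -> has_charts M.
Proof. by case. Qed.

Lemma near_chart (T : topologicalType) n (phi : chart R T n) (x : T) (A : set T) :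
  is_chart phi -> cdom phi x -> nbhs x A ->
  \forall z \near cmap phi x,
    [/\ cdom phi (cinv phi z), A (cinv phi z) & cmap phi (cinv phi z) = z].
Proof.
move=> [od oi K cm ci] xd Ax.
have xi : cimg phi (cmap phi x) by exists x.
have N1 : nbhs (cmap phi x) (cimg phi) by apply: open_nbhs_nbhs.
have N2 : \forall z \near cmap phi x, A (cinv phi z).
  by apply: (ci _ xi); rewrite K.
apply: (near_imp2 N1 N2) => z [w wd <-]; rewrite K// => Aw; split=> //.
Qed.

Definition smooth_near k M (f : M -> R) (x : M) : Prop :=
  forall phi, matlas M phi -> cdom phi x ->
    Cnear k (fun y => f (cinv phi y)) (cmap phi x).

Lemma smoothRP M (f : M -> R) : has_charts M ->
  smoothR f <-> (forall x k, smooth_near k f x).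
Proof.
move=> [cM _]; split.
  move=> sf x k phi aphi xd; apply: Csmooth_Cnear (sf _ aphi).
  have [od oi _ _ _] := cM _ aphi.
  by apply: open_nbhs_nbhs; split=> //; exists x.
move=> sf phi aphi; apply: Cnear_Csmooth => y [x xd <-] k; exact: sf.
Qed.

Definition smooth_map_near k M N (F : M -> N) (x : M) : Prop :=
  {for x, continuous F} /\
  forall phi psi, matlas M phi -> matlas N psi -> cdom phi x -> cdom psi (F x) ->
    forall i, Cnear k (fun y => cmap psi (F (cinv phi y)) 0 i) (cmap phi x).

Lemma smooth_on_near k M N (U : set M) (F : M -> N) x :
  has_charts M -> has_charts N -> open U -> U x -> smooth_on U F -> smooth_map_near k F x.
Proof.
move=> [cM _] [cN _] oU Ux [cF sF]; split; first exact: cF.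
move=> phi psi aphi apsi xd Fxd i; apply: Csmooth_Cnear (sF _ _ aphi apsi i).
have NU : nbhs x U by apply: open_nbhs_nbhs.
have NF : nbhs x (F @^-1` cdom psi).
  apply: (cF _ Ux); apply: open_nbhs_nbhs; split=> //.
  by have [] := cN _ apsi.
have NUF : nbhs x (U `&` F @^-1` cdom psi) by apply: filterI.
have H := near_chart (cM _ aphi) xd NUF.
suff : \forall z \near cmap phi x, (cmap phi @` (cdom phi `&` U `&` F @^-1` cdom psi)) z by [].
by apply: (near_imp H) => z [zd [zU zF] zE]; exists (cinv phi z).
Qed.

(** With psi a chart at F x, the function f o F is (f o psi^-1) o (psi o F) near x: continuity of F
    keeps the nearby values in the domain of psi, and [Cnear_comp] applies. *)
Lemma smooth_near_comp k M N (F : M -> N) (f : N -> R) x :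
  has_charts M -> has_charts N ->
  smooth_map_near k F x -> smooth_near k f (F x) -> smooth_near k (fun z => f (F z)) x.
Proof.
move=> [cM _] [cN hN] [cF sF] sf phi aphi xd.
have [psi apsi Fxd] := hN (F x).
have [_ _ Kphi _ _] := cM _ aphi; have [opsi _ Kpsi _ _] := cN _ apsi.
have NF : nbhs x (F @^-1` cdom psi).
  by apply: cF; apply: open_nbhs_nbhs.
apply: (@Cnear_eq _ _ _ (fun y => f (cinv psi (cmap psi (F (cinv phi y)))))).
  have H := near_chart (cM _ aphi) xd NF.
  by apply: (near_imp H) => z [_ zF _]; rewrite Kpsi.
apply: (@Cnear_comp _ _ _ _ (fun w => f (cinv psi w)) (fun y => cmap psi (F (cinv phi y)))).
  by rewrite Kphi//; exact: sf.
by move=> i; exact: sF.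
Qed.

Lemma smoothR_comp M N (F : M -> N) (f : N -> R) :
  has_charts M -> has_charts N -> smooth_map F -> smoothR f -> smoothR (fun x => f (F x)).
Proof.
move=> hM hN sF /(smoothRP _ hN) sf; apply/(smoothRP _ hM) => x k.
apply: smooth_near_comp => //.
by apply: smooth_on_near sF => //; exact: openT.
Qed.

Lemma Rn_has_charts n : has_charts (Rn R n).
Proof.
split; last by move=> x; exists (Chart setT id id).
move=> _ ->; split.
- exact: openT.
- rewrite /cimg/= image_id; exact: openT.
- by [].
- by move=> x _; exact: cvg_id.
- by move=> x _; exact: cvg_id.
Qed.

Lemma is_chart_prod (S T : topologicalType) m n (phi : chart R S m) (psi : chart R T n) :
  is_chart phi -> is_chart psi -> is_chart (prod_chart phi psi).
Proof.
move=> [od1 oi1 K1 cm1 ci1] [od2 oi2 K2 cm2 ci2].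
have imgE (y : 'rV[R]_(m + n)) : cimg (prod_chart phi psi) y ->
    cimg phi (lsubmx y) /\ cimg psi (rsubmx y).
  by move=> [[a b] [/= ad bd] <-]; rewrite row_mxKl row_mxKr; split; [exists a|exists b].
have cl (y : 'rV[R]_(m + n)) : {for y, continuous (fun z : 'rV[R]_(m + n) => lsubmx z)}.
  by apply: continuous_rV => j; apply: (Cnear_cont (k := 0%N)); exact: Cnear_lsubmx.
have cr (y : 'rV[R]_(m + n)) : {for y, continuous (fun z : 'rV[R]_(m + n) => rsubmx z)}.
  by apply: continuous_rV => j; apply: (Cnear_cont (k := 0%N)); exact: Cnear_rsubmx.
split.
- rewrite openE => -[a b] [/= ad bd].
  exists (cdom phi, cdom psi) => /=; first by split; apply: open_nbhs_nbhs.
  by move=> [a' b'].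
- rewrite openE => y /imgE[y1 y2].
  have N1 : \forall z \near y, cimg phi (lsubmx z) by apply: cl; apply: open_nbhs_nbhs.
  have N2 : \forall z \near y, cimg psi (rsubmx z) by apply: cr; apply: open_nbhs_nbhs.
  apply: (near_imp2 N1 N2) => z [a ad aE] [b bd bE]; exists (a, b) => //=.
  by rewrite aE bE hsubmxK.
- by move=> [a b] [/= ad bd]; rewrite row_mxKl row_mxKr K1// K2.
- move=> [a b] [/= ad bd]; apply: continuous_rV => j; case: (split_ordP j) => i ->.
    rewrite (_ : (fun t => _) = (fun t : S * T => cmap phi t.1 0 i)); last first.
      by apply/funext => t; rewrite row_mxEl.
    apply: (@continuous_comp _ _ _ (fun t : S * T => cmap phi t.1) (fun w : 'rV[R]_m => w 0 i)).
      apply: (@continuous_comp _ _ _ fst (cmap phi)); first exact: cvg_fst.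
      exact: cm1.
    exact: coord_continuous.
  rewrite (_ : (fun t => _) = (fun t : S * T => cmap psi t.2 0 i)); last first.
    by apply/funext => t; rewrite row_mxEr.
  apply: (@continuous_comp _ _ _ (fun t : S * T => cmap psi t.2) (fun w : 'rV[R]_n => w 0 i)).
    apply: (@continuous_comp _ _ _ snd (cmap psi)); first exact: cvg_snd.
    exact: cm2.
  exact: coord_continuous.
- move=> y /imgE[y1 y2].
  have c1 : {for y, continuous (fun z : 'rV[R]_(m + n) => cinv phi (lsubmx z))}.
    by apply: (@continuous_comp _ _ _ (fun z : 'rV[R]_(m + n) => lsubmx z) (cinv phi)) => //; exact: ci1.
  have c2 : {for y, continuous (fun z : 'rV[R]_(m + n) => cinv psi (rsubmx z))}.
    by apply: (@continuous_comp _ _ _ (fun z : 'rV[R]_(m + n) => rsubmx z) (cinv psi)) => //; exact: ci2.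
  exact: continuous_pair.
Qed.

Lemma prod_has_charts M N : has_charts M -> has_charts N -> has_charts (prodm M N).
Proof.
move=> [cM hM] [cN hN]; split.
  by move=> _ [phi [psi [a1 a2 ->]]]; apply: is_chart_prod; [exact: cM|exact: cN].
move=> [x y]; have [phi aphi xd] := hM x; have [psi apsi yd] := hN y.
by exists (prod_chart phi psi) => //; exists phi, psi.
Qed.

Lemma smooth_near_prodl k M N (f : M * N -> R) (x : M) (y : N) : has_charts N ->
  @smooth_near k (prodm M N) f (x, y) -> smooth_near k (fun z => f (z, y)) x.
Proof.
move=> [cN hN] sf phi aphi xd; have [psi apsi yd] := hN y.
have [_ _ Kpsi _ _] := cN _ apsi.
have a : matlas (prodm M N) (prod_chart phi psi) by exists phi, psi.
have := sf _ a (conj xd yd) => /= Cf.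
have := @Cnear_comp _ k _ _ _ (fun u : 'rV[R]_(mdim M) => row_mx u (cmap psi y)) _ Cf.
move=> /(_ (@Cnear_row_mx _ k _ _ _ id (fun=> cmap psi y) _
  (fun j => Cnear_coord k _ j) (fun j => Cnear_cst k _ _))).
by under eq_fun do rewrite row_mxKl row_mxKr Kpsi//.
Qed.

Lemma smoothR_cst M (c : R) : smoothR (fun _ : M => c).
Proof. by move=> phi _; apply: Cnear_Csmooth => y _ k; exact: Cnear_cst. Qed.

Lemma smoothR_add M (f g : M -> R) : has_charts M ->
  smoothR f -> smoothR g -> smoothR (fun x => f x + g x).
Proof.
move=> hM /(smoothRP _ hM) sf /(smoothRP _ hM) sg; apply/(smoothRP _ hM) => x k phi a xd.
by apply: CnearD; [exact: sf|exact: sg].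
Qed.

Lemma smoothR_mul M (f g : M -> R) : has_charts M ->
  smoothR f -> smoothR g -> smoothR (fun x => f x * g x).
Proof.
move=> hM /(smoothRP _ hM) sf /(smoothRP _ hM) sg; apply/(smoothRP _ hM) => x k phi a xd.
by apply: CnearM; [exact: sf|exact: sg].
Qed.

Lemma smoothR_scale M (a : R) (f : M -> R) : has_charts M ->
  smoothR f -> smoothR (fun x => a * f x).
Proof. by move=> hM sf; apply: smoothR_mul => //; exact: smoothR_cst. Qed.

Lemma smoothR_opp M (f : M -> R) : has_charts M -> smoothR f -> smoothR (fun x => - f x).
Proof.
move=> hM sf; rewrite (_ : (fun x => - f x) = (fun x => -1 * f x)).
  exact: smoothR_scale.
by apply/funext => x; rewrite mulN1r.
Qed.

Lemma smoothR_sum M (I : Type) (r : seq I) (P : pred I) (f : I -> M -> R) : has_charts M ->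
  (forall i, smoothR (f i)) -> smoothR (fun x => \sum_(i <- r | P i) f i x).
Proof.
move=> hM sf; apply/(smoothRP _ hM) => x k phi a xd.
by apply: Cnear_sum => i; move/(smoothRP _ hM): (sf i); exact.
Qed.

End ManifoldCalculus.

(** * Bump functions and the exponential curve *)

Section FlatFunction.
Variable R : realType.

(* The family, unlike [flat 0] alone, is closed under differentiation. *)
Definition flat (m : nat) (x : R) : R :=
  if 0 < x then x^-1 ^+ m * expR (- x^-1) else 0.

(** With y = 1 / x this is y^(m+1) / (m+1)! <= exp y. The linear bound gives the continuity of every
    [flat m] at 0. *)
Lemma flat_le m (x : R) : `|flat m x| <= (m.+1)`!%:R * `|x|.
Proof.
rewrite /flat; case: ltP => [x0|_]; last by rewrite normr0 mulr_ge0.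
have y0 : 0 < x^-1 by rewrite invr_gt0.
rewrite ger0_norm ?mulr_ge0 ?exprn_ge0 ?expR_ge0 ?(ltW y0)// (gtr0_norm x0).
have f0 : 0 < (m.+1)`!%:R :> R by rewrite ltr0n fact_gt0.
have := expR_ge1Dxn m (ltW y0).
have e0 : 0 < expR x^-1 by exact: expR_gt0.
rewrite expRN ler_pdivrMr// => H.
have H1 : x^-1 ^+ m.+1 / (m.+1)`!%:R <= expR x^-1.
  by apply: le_trans H; rewrite lerDr.
rewrite ler_pdivrMr// in H1.
rewrite -(ler_pM2l y0) -exprS (le_trans H1)//.
by rewrite mulrC -mulrA mulrCA (mulrA _ x) mulVf ?gt_eqF// mul1r.
Qed.

Lemma flat0 m : flat m 0 = 0.
Proof. by rewrite /flat ltxx. Qed.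

Lemma flat_is_derive m (x : R) :
  is_derive x 1 (flat m) (flat m.+2 x - m%:R * flat m.+1 x).
Proof.
have [x0|x0|->] := ltgtP x 0.
- have -> : flat m.+2 x - m%:R * flat m.+1 x = 0.
    by rewrite /flat ltNge (ltW x0)/= mulr0 subr0.
  apply: (@near_eq_is_derive _ _ _ (cst 0)).
  have N : \forall z \near x, z < 0 by exact: lt_nbhsl.
  by apply: (near_imp N) => z z0; rewrite /flat ltNge (ltW z0).
- have dq : is_derive x 1 (fun y : R => y^-1) (- x^-1 ^+ 2).
    have := @is_deriveV R id x 1 1 (lt0r_neq0 x0) (is_derive_id _ _).
    by rewrite [_ *: 1]mulr1 exprVn.
  have dN : is_derive x 1 (fun y : R => - y^-1) (x^-1 ^+ 2).
    by rewrite -[X in is_derive _ _ _ X]opprK; exact: is_deriveN.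
  have dE : is_derive x 1 (fun y : R => expR (- y^-1)) (expR (- x^-1) * x^-1 ^+ 2).
    by have := @is_derive1_comp _ expR (fun y : R => - y^-1) x _ _ (is_derive_expR _) dN.
  have dX : is_derive x 1 (fun y : R => y^-1 ^+ m) ((m%:R * x^-1 ^+ m.-1) * - x^-1 ^+ 2).
    rewrite (_ : (fun y : R => y^-1 ^+ m) = (fun y : R => y^-1) ^+ m); last first.
      by apply/funext => y; rewrite exprfctE.
    exact: (@is_deriveX _ _ (fun y : R => y^-1) m x 1 _ dq).
  have dM := is_deriveM dX dE.
  apply: (@near_eq_is_derive _ _ _ (fun y : R => y^-1 ^+ m * expR (- y^-1))).
    have N : \forall z \near x, 0 < z by exact: lt_nbhsr.
    by apply: (near_imp N) => z z0; rewrite /flat z0.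
  apply: is_derive_eq dM _.
  rewrite /flat x0 /= /GRing.scale/=.
  case: m {dX} => [|m]; rewrite /= !exprS; ring.
- rewrite !flat0 mulr0 subr0.
  have lim0 : (fun h : R => h^-1 *: (flat m (h *: 1 + 0) - flat m 0)) @ 0^' --> (0 : R).
    (* At 0 the difference quotient of [flat m] is [flat m.+1] itself, so the derivative there is a
       limit controlled by [flat_le]. *)
    have E : (fun h : R => h^-1 *: (flat m (h *: 1 + 0) - flat m 0)) = flat m.+1.
      apply/funext => h; rewrite flat0 subr0 addr0 [h *: 1]mulr1 /GRing.scale/= /flat.
      by case: ifP => _; rewrite ?mulr0// mulrA exprS.
    rewrite E.
    suff : {for (0 : R), continuous (flat m.+1)}.
      rewrite /prop_for /continuous_at flat0 => cf.
      by apply: cvg_trans cf; apply: cvg_app; exact: nbhs_dnbhs.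
    apply: continuous_dist => e e0; rewrite flat0.
    have c0 : 0 < (m.+2)`!%:R :> R by rewrite ltr0n fact_gt0.
    have N : \forall t \near (0 : R), `|t| < e / (m.+2)`!%:R.
      by apply: (@nbhs0_lt R R^o); exact: divr_gt0.
    apply: (near_imp N) => t te; rewrite sub0r normrN.
    apply: (le_trans (flat_le _ _)).
    by rewrite mulrC -ler_pdivlMr// ltW.
  apply: DeriveDef; first by apply/cvg_ex; eexists; exact: lim0.
  exact/cvg_lim.
Qed.

Lemma Cnear_flat k m (y : 'rV[R]_1) : Cnear k (fun v => flat m (v 0 0)) y.
Proof.
have dv (z : 'rV[R]_1) m' i : is_derive z (delta_mx 0 i) (fun v : 'rV[R]_1 => flat m' (v 0 0))
   (flat m'.+2 (z 0 0) - m'%:R * flat m'.+1 (z 0 0)).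
  have E (h : R) : (h *: (delta_mx 0 i : 'rV[R]_1) + z) 0 0 = h *: 1 + z 0 0.
    by rewrite !mxE (ord1 i) eqxx.
  have := flat_is_derive m' (z 0 0).
  have E2 : (fun h : R => h^-1 *: (flat m' ((h *: (delta_mx 0 i : 'rV[R]_1) + z) 0 0) - flat m' (z 0 0)))
    = (fun h : R => h^-1 *: (flat m' (h *: 1 + z 0 0) - flat m' (z 0 0))).
    by apply/funext => h; rewrite E.
  move=> [d1 d2]; apply: DeriveDef; move: d1 d2; rewrite /derivable /derive/= E2 //.
have cv (z : 'rV[R]_1) m' : {for z, continuous (fun v : 'rV[R]_1 => flat m' (v 0 0))}.
  apply: (@continuous_comp _ _ _ (fun v : 'rV[R]_1 => v 0 0) (flat m')).
    exact: coord_continuous.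
  apply: differentiable_continuous; apply/derivable1_diffP.
  by have := flat_is_derive m' (z 0 0) => d; exact: ex_derive.
elim: k m => [|k IH] m; (split=> //; first by apply: near_all => z; exact: cv).
move=> i; split; first by apply: near_all => z; have := dv z m i => d; exact: ex_derive.
apply: (@Cnear_eq _ _ _ (fun z => flat m.+2 (z 0 0) + (- m%:R) * flat m.+1 (z 0 0))).
  by apply: near_all => z; have [_ dz] := dv z m i; rewrite /partial dz mulNr.
by apply: CnearD; [exact: IH|apply: CnearM; [exact: Cnear_cst|exact: IH]].
Qed.

(** The Euclidean distance is used because its square is a polynomial. The norm on row vectors is
    the maximum norm, and a Euclidean ball lies in the ball of the same radius for that norm. *)
Definition bump n (y0 : 'rV[R]_n) (r : R) (y : 'rV[R]_n) : R :=
  flat 0 (r ^+ 2 - \sum_i (y 0 i - y0 0 i) ^+ 2).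

Lemma Cnear_bump k n (y0 y : 'rV[R]_n) r : Cnear k (bump y0 r) y.
Proof.
apply: (@Cnear_eq _ _ _ (fun z => (fun v : 'rV[R]_1 => flat 0 (v 0 0))
   (const_mx (r ^+ 2 - \sum_i (z 0 i - y0 0 i) ^+ 2) : 'rV[R]_1))).
  by apply: near_all => z; rewrite mxE.
apply: (@Cnear_comp _ _ _ _ (fun v : 'rV[R]_1 => flat 0 (v 0 0))
  (fun z => const_mx (r ^+ 2 - \sum_i (z 0 i - y0 0 i) ^+ 2))).
  exact: Cnear_flat.
move=> j; apply: (@Cnear_eq _ _ _ (fun z => r ^+ 2 + - \sum_i (z 0 i - y0 0 i) ^+ 2)).
  by apply: near_all => z; rewrite mxE.
apply: CnearD; first exact: Cnear_cst.
apply: CnearN; apply: Cnear_sum => i; apply: CnearM;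
  by apply: CnearD; [exact: Cnear_coord|exact: Cnear_cst].
Qed.

Lemma bump_center n (y0 : 'rV[R]_n) r : 0 < r -> bump y0 r y0 != 0.
Proof.
move=> r0; rewrite /bump big1 => [|i _]; last by rewrite subrr expr0n.
by rewrite subr0 /flat exprn_gt0// expr0 mul1r gt_eqF// expR_gt0.
Qed.

Lemma bump_support n (y0 y : 'rV[R]_n) r : 0 < r -> bump y0 r y != 0 -> `|y - y0| <= r.
Proof.
move=> r0; rewrite /bump /flat; case: ltP; rewrite ?eqxx// subr_gt0 => H _.
rewrite [leLHS]/Num.Def.normr/= mx_normrE; apply/bigmax_leP; split; first exact: ltW.
move=> [a i] _ /=; rewrite (ord1 a) !mxE -(ler_pXn2r (ltn0Sn 1)) ?nnegrE//; last exact: ltW.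
rewrite -normrX ger0_norm ?sqr_ge0//; apply: le_trans (ltW H).
by rewrite (bigD1 i)//= lerDl sumr_ge0// => j _; rewrite sqr_ge0.
Qed.

End FlatFunction.

Section BumpOnManifold.
Variables (R : realType) (M : premanifold R).
Hypothesis hM : is_manifold M.

(** The bump is extended by 0 outside the chart. It vanishes off the image Kc of a closed ball,
    which is compact, hence closed as M is Hausdorff; so near a point of Kc the chart is available,
    and near any other point the function is 0. The factor u is meant for the coordinates, which
    become globally smooth when multiplied by b. *)
Lemma chart_bump (phi : chart R M (mdim M)) (x0 : M) : matlas M phi -> cdom phi x0 ->
  exists b : M -> R, [/\ b x0 != 0, forall x, b x != 0 -> cdom phi x &
    forall u : 'rV[R]_(mdim M) -> R, (forall k y, Cnear k u y) ->
      smoothR (fun x => b x * u (cmap phi x))].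
Proof.
have [hausM _ cM hcov trM] := hM => aphi xd0.
have [od oi K cm ci] := cM _ aphi.
set y0 := cmap phi x0.
have [d d0 Hd] : exists2 d : R, 0 < d & forall y, `|y - y0| < d -> cimg phi y.
  have : nbhs y0 (cimg phi) by apply: open_nbhs_nbhs; split=> //; exists x0.
  move=> /(@nbhs_normP R 'rV[R]_(mdim M))[d /= d0 Hd]; exists d => // y yd.
  by apply: Hd; rewrite /= distrC.
(* Half of d, so that the closed ball B of radius r stays inside the image of the chart. *)
pose r := d / 2; have r0 : 0 < r by exact: divr_gt0.
have rd : r < d by rewrite /r ltr_pdivrMr// ltr_pMr// ltr1n.
pose B := [set y : 'rV[R]_(mdim M) | `|y - y0| <= r].
have BI y : B y -> cimg phi y by move=> yB; apply: Hd; exact: le_lt_trans rd.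
have cB : compact B.
  apply: bounded_closed_compact.
    exists (`|y0| + r); split; first exact: num_real.
    move=> z rz y By /=; rewrite -(subrK y0 y) addrC.
    by rewrite (le_trans (ler_normD _ _))// (le_trans _ (ltW rz))// lerD2l.
  rewrite (_ : B = closed_ball_ Num.norm y0 r); last first.
    by apply/seteqP; split=> y; rewrite /B /closed_ball_/= distrC.
  exact: (@closed_closed_ball_ R 'rV[R]_(mdim M)).
pose Kc := cinv phi @` B.
have clK : closed Kc.
  apply: compact_closed => //; apply: continuous_compact cB.
  apply: continuous_in_subspaceT => y; rewrite inE => yB; exact: (ci _ (BI _ yB)).
pose b x := if `[< cdom phi x >] then bump y0 r (cmap phi x) else 0.
have bK x : b x != 0 -> Kc x.
  rewrite /b; case: asboolP => [xd|_]; last by rewrite eqxx.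
  by move=> /(bump_support r0) xB; exists (cmap phi x) => //; exact: K.
exists b; split.
- by rewrite /b asboolT//; exact: bump_center.
- by move=> x; rewrite /b; case: asboolP => // _; rewrite eqxx.
move=> u Cu; have hcM := manifold_has_charts hM.
apply/(smoothRP _ hcM) => x k psi apsi xpsi.
have [od' oi' K' cm' ci'] := cM _ apsi.
have [xK|xK] := pselect (Kc x).
  have xphi : cdom phi x.
    by case: xK => y yB <-; have [w wd <-] := BI _ yB; rewrite K.
  have Nx : nbhs x (cdom phi) by apply: open_nbhs_nbhs.
  have H := near_chart (cM _ apsi) xpsi Nx.
  apply: (@Cnear_eq _ _ _ (fun y => (fun v => bump y0 r v * u v) (cmap phi (cinv psi y)))).
    by apply: (near_imp H) => z [_ zphi _]; rewrite /b asboolT.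
  apply: (@Cnear_comp _ _ _ _ (fun v => bump y0 r v * u v) (fun y => cmap phi (cinv psi y))).
    by apply: CnearM; [exact: Cnear_bump|exact: Cu].
  move=> j; apply: Csmooth_Cnear (trM _ _ apsi aphi j).
  suff : \forall z \near cmap psi x, (cmap psi @` (cdom psi `&` cdom phi)) z by [].
  by apply: (near_imp H) => z [z1 z2 z3]; exists (cinv psi z).
have Nx : nbhs x (~` Kc) by apply: open_nbhs_nbhs; split=> //; exact: closed_openC.
have H := near_chart (cM _ apsi) xpsi Nx.
apply: (@Cnear_eq _ _ _ (fun=> 0)); last exact: Cnear_cst.
apply: (near_imp H) => z [_ zK _].
case: (eqVneq (b (cinv psi z)) 0) => [->|/bK//]; by rewrite mul0r.
Qed.

End BumpOnManifold.

Section ExpCurve.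
Variables (R : realType) (G : lie_group R).
Local Notation d := (mdim G).
Variables (e : 'I_d -> (G -> R) -> R) (exp : 'rV[R]_d -> G).
Hypothesis expP : is_exp e exp.

(** The v i are the derivatives at t = 0 of the coordinates of exp (t xi). They are chosen before F,
    and F is only required to be C^1 near the unit, which covers functions obtained by integration
    in a chart. *)
Lemma exp_is_derive (phi : chart R G d) (xi : 'rV[R]_d) :
  matlas G phi -> cdom phi gone ->
  exists v : 'I_d -> R, forall F : G -> R,
    Cnear 1 (fun y => F (cinv phi y)) (cmap phi gone) ->
    is_derive (0 : R) 1 (fun t : R => F (exp (t *: xi)))
      (\sum_i v i * partial i (fun y => F (cinv phi y)) (cmap phi gone)).
Proof.
move=> aphi gd; have hG := lg_manifold G.
have [b [b0 bd bu]] := chart_bump hG aphi gd.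
have [e0 eD] := expP.
have [_ _ cM _ _] := hG; have [od oi K cm ci] := cM _ aphi.
have sb : smoothR b.
  have := bu (fun=> 1) (fun k y => Cnear_cst k 1 y).
  by rewrite (_ : (fun x => b x * 1) = b)//; apply/funext => x; rewrite mulr1.
have sbj j : smoothR (fun x => b x * cmap phi x 0 j).
  exact: (bu (fun y => y 0 j) (fun k y => Cnear_coord k y j)).
have exp0 : exp (0 *: xi) = gone by rewrite scale0r.
have db := eD xi _ 0 sb.
have dbj j := eD xi _ 0 (sbj j).
have bn0 : \forall t \near (0 : R), b (exp (t *: xi)) != 0.
  have cb : {for (0 : R), continuous (fun t : R => b (exp (t *: xi)))}.
    apply: differentiable_continuous; apply/derivable1_diffP; exact: ex_derive.
  apply: (cb [set r : R | r != 0]); apply: open_nbhs_nbhs; split.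
    exact: open_neq.
  by rewrite /= exp0.
(* Near t = 0 a coordinate is the quotient of its product with b by b, and both of these are
   globally smooth functions on G. *)
have dg j : derivable (fun t : R => cmap phi (exp (t *: xi)) 0 j) 0 1.
  apply: (@near_eq_derivable _ _ _ (fun t : R =>
     (b (exp (t *: xi)) * cmap phi (exp (t *: xi)) 0 j) * (b (exp (t *: xi)))^-1)).
    by apply: (near_imp bn0) => t bt; rewrite mulrAC mulfV// mul1r.
  apply: derivableM; first by have := dbj j => dj; exact: ex_derive.
  apply: derivableV; first by rewrite exp0.
  exact: ex_derive.
exists (fun j => 'D_1 (fun t : R => cmap phi (exp (t *: xi)) 0 j) 0) => F CF.
have := @chain_curve R d (fun y => F (cinv phi y)) (fun t => cmap phi (exp (t *: xi))) 0
  (fun j => 'D_1 (fun t : R => cmap phi (exp (t *: xi)) 0 j) 0).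
rewrite exp0 => /(_ CF (fun j => derivableP (dg j))).
apply: near_eq_is_derive; apply: (near_imp bn0) => t bt.
by rewrite K//; exact: bd.
Qed.

End ExpCurve.

(** * Linear functionals and linearity of the integral over [0, 1] *)

Section LinearFunctional.
Variable R : realType.

Lemma linear_is_derive n (A : 'I_n -> R) (y v : 'rV[R]_n) :
  is_derive y v (fun x : 'rV[R]_n => \sum_j x 0 j * A j) (\sum_j v 0 j * A j).
Proof.
have E : \forall h \near 0^', h^-1 *: (\sum_j (h *: v + y) 0 j * A j - \sum_j y 0 j * A j)
    = \sum_j v 0 j * A j.
  near=> h.
  have h0 : h != 0 by near: h; exact: nbhs_dnbhs_neq.
  rewrite -sumrB scaler_sumr; apply: eq_bigr => j _.
  by rewrite !mxE -mulrBl addrK [_ *: _]mulrA mulrA mulVf// mul1r.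
apply: DeriveDef; first by apply: (is_cvg_near_cst (\sum_j v 0 j * A j)).
exact: lim_near_cst.
Unshelve. all: end_near. Qed.

Lemma Rintegral01_sum n (F : 'I_n -> R -> R) :
  (forall i (s : R), s \in `[0, 1] -> {for s, continuous (F i)}) ->
  \int[@lebesgue_measure R]_(s in `[0, 1]) (\sum_i F i s) =
  \sum_i \int[@lebesgue_measure R]_(s in `[0, 1]) F i s.
Proof.
elim: n F => [|n IH] F cF.
  rewrite big_ord0 -[RHS]Rintegral01_cst; apply: eq_Rintegral => s _.
  by rewrite big_ord0.
rewrite big_ord_recl -IH => [|i s s01]; last exact: cF.
rewrite -RintegralD//; last 2 first.
- by apply: integrable01 => s s01; exact: cF.
- apply: integrable01 => s s01.
  elim: n F cF {IH} => [|n IH] F cF.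
    rewrite (_ : (fun s => _) = (fun=> 0)); first exact: cst_continuous.
    by apply/funext => t; rewrite big_ord0.
  rewrite (_ : (fun s => _) = (fun s => F (lift ord0 ord0) s +
     \sum_(i < n) F (lift ord0 (lift ord0 i)) s)); last first.
    by apply/funext => t; rewrite big_ord_recl.
  apply: continuousD; first exact: cF.
  exact: (IH (fun i => F (lift ord0 i)) (fun i => cF (lift ord0 i))).
by apply: eq_Rintegral => s _; rewrite big_ord_recl.
Qed.

Lemma Rintegral01_scale (c : R) (F : R -> R) :
  (forall s : R, s \in `[0, 1] -> {for s, continuous F}) ->
  \int[@lebesgue_measure R]_(s in `[0, 1]) (c * F s) =
  c * \int[@lebesgue_measure R]_(s in `[0, 1]) F s.
Proof. by move=> cF; rewrite RintegralZl//; exact: integrable01. Qed.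

Lemma continuous_row_scale m n (P : 'rV[R]_(m + n) -> R) (x : 'rV[R]_m) (mu : 'rV[R]_n) (s : R) :
  {for row_mx x (s *: mu), continuous P} ->
  {for s, continuous (fun s : R => P (row_mx x (s *: mu)))}.
Proof.
move=> cP; apply: (@continuous_comp _ _ _ (fun s : R => row_mx x (s *: mu)) P) => //.
apply: continuous_rV => j; case: (split_ordP j) => k ->.
  rewrite (_ : (fun t => _) = (fun=> x 0 k)); first exact: cst_continuous.
  by apply/funext => t; rewrite row_mxEl.
rewrite (_ : (fun t => _) = (fun t : R => t * mu 0 k)).
  by apply: continuousM; [exact: cvg_id|exact: cst_continuous].
by apply/funext => t; rewrite row_mxEr mxE.
Qed.

End LinearFunctional.

(** * The homotopy h_0 and the infinitesimal action *)

Section ReductionCalculus.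
Variables (R : realType) (D : reduction_data R).
Local Notation M := (rdM D).
Local Notation C := (rdC D).
Local Notation G := (rdG D).
Local Notation d := (mdim G).
Local Notation nC := (mdim C).
Local Notation Phi := (@rd_Phi R D).
Local Notation Psi := (@rd_Psi R D).
Local Notation L := (@rd_L R D).
Local Notation pb := (@rd_pb R D).
Local Notation exp := (@rd_exp R D).
Local Notation CxRn := (prodm C (Rn R d)).

Let hM : has_charts M := manifold_has_charts (rd_M_manifold D).
Let hC : has_charts C := manifold_has_charts (rd_C_manifold D).
Let hG : has_charts G := manifold_has_charts (lg_manifold G).
Let hCR : has_charts CxRn := prod_has_charts hC (Rn_has_charts R d).

Definition std_chart : chart R 'rV[R]_d d := Chart setT id id.

Lemma Psi_smooth_near k q : range Phi q -> @smooth_map_near R k CxRn M Psi q.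
Proof.
move=> Uq; apply: (@smooth_on_near R k CxRn M (range Phi)) => //.
- exact: rd_U_open.
- exact: rd_Psi_smooth.
Qed.

Lemma Phi_smooth_near k p : @smooth_map_near R k M CxRn Phi p.
Proof.
apply: (@smooth_on_near R k M CxRn setT) => //; first exact: openT.
exact: rd_Phi_smooth.
Qed.

Definition tube_fun (psi : chart R C nC) (f : M -> R) (w : 'rV[R]_(nC + d)) : R :=
  f (Psi (cinv psi (lsubmx w), rsubmx w)).

Lemma Cnear_tube_fun k psi f q : smoothR f -> matlas C psi -> range Phi q ->
  cdom psi q.1 -> Cnear k (tube_fun psi f) (row_mx (cmap psi q.1) q.2).
Proof.
move=> /(smoothRP _ hM) sf apsi Uq qd.
have := @smooth_near_comp R k CxRn M Psi f q hCR hM (Psi_smooth_near k Uq) (sf _ k).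
have a : matlas CxRn (prod_chart psi std_chart) by exists psi, std_chart.
by move=> /(_ _ a (conj qd I)).
Qed.

(** The map (s, x, mu) -> (x, s mu) along which h_0 integrates, with s as first coordinate so that
    [integral01] applies. *)
Definition fib_scale (v : 'rV[R]_(1 + (nC + d))) : 'rV[R]_(nC + d) :=
  row_mx (lsubmx (rsubmx v)) (lsubmx v 0 0 *: rsubmx (rsubmx v)).

Lemma fib_scaleE (s : R) (z : 'rV[R]_nC) (mu : 'rV[R]_d) :
  fib_scale (cons_rV s (row_mx z mu)) = row_mx z (s *: mu).
Proof. by rewrite /fib_scale /cons_rV !(row_mxKr, row_mxKl) mxE eqxx. Qed.

Lemma Cnear_fib_scale k v j : Cnear k (fun v => fib_scale v 0 j) v.
Proof.
apply: Cnear_row_mx => i.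
  apply: (@Cnear_eq _ _ _ (fun v : 'rV[R]_(1 + (nC + d)) => v 0 (rshift 1 (lshift d i)))).
    by apply: near_all => z; rewrite !mxE.
  exact: Cnear_coord.
apply: (@Cnear_eq _ _ _ (fun v : 'rV[R]_(1 + (nC + d)) =>
    v 0 (lshift (nC + d) 0) * v 0 (rshift 1 (rshift nC i)))).
  by apply: near_all => z; rewrite !mxE.
by apply: CnearM; exact: Cnear_coord.
Qed.

Lemma h0RE psi a f p : matlas C psi -> cdom psi (Phi p).1 ->
  h0R a f p = integral01 (fun v => partial (rshift nC a) (tube_fun psi f) (fib_scale v))
                (row_mx (cmap psi (Phi p).1) (Phi p).2).
Proof.
move=> apsi pd; have [cC _] := hC; have [_ _ K _ _] := cC _ apsi.
apply: eq_Rintegral => s _; rewrite fib_scaleE -derive_row_mxr /partial.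
rewrite (_ : (fun u => tube_fun psi f (row_mx (cmap psi (Phi p).1) u)) =
  (fun mu => f (Psi ((Phi p).1, mu))))//.
by apply/funext => mu; rewrite /tube_fun row_mxKl row_mxKr K.
Qed.

(** In charts h_0 f is [integral01] of a C^k kernel, for every k, evaluated at the coordinates of
    Phi p. The kernel involves Psi at the points (c, s mu), which the star shape of U keeps in the
    range of Phi. *)
Lemma h0R_smooth a f : smoothR f -> smoothR (@h0R R D a f).
Proof.
move=> sf; apply/(smoothRP _ hM) => p k phi aphi pd.
have [_ hcovC] := hC; have [psi apsi cd] := hcovC (Phi p).1.
have [cC _] := hC; have [cM _] := hM.
have [odpsi _ _ _ _] := cC _ apsi; have [_ _ Kphi _ _] := cM _ aphi.
have apr : matlas CxRn (prod_chart psi std_chart) by exists psi, std_chart.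
have [cPhi sPhi] := Phi_smooth_near k p.
pose I := integral01 (fun v => partial (rshift nC a) (tube_fun psi f) (fib_scale v)).
apply: (@Cnear_eq _ _ _ (fun y => I (cmap (prod_chart psi std_chart) (Phi (cinv phi y))))).
  have N : nbhs p [set p' | cdom psi (Phi p').1].
    have : nbhs (Phi p) [set q : C * 'rV[R]_d | cdom psi q.1].
      by exists (cdom psi, setT) => /=; [split; [apply: open_nbhs_nbhs|exact: filterT]|move=> q []].
    exact: cPhi.
  have H := near_chart (cM _ aphi) pd N.
  by apply: (near_imp H) => y [_ yd _]; rewrite (h0RE _ _ apsi yd).
apply: (@Cnear_comp _ _ _ _ I (fun y => cmap (prod_chart psi std_chart) (Phi (cinv phi y)))); last first.
  by move=> j; apply: sPhi.
rewrite Kphi//=; apply: Cnear_integral01 => s s01.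
apply: (@Cnear_comp _ _ _ _ (partial (rshift nC a) (tube_fun psi f)) fib_scale).
  rewrite fib_scaleE; apply: Cnear_partial.
  apply: (@Cnear_tube_fun k.+1 psi f ((Phi p).1, s *: (Phi p).2)) => //.
  apply: rd_U_star; last by move: s01; rewrite in_itv.
  by exists p => //; case: (Phi p).
by move=> j; exact: Cnear_fib_scale.
Qed.

Lemma rd_J_coord_smooth b : smoothR (fun p : M => rd_J p 0 b).
Proof.
have sb : @smoothR R (Rn R d) (fun y => y 0 b).
  by move=> _ ->; apply: Cnear_Csmooth => y _ k; exact: Cnear_coord.
exact: (@smoothR_comp R M (Rn R d) (@rd_J R D) (fun y => y 0 b) hM (Rn_has_charts R d)
  (rd_J_smooth D) sb).
Qed.

Lemma Jfun_smooth xi : smoothR (@Jfun R D xi).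
Proof.
apply: smoothR_sum => // a; apply: smoothR_scale => //; exact: rd_J_coord_smooth.
Qed.

Lemma pb_smooth (f g : M -> R) : smoothR f -> smoothR g -> smoothR (pb f g).
Proof. by have [] := rd_poisson D => H *; exact: H. Qed.

Lemma action_smooth_near k (f : M -> R) (h : G) (p : M) : smoothR f ->
  @smooth_near R k (prodm G M) (fun z => f (L z.1 z.2)) (h, p).
Proof.
move=> sf; have hGM := prod_has_charts hG hM.
have [sL _ _] := rd_action D.
have := @smoothR_comp R (prodm G M) M (fun z => L z.1 z.2) f hGM hM sL sf.
by move=> /(smoothRP _ hGM).
Qed.

Definition Gchart : chart R G d := projT1 (cid2 (hG.2 gone)).
Lemma Gchart_atlas : matlas G Gchart.
Proof. by rewrite /Gchart; case: cid2. Qed.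
Lemma Gchart_gone : cdom Gchart gone.
Proof. by rewrite /Gchart; case: cid2. Qed.
Local Notation phi := Gchart.
Local Notation x1 := (cmap phi gone).

(* [is_exp] differentiates only globally smooth functions along the curve exp (t xi); the
   coefficients in a chart come from multiplying the coordinates by a bump function. *)
Definition exp_coef xi : 'I_d -> R :=
  projT1 (cid (exp_is_derive (rd_expP D) xi Gchart_atlas Gchart_gone)).

Lemma exp_coefP xi (F : G -> R) : Cnear 1 (fun y => F (cinv phi y)) x1 ->
  is_derive (0 : R) 1 (fun t : R => F (exp (t *: xi)))
    (\sum_i exp_coef xi i * partial i (fun y => F (cinv phi y)) x1).
Proof. by rewrite /exp_coef; case: cid => v Hv /Hv. Qed.

(** [rd_J_hamiltonian] gives the value of a [derive1]; the chain rule along exp supplies the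
    derivability. The second form separates coefficients depending on xi alone from partials in g,
    and can itself be differentiated in q. *)
Lemma ham_is_derive (f : M -> R) xi q : smoothR f ->
  is_derive (0 : R) 1 (fun t : R => f (L (exp (t *: xi)) q)) (pb f (Jfun xi) q) /\
  pb f (Jfun xi) q = \sum_i exp_coef xi i * partial i (fun y => f (L (cinv phi y) q)) x1.
Proof.
move=> sf.
have C1 : Cnear 1 (fun y => f (L (cinv phi y) q)) x1.
  have := smooth_near_prodl hM (@action_smooth_near 1 f gone q sf).
  by apply; [exact: Gchart_atlas|exact: Gchart_gone].
have dF := @exp_coefP xi (fun h => f (L h q)) C1.
have E : pb f (Jfun xi) q = \sum_i exp_coef xi i * partial i (fun y => f (L (cinv phi y) q)) x1.
  have [_ <-] := dF; rewrite -derive1E; exact: rd_J_hamiltonian.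
by rewrite E; split.
Qed.

End ReductionCalculus.

(** * Equivariance of the homotopy and its infinitesimal form *)

Section Equivariance.
Variables (R : realType) (D : reduction_data R).
Local Notation M := (rdM D).
Local Notation C := (rdC D).
Local Notation G := (rdG D).
Local Notation d := (mdim G).
Local Notation Phi := (@rd_Phi R D).
Local Notation Psi := (@rd_Psi R D).
Local Notation L := (@rd_L R D).
Local Notation pb := (@rd_pb R D).
Local Notation exp := (@rd_exp R D).
Local Notation e := (@rd_e R D).
Local Notation J := (@rd_J R D).
Local Notation CxRn := (prodm C (Rn R d)).
Local Notation phi := (Gchart D).
Local Notation x1 := (cmap (Gchart D) gone).

Let hM : has_charts M := manifold_has_charts (rd_M_manifold D).
Let hC : has_charts C := manifold_has_charts (rd_C_manifold D).

Lemma coAdE (g : G) mu b : coAd e g mu 0 b = \sum_j mu 0 j * Ad e (ginv g) (delta_mx 0 b) 0 j.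
Proof. by rewrite /coAd mxE. Qed.

Lemma coAdZ (g : G) (s : R) mu : coAd e g (s *: mu) = s *: coAd e g mu.
Proof.
apply/rowP => b; rewrite [RHS]mxE !coAdE mulr_sumr.
by apply: eq_bigr => j _; rewrite mxE mulrA.
Qed.

(** f (g . Psi (c, nu)) in the coordinates of g near the unit and of nu in the fibre over c.
    Derivatives in g give brackets with J_xi, derivatives in nu enter h_0, and the two commute. *)
Definition orbit_fun (f : M -> R) (c : C) (u : 'rV[R]_(d + d)) : R :=
  f (L (cinv phi (lsubmx u)) (Psi (c, rsubmx u))).

Lemma Cnear_orbit_fun k f c nu : smoothR f -> range Phi (c, nu) ->
  Cnear k (orbit_fun f c) (row_mx x1 nu).
Proof.
move=> sf U.
have [cM hcovM] := hM; have [cC hcovC] := hC.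
have [beta abeta qd] := hcovM (Psi (c, nu)); have [psi apsi cd] := hcovC c.
have [ob _ Kb _ _] := cM _ abeta; have [_ _ Kpsi _ _] := cC _ apsi.
have [cPsi sPsi] := Psi_smooth_near k U.
have asf := @action_smooth_near R D k f gone (Psi (c, nu)) sf.
have apr : matlas (prodm G M) (prod_chart phi beta) by exists phi, beta; split => //; exact: Gchart_atlas.
have {}asf := asf _ apr (conj (Gchart_gone D) qd).
have apr2 : matlas CxRn (prod_chart psi (std_chart D)) by exists psi, (std_chart D).
have {}sPsi := sPsi _ _ apr2 abeta (conj cd I) qd.
apply: (@Cnear_eq _ _ _ (fun u => f (L (cinv phi (lsubmx u)) (cinv beta (cmap beta (Psi (c, rsubmx u))))))).
  have cr : {for row_mx x1 nu, continuous (fun u : 'rV[R]_(d + d) => (c, rsubmx u))}.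
    apply: continuous_pair; first exact: cst_continuous.
    by apply: continuous_rV => j; apply: (Cnear_cont (k := 0%N)); exact: Cnear_rsubmx.
  have N1 : nbhs (c, nu) (Psi @^-1` cdom beta) by apply: cPsi; apply: open_nbhs_nbhs.
  have N : \forall u \near row_mx x1 nu, cdom beta (Psi (c, rsubmx u)).
    by move: cr; rewrite /prop_for /continuous_at row_mxKr => cr; exact: (cr _ N1).
  by apply: (near_imp N) => u ud; rewrite /orbit_fun Kb.
have := @Cnear_comp _ k _ _ _ (fun u : 'rV[R]_(d + d) =>
  row_mx (lsubmx u) (cmap beta (Psi (c, rsubmx u)))) (row_mx x1 nu) _ _.
rewrite row_mxKl row_mxKr => /(_ _ asf) /=.
under eq_fun do rewrite row_mxKl row_mxKr.
apply; apply: Cnear_row_mx => j; first exact: Cnear_lsubmx.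
have := @Cnear_comp _ k _ _ _ (fun u : 'rV[R]_(d + d) => row_mx (cmap psi c) (rsubmx u)) (row_mx x1 nu).
rewrite row_mxKr => /(_ _ (sPsi j)) /=.
under eq_fun do rewrite row_mxKl row_mxKr Kpsi//.
apply; apply: Cnear_row_mx => i; first exact: Cnear_cst.
exact: Cnear_rsubmx.
Qed.

(** The analogue of [fib_scale] with mu fixed: the parameter of the integral is now the coordinate
    of g. *)
Definition orbit_scale (mu : 'rV[R]_d) (v : 'rV[R]_(1 + d)) : 'rV[R]_(d + d) :=
  row_mx (rsubmx v) (lsubmx v 0 0 *: mu).

Lemma orbit_scaleE mu (s : R) x : orbit_scale mu (cons_rV s x) = row_mx x (s *: mu).
Proof. by rewrite /orbit_scale /cons_rV !(row_mxKr, row_mxKl) mxE eqxx. Qed.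

Lemma Cnear_orbit_scale k mu v j : Cnear k (fun v => orbit_scale mu v 0 j) v.
Proof.
apply: Cnear_row_mx => i; first exact: Cnear_rsubmx.
apply: (@Cnear_eq _ _ _ (fun v : 'rV[R]_(1 + d) => v 0 (lshift d 0) * mu 0 i)).
  by apply: near_all => z; rewrite !mxE.
by apply: CnearM; [exact: Cnear_coord|exact: Cnear_cst].
Qed.

Lemma star01 p (s : R) : s \in `[0, 1] -> range Phi ((Phi p).1, s *: (Phi p).2).
Proof.
move=> s01; apply: rd_U_star; last by move: s01; rewrite in_itv.
by exists p => //; case: (Phi p).
Qed.

Lemma Cnear_orbit_kernel k f p (s : R) i : smoothR f -> s \in `[0, 1] ->
  Cnear k (fun v => partial i (orbit_fun f (Phi p).1) (orbit_scale (Phi p).2 v)) (cons_rV s x1).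
Proof.
move=> sf s01; apply: (@Cnear_comp _ _ _ _ (partial i (orbit_fun f (Phi p).1))).
  by rewrite orbit_scaleE; apply: Cnear_partial; apply: Cnear_orbit_fun => //; exact: star01.
by move=> j; exact: Cnear_orbit_scale.
Qed.

Lemma Cnear_orbit_fun01 k f p (s : R) : smoothR f -> s \in `[0, 1] ->
  Cnear k (orbit_fun f (Phi p).1) (row_mx x1 (s *: (Phi p).2)).
Proof. by move=> sf s01; exact: (Cnear_orbit_fun k sf (star01 p s01)). Qed.

Definition mixed_partial f c a i : 'rV[R]_(d + d) -> R :=
  partial (rshift d a) (partial (lshift d i) (orbit_fun f c)).

Lemma mixed_partial_continuous f p a i (s : R) : smoothR f -> s \in `[0, 1] ->
  {for s, continuous (fun s : R => mixed_partial f (Phi p).1 a i (row_mx x1 (s *: (Phi p).2)))}.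
Proof.
move=> sf s01; apply: continuous_row_scale; apply: (Cnear_cont (k := 0%N)).
by apply: Cnear_partial; apply: Cnear_partial; exact: Cnear_orbit_fun01.
Qed.

Lemma h0R_orbitE f a p y :
  h0R a (fun x => f (L (cinv phi y) x)) p =
  integral01 (fun v => partial (rshift d a) (orbit_fun f (Phi p).1) (orbit_scale (Phi p).2 v)) y.
Proof.
apply: eq_Rintegral => s _.
rewrite orbit_scaleE -derive_row_mxr /partial.
have -> : (fun u => orbit_fun f (Phi p).1 (row_mx y u)) = (fun nu => f (L (cinv phi y) (Psi ((Phi p).1, nu)))).
  by apply/funext => nu; rewrite /orbit_fun row_mxKl row_mxKr.
by [].
Qed.

(** By symmetry of second partials, the derivative in g of the integrand of h_0 (f o L_g) is the
    fibre derivative of the derivative of f o L_g in g. *)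
Lemma kernel_partial f a i p (s : R) : smoothR f -> s \in `[0, 1] ->
  partial (rshift 1 i) (fun v => partial (rshift d a) (orbit_fun f (Phi p).1) (orbit_scale (Phi p).2 v))
    (cons_rV s x1) = mixed_partial f (Phi p).1 a i (row_mx x1 (s *: (Phi p).2)).
Proof.
move=> sf s01.
rewrite -[LHS](derive_row_mxr (fun v =>
  partial (rshift d a) (orbit_fun f (Phi p).1) (orbit_scale (Phi p).2 v))).
have -> : (fun u => partial (rshift d a) (orbit_fun f (Phi p).1) (orbit_scale (Phi p).2 (row_mx s%:M u))) =
     (fun u => partial (rshift d a) (orbit_fun f (Phi p).1) (row_mx u (s *: (Phi p).2))).
  by apply/funext => u; rewrite orbit_scaleE.
rewrite (derive_row_mxl (partial (rshift d a) (orbit_fun f (Phi p).1))).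
by apply: partialC; exact: Cnear_orbit_fun01.
Qed.

(** In the chart at the unit g -> h_0 (f o L_g) is a parameter integral, of class C^1 there by
    [Cnear_integral01]; [exp_coefP] differentiates it along exp (t xi). *)
Lemma h0R_flow_coef f xi a p : smoothR f ->
  is_derive (0 : R) 1 (fun t : R => h0R a (fun x => f (L (exp (t *: xi)) x)) p)
    (\sum_i exp_coef xi i * \int[@lebesgue_measure R]_(s in `[0, 1])
       mixed_partial f (Phi p).1 a i (row_mx x1 (s *: (Phi p).2))).
Proof.
move=> sf.
pose K v := partial (rshift d a) (orbit_fun f (Phi p).1) (orbit_scale (Phi p).2 v).
have CK (s : R) : s \in `[0, 1] -> Cnear 1 K (cons_rV s x1).
  by move=> s01; exact: (Cnear_orbit_kernel 1 p (rshift d a) sf s01).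
have := @exp_coefP R D xi (fun h => h0R a (fun x => f (L h x)) p).
have -> : (fun y => h0R a (fun x => f (L (cinv phi y) x)) p) = integral01 K.
  by apply/funext => y; exact: h0R_orbitE.
move=> /(_ (Cnear_integral01 CK)) dF.
apply: is_derive_eq dF _.
apply: eq_bigr => i _; congr (_ * _).
have [_ dI] := integral01_is_derive i CK; rewrite /partial dI.
by apply: eq_Rintegral => s; rewrite inE => s01; exact: (kernel_partial a i p sf s01).
Qed.

Lemma near_tube c (nu : 'rV[R]_d) : range Phi (c, nu) -> \forall nu' \near nu, range Phi (c, nu').
Proof.
move=> U.
have cc : {for nu, continuous (fun nu : 'rV[R]_d => (c, nu))}.
  by apply: continuous_pair; [exact: cst_continuous|exact: cvg_id].
have N : nbhs (c, nu) (range Phi) by apply: open_nbhs_nbhs; split; [exact: rd_U_open|exact: U].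
exact: (cc _ N).
Qed.

Lemma ham_tubeE f xi c nu : smoothR f ->
  pb f (Jfun xi) (Psi (c, nu)) =
  \sum_i exp_coef xi i * partial (lshift d i) (orbit_fun f c) (row_mx x1 nu).
Proof.
move=> sf; have [_ ->] := ham_is_derive xi (Psi (c, nu)) sf.
apply: eq_bigr => i _; congr (_ * _); rewrite -derive_row_mxl /partial.
have -> : (fun u => orbit_fun f c (row_mx u nu)) = (fun y => f (L (cinv phi y) (Psi (c, nu)))).
  by apply/funext => y; rewrite /orbit_fun row_mxKl row_mxKr.
by [].
Qed.

Lemma mixed_partial_is_derive f p a i (s : R) : smoothR f -> s \in `[0, 1] ->
  is_derive (s *: (Phi p).2) (delta_mx 0 a)
    (fun nu => partial (lshift d i) (orbit_fun f (Phi p).1) (row_mx x1 nu))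
    (mixed_partial f (Phi p).1 a i (row_mx x1 (s *: (Phi p).2))).
Proof.
move=> sf s01.
have Cp : Cnear 1 (partial (lshift d i) (orbit_fun f (Phi p).1)) (row_mx x1 (s *: (Phi p).2)).
  by apply: Cnear_partial; exact: Cnear_orbit_fun01.
have Cp' : Cnear 1 (fun nu => partial (lshift d i) (orbit_fun f (Phi p).1) (row_mx x1 nu)) (s *: (Phi p).2).
  apply: (@Cnear_comp _ _ _ _ (partial (lshift d i) (orbit_fun f (Phi p).1)) (fun nu => row_mx x1 nu) _ Cp).
  by apply: Cnear_row_mx => j; [exact: Cnear_cst|exact: Cnear_coord].
rewrite /mixed_partial -derive_row_mxr; apply: derivableP; exact: (@Cnear_derivable _ _ 0%N _ _ _ Cp').
Qed.

Lemma ham_fiber_derive f xi a p (s : R) : smoothR f -> s \in `[0, 1] ->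
  'D_(delta_mx 0 a) (fun mu : 'rV[R]_d => pb f (Jfun xi) (Psi ((Phi p).1, mu))) (s *: (Phi p).2) =
  \sum_i exp_coef xi i * mixed_partial f (Phi p).1 a i (row_mx x1 (s *: (Phi p).2)).
Proof.
move=> sf s01.
have -> : (fun mu : 'rV[R]_d => pb f (Jfun xi) (Psi ((Phi p).1, mu))) =
   \sum_i (fun nu => exp_coef xi i * partial (lshift d i) (orbit_fun f (Phi p).1) (row_mx x1 nu)).
  by apply/funext => nu; rewrite fct_sumE; exact: ham_tubeE.
have dsum := @is_derive_sum _ _ _ d
  (fun i nu => exp_coef xi i * partial (lshift d i) (orbit_fun f (Phi p).1) (row_mx x1 nu))
  (s *: (Phi p).2) (delta_mx 0 a) _
  (fun i => is_deriveZ (exp_coef xi i) (mixed_partial_is_derive p a i sf s01)).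
by have [_ ->] := dsum.
Qed.

(** The derivative in t passes through h_0: both sides are the integral over s of the same
    combination of mixed partials, by differentiation under the integral on the left and by
    [ham_fiber_derive] on the right. *)
Lemma h0R_flow_derive f xi a p : smoothR f ->
  is_derive (0 : R) 1 (fun t : R => h0R a (fun x => f (L (exp (t *: xi)) x)) p)
    (h0R a (pb f (Jfun xi)) p).
Proof.
move=> sf; apply: is_derive_eq (h0R_flow_coef xi a p sf) _.
pose F i (s : R) := mixed_partial f (Phi p).1 a i (row_mx x1 (s *: (Phi p).2)).
have cF i (s : R) : s \in `[0, 1] -> {for s, continuous (F i)}.
  by move=> s01; exact: (@mixed_partial_continuous f p a i s sf s01).
transitivity (\int[@lebesgue_measure R]_(s in `[0, 1]) \sum_i (exp_coef xi i * F i s)).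
  rewrite (Rintegral01_sum (F := fun i s => exp_coef xi i * F i s)); last first.
    by move=> i s s01; apply: continuousM; [exact: cst_continuous|exact: (cF i s s01)].
  by apply: eq_bigr => i _; rewrite -(Rintegral01_scale (exp_coef xi i) (cF i)).
apply: eq_Rintegral => s; rewrite inE => s01.
exact: (esym (ham_fiber_derive xi a p sf s01)).
Qed.

(** Equivariance of Phi turns f o L_g on the fibre over c into f on the fibre over g c, composed
    with the linear map coAd g. Linearity sends the path s mu to s (coAd g mu), so the substitution
    takes place under the integral and the chain rule produces the coefficients. *)
Lemma h0R_equivariant f (g : G) a p : smoothR f ->
  h0R a (fun x => f (L g x)) p = \sum_b coAd e g (delta_mx 0 a) 0 b * h0R b f (L g p).
Proof.
move=> sf; set c := (Phi p).1; set mu := (Phi p).2.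
have [cC hcovC] := hC.
have PhiL : Phi (L g p) = (@rd_LC R D g c, coAd e g mu) by exact: rd_Phi_equivariant.
set c' := rd_LC g c in PhiL *; set mu' := coAd e g mu in PhiL *.
have [psi apsi cd] := hcovC c'.
have [_ _ Kpsi _ _] := cC _ apsi.
pose F nu := f (Psi (c', nu)).
have CF k (s : R) : s \in `[0, 1] -> Cnear k F (s *: mu').
  move=> s01; have := star01 (L g p) s01; rewrite PhiL/= => U.
  have := Cnear_tube_fun k sf apsi U cd => /= Ct.
  have := @Cnear_comp _ k _ _ (tube_fun psi f) (fun nu : 'rV[R]_d => row_mx (cmap psi c') nu) _ Ct.
  rewrite (_ : (fun z => _) = F); last first.
    by apply/funext => nu; rewrite /tube_fun row_mxKl row_mxKr Kpsi.
  by apply; apply: Cnear_row_mx => j; [exact: Cnear_cst|exact: Cnear_coord].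
have h0E b : h0R b f (L g p) = \int[@lebesgue_measure R]_(s in `[0, 1]) partial b F (s *: mu').
  by rewrite /h0R PhiL.
have -> : \sum_b coAd e g (delta_mx 0 a) 0 b * h0R b f (L g p) =
    \sum_b \int[@lebesgue_measure R]_(s in `[0, 1]) (coAd e g (delta_mx 0 a) 0 b * partial b F (s *: mu')).
  apply: eq_bigr => b _; rewrite Rintegral01_scale.
    by rewrite h0E.
  move=> s s01; apply: (@continuous_comp _ _ _ (fun s : R => s *: mu') (partial b F)).
    exact: scalel_continuous.
  by apply: (Cnear_cont (k := 0%N)); apply: Cnear_partial; exact: CF.
rewrite -Rintegral01_sum; last first.
  move=> b s s01; apply: continuousM; first exact: cst_continuous.
  apply: (@continuous_comp _ _ _ (fun s : R => s *: mu') (partial b F)).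
    exact: scalel_continuous.
  by apply: (Cnear_cont (k := 0%N)); apply: Cnear_partial; exact: CF.
apply: eq_Rintegral => s; rewrite inE => s01.
(* The identity f (L_g (Psi (c, nu))) = f (Psi (g c, coAd g nu)) is available on the range of Phi,
   which is open: enough for a derivative at s mu. *)
have NU : \forall nu \near s *: mu, range Phi (c, nu) by exact: (near_tube (star01 p s01)).
rewrite (@near_eq_derive _ _ _ _ (fun nu => F (coAd e g nu))); last first.
  apply: (near_imp NU) => nu [q _ qE]; rewrite /F.
  have -> : (c', coAd e g nu) = Phi (L g q) by rewrite rd_Phi_equivariant qE.
  by rewrite rd_PhiK -qE rd_PhiK.
have dl b : is_derive (s *: mu) (delta_mx 0 a) (fun nu => coAd e g nu 0 b) (coAd e g (delta_mx 0 a) 0 b).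
  have -> : (fun nu => coAd e g nu 0 b) =
      (fun nu : 'rV[R]_d => \sum_j nu 0 j * Ad e (ginv g) (delta_mx 0 b) 0 j).
    by apply/funext => nu; rewrite coAdE.
  by rewrite coAdE; exact: linear_is_derive.
have := @chain_partial _ _ _ F (coAd e g) (s *: mu) (delta_mx 0 a).
rewrite coAdZ => /(_ (CF 1%N _ s01) (fun b => @ex_derive _ _ _ _ _ _ _ (dl b)))[_ ->].
by apply: eq_bigr => b _; have [_ ->] := dl b.
Qed.

(** The range of Phi is open around (c, 0), and J is the second component of Phi, so J takes small
    nonzero multiples of e^a as values. *)
Lemma J_axis a : exists q : M, exists2 ep : R, ep != 0 & J q = ep *: delta_mx 0 a.
Proof.
have [p0 J0] := rd_0_value D.
have cc : {for (0 : R), continuous (fun t : R => ((Phi p0).1, t *: delta_mx 0 a : 'rV[R]_d))}.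
  by apply: continuous_pair; [exact: cst_continuous|exact: scalel_continuous].
have N : \forall t \near (0 : R), range Phi ((Phi p0).1, t *: delta_mx 0 a).
  apply: cc; apply: open_nbhs_nbhs; split; first exact: rd_U_open.
  by exists p0 => //; rewrite scale0r -J0 rd_J_Phi; case: (Phi p0).
have [t [t0 [[q _ qE] _]]] := near0_pick N N.
by exists q, t => //; rewrite rd_J_Phi qE.
Qed.

Lemma JfunE a : Jfun (delta_mx 0 a) = (fun p => J p 0 a).
Proof.
apply/funext => p; rewrite /Jfun (bigD1 a)//= mxE !eqxx mul1r big1 ?addr0// => b ba.
by rewrite mxE (negbTE ba) andbF mul0r.
Qed.

(** The product rule at t = 0 for [h0R_equivariant] with g = exp (t xi): the left-hand side of that
    identity has derivative [h0R a] of the bracket, and the right-hand side contributes the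
    derivative of the coefficients and that of the h_0^b f. *)
Lemma h0R_infinitesimal f xi a p : smoothR f ->
  pb (h0R a f) (Jfun xi) p =
  h0R a (pb f (Jfun xi)) p - \sum_b bracket e (delta_mx 0 b) xi 0 a * h0R b f p.
Proof.
move=> sf; have [q [ep ep0 qE]] := J_axis a.
have coAd_q (g : G) b : coAd e g (delta_mx 0 a) 0 b = ep^-1 * J (L g q) 0 b.
  rewrite rd_J_equivariant qE coAdZ; move: (coAd _ _ _) => v.
  by rewrite mxE mulrA mulVf// mul1r.
have [exp0 _] := rd_expP D; have [_ L1 _] := rd_action D.
(* The derivative is {J_b, J_xi} at q divided by ep. Since {J_b, J_xi} is J_[e_b, xi] and J q = ep
   e^a, this is the a-component of [e_b, xi]. *)
have dJ b : is_derive (0 : R) 1 (fun t : R => ep^-1 * J (L (exp (t *: xi)) q) 0 b)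
    (bracket e (delta_mx 0 b) xi 0 a).
  have [dJ _] := ham_is_derive xi q (rd_J_coord_smooth b).
  have := is_deriveZ ep^-1 dJ => dJ'; apply: is_derive_eq dJ' _.
  have := rd_J_bracket (delta_mx 0 b) xi q.
  rewrite -!/(Jfun _) JfunE => ->.
  rewrite qE (bigD1 a)//= !mxE !eqxx/= mulr1 big1 ?addr0.
    by rewrite [_ *: _]mulrCA mulVf// mulr1.
  by move=> j ja; rewrite !mxE (negbTE ja) andbF !mulr0.
have dh b := (ham_is_derive xi p (h0R_smooth b sf)).1.
have dsum := @is_derive_sum _ _ _ d (fun b (t : R) => (ep^-1 * J (L (exp (t *: xi)) q) 0 b) *
   h0R b f (L (exp (t *: xi)) p)) 0 1 _ (fun b => is_deriveM (dJ b) (dh b)).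
have [_ E1] := dsum.
have [_ E2] := h0R_flow_derive xi a p sf.
move: E1; rewrite (_ : (\sum_b _) = (fun t : R => h0R a (fun x => f (L (exp (t *: xi)) x)) p)); last first.
  apply/funext => t; rewrite fct_sumE h0R_equivariant//.
  by apply: eq_bigr => b _; rewrite coAd_q.
rewrite E2 => ->; rewrite big_split/= addrC scale0r exp0 !L1 qE.
rewrite (_ : \sum_i (h0R i f p *: _) = \sum_b bracket e (delta_mx 0 b) xi 0 a * h0R b f p); last first.
  by apply: eq_bigr => b _; rewrite [LHS]mulrC.
(* At t = 0 the coefficients are the components of J q / ep = e^a, so only b = a survives among the
   brackets of the h_0^b f. *)
rewrite addrAC subrr add0r (bigD1 a)//= big1 ?addr0; last first.
  by move=> b ba; rewrite !mxE (negbTE ba) andbF !mulr0 scale0r.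
by rewrite !mxE !eqxx/= mulr1 mulVf// scale1r.
Qed.

End Equivariance.

(** * The Lie bracket read off the Poisson bracket *)

Section LieAlgebraOfReduction.
Variables (R : realType) (D : reduction_data R).
Local Notation M := (rdM D).
Local Notation d := (mdim (rdG D)).
Local Notation pb := (@rd_pb R D).
Local Notation e := (@rd_e R D).
Implicit Types (f g h : M -> R) (xi : 'rV[R]_d).

Let hM : has_charts M := manifold_has_charts (rd_M_manifold D).

Lemma pb_anti f g p : smoothR f -> smoothR g -> pb f g p = - pb g f p.
Proof. by move=> sf sg; have [_ H _ _ _] := rd_poisson D; exact: H. Qed.

Lemma pb_linl (a : R) f g h p : smoothR f -> smoothR g -> smoothR h ->
  pb (fun x => a * f x + g x) h p = a * pb f h p + pb g h p.
Proof. by move=> sf sg sh; have [_ _ H _ _] := rd_poisson D; exact: H. Qed.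

Lemma pb0l h p : smoothR h -> pb (fun=> 0) h p = 0.
Proof.
move=> sh; have := @pb_linl (-1) (fun=> 0) (fun=> 0) h p (smoothR_cst 0) (smoothR_cst 0) sh.
rewrite (_ : (fun x => -1 * 0 + 0) = (fun=> 0)); last by apply/funext => z; rewrite mulr0 addr0.
by rewrite mulN1r addNr.
Qed.

Lemma pb_lin2 (a b : R) f g h p : smoothR f -> smoothR g -> smoothR h ->
  pb (fun x => a * f x + b * g x) h p = a * pb f h p + b * pb g h p.
Proof.
move=> sf sg sh; rewrite pb_linl//; last exact: smoothR_scale.
congr (_ + _).
have := @pb_linl b g (fun=> 0) h p sg (smoothR_cst 0) sh.
rewrite pb0l// addr0 => <-.
by congr (pb _ h p); apply/funext => z; rewrite addr0.
Qed.

Lemma pb_mull f g h p : smoothR f -> smoothR g -> smoothR h ->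
  pb (fun x => f x * g x) h p = pb f h p * g p + f p * pb g h p.
Proof.
move=> sf sg sh; have [_ _ _ H _] := rd_poisson D.
rewrite pb_anti//; last exact: smoothR_mul.
rewrite H// (pb_anti p sh sf) (pb_anti p sh sg); ring.
Qed.

Lemma Jfun_lin (a b : R) (x y : 'rV[R]_d) : Jfun (a *: x + b *: y) = (fun p : M => a * Jfun x p + b * Jfun y p).
Proof.
apply/funext => p; rewrite /Jfun !mulr_sumr -big_split/=; apply: eq_bigr => i _.
by rewrite !mxE mulrDl !mulrA.
Qed.

(** Evaluation where J is a nonzero multiple of e^a recovers the coordinate a. Identities in the Lie
    algebra can thus be checked on the functions J_x, where the Lie bracket is the Poisson
    bracket. *)
Lemma Jfun_inj (x y : 'rV[R]_d) : @Jfun R D x = Jfun y -> x = y.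
Proof.
move=> xy; apply/rowP => a; have [q [ep ep0 qE]] := J_axis a.
have E z : Jfun z q = ep * z 0 a.
  rewrite /Jfun qE (bigD1 a)//= !mxE !eqxx mulr1 big1 ?addr0 1?mulrC// => b ba.
  by rewrite !mxE (negbTE ba) andbF !mulr0.
by apply: (mulfI ep0); rewrite -!E xy.
Qed.

Lemma Jfun_bracket (x y : 'rV[R]_d) : Jfun (bracket e x y) = pb (Jfun x) (Jfun y).
Proof. by apply/funext => p; rewrite rd_J_bracket. Qed.

Lemma bracket_anti (x y : 'rV[R]_d) : bracket e x y = - bracket e y x.
Proof.
apply: Jfun_inj.
have := Jfun_lin (-1) 0 (bracket e y x) 0; rewrite scaleN1r scale0r addr0 => ->.
apply/funext => p; rewrite mul0r addr0 mulN1r !Jfun_bracket pb_anti//; exact: Jfun_smooth.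
Qed.

Lemma bracket_linl (a b : R) (x y z : 'rV[R]_d) :
  bracket e (a *: x + b *: y) z = a *: bracket e x z + b *: bracket e y z.
Proof.
apply: Jfun_inj; rewrite Jfun_bracket !Jfun_lin !Jfun_bracket.
by apply/funext => p; rewrite pb_lin2//; exact: Jfun_smooth.
Qed.

Lemma bracket_linr (a b : R) (x y z : 'rV[R]_d) :
  bracket e z (a *: x + b *: y) = a *: bracket e z x + b *: bracket e z y.
Proof. by rewrite bracket_anti bracket_linl (bracket_anti x) (bracket_anti y) !scalerN -opprD opprK. Qed.

Lemma bracket_jacobi (x y z : 'rV[R]_d) :
  bracket e x (bracket e y z) + bracket e y (bracket e z x) + bracket e z (bracket e x y) = 0.
Proof.
apply: Jfun_inj.
have lin u v : Jfun (u + v) = (fun p : M => Jfun u p + Jfun v p).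
  by have := Jfun_lin 1 1 u v; rewrite !scale1r => ->; apply/funext => p; rewrite !mul1r.
have -> : @Jfun R D 0 = (fun=> 0).
  by have := Jfun_lin 0 0 0 0; rewrite !scale0r addr0 => ->; apply/funext => p; rewrite !mul0r addr0.
rewrite !lin !Jfun_bracket; apply/funext => p.
by have [_ _ _ _ H] := rd_poisson D; apply: H; exact: Jfun_smooth.
Qed.

Lemma bracket_sumr (x y : 'rV[R]_d) : bracket e x y = \sum_b y 0 b *: bracket e x (delta_mx 0 b).
Proof.
have H n (c : 'I_n -> R) (u : 'I_n -> 'rV[R]_d) :
    bracket e x (\sum_b c b *: u b) = \sum_b c b *: bracket e x (u b).
  elim: n c u => [|n IH] c u.
    by rewrite !big_ord0; have := bracket_linr 0 0 0 0 x; rewrite !scale0r addr0.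
  rewrite !big_ord_recl; have := bracket_linr (c ord0) 1 (u ord0) (\sum_(i < n) c (lift ord0 i) *: u (lift ord0 i)) x.
  by rewrite !scale1r => ->; rewrite IH.
by rewrite -H -row_sum_delta.
Qed.

Lemma bracket_suml (x y : 'rV[R]_d) : bracket e x y = \sum_a x 0 a *: bracket e (delta_mx 0 a) y.
Proof.
rewrite bracket_anti bracket_sumr -sumrN; apply: eq_bigr => a _.
by rewrite -scalerN -bracket_anti.
Qed.

Definition adm (x : 'rV[R]_d) : 'M[R]_d := \matrix_(a, b) bracket e x (delta_mx 0 b) 0 a.

Lemma bracketE x y a : bracket e x y 0 a = \sum_b adm x a b * y 0 b.
Proof.
rewrite bracket_sumr summxE; apply: eq_bigr => b _.
by rewrite !mxE mulrC.
Qed.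

(** The Jacobi identity makes ad of a bracket a commutator of matrices, and a commutator has trace
    0. *)
Lemma Delta_bracket (x y : 'rV[R]_d) : Delta e (bracket e x y) = 0.
Proof.
rewrite /Delta -/(adm _).
have -> : adm (bracket e x y) = adm x *m adm y - adm y *m adm x.
  apply/matrixP => a b; rewrite !mxE.
  have := bracket_jacobi x y (delta_mx 0 b).
  move/(congr1 (fun u : 'rV[R]_d => u 0 a)).
  rewrite (bracket_anti (delta_mx 0 b) (bracket e x y)) (bracket_anti (delta_mx 0 b) x).
  have -> : bracket e y (- bracket e x (delta_mx 0 b)) = - bracket e y (bracket e x (delta_mx 0 b)).
    have := bracket_linr (-1) 0 (bracket e x (delta_mx 0 b)) 0 y.
    by rewrite !scale0r !addr0 !scaleN1r.
  rewrite !mxE => /eqP; rewrite subr_eq0 => /eqP <-.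
  rewrite [X in X - _]bracketE [X in _ - X]bracketE.
  by congr (_ - _); apply: eq_bigr => c _; rewrite [adm _ c b]mxE.
by rewrite raddfB/= mxtrace_mulC subrr.
Qed.

Lemma Delta_sum (x : 'rV[R]_d) : Delta e x = \sum_a x 0 a * Delta e (delta_mx 0 a).
Proof.
rewrite /Delta /mxtrace.
under [RHS]eq_bigr do rewrite mulr_sumr.
rewrite exchange_big/=; apply: eq_bigr => b _.
rewrite mxE bracket_suml summxE; apply: eq_bigr => a _.
by rewrite !mxE.
Qed.

Lemma Delta_deltaE b : Delta e (delta_mx 0 b) = \sum_a bracket e (delta_mx 0 b) (delta_mx 0 a) 0 a.
Proof. by rewrite /Delta /mxtrace; apply: eq_bigr => a _; rewrite mxE. Qed.

Lemma sum_Delta_bracket b xi :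
  \sum_a Delta e (delta_mx 0 a) * bracket e (delta_mx 0 b) xi 0 a = 0.
Proof.
transitivity (Delta e (bracket e (delta_mx 0 b) xi)); last exact: Delta_bracket.
by rewrite Delta_sum; apply: eq_bigr => a _; rewrite mulrC.
Qed.

End LieAlgebraOfReduction.

(** * Complex-linear extension of real operators *)

Section ExtC.
Variable R : realType.
Local Open Scope complex_scope.

Lemma complex_ext (x y : R[i]) : complex.Re x = complex.Re y -> complex.Im x = complex.Im y -> x = y.
Proof. by case: x y => [a b] [c e] /= -> ->. Qed.

Lemma cReD (x y : R[i]) : complex.Re (x + y) = complex.Re x + complex.Re y.
Proof. by case: x y => [a b] [c e]. Qed.
Lemma cImD (x y : R[i]) : complex.Im (x + y) = complex.Im x + complex.Im y.
Proof. by case: x y => [a b] [c e]. Qed.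
Lemma cReM (x y : R[i]) : complex.Re (x * y) =
  complex.Re x * complex.Re y - complex.Im x * complex.Im y.
Proof. by case: x y => [a b] [c e]. Qed.
Lemma cImM (x y : R[i]) : complex.Im (x * y) =
  complex.Re x * complex.Im y + complex.Im x * complex.Re y.
Proof. by case: x y => [a b] [c e]. Qed.

(* [S] is the class of functions on which the real operator [T] is known to be linear at [y]. *)
Definition linear_at (X Y : Type) (S : (X -> R) -> Prop) (T : (X -> R) -> Y -> R) (y : Y) : Prop :=
  (forall (a b : R) f g, S f -> S g -> S (fun x => a * f x + b * g x)) /\
  (forall (a b : R) f g, S f -> S g ->
     T (fun x => a * f x + b * g x) y = a * T f y + b * T g y).

Lemma extC_lin (X Y : Type) (S : (X -> R) -> Prop) (T : (X -> R) -> Y -> R) (y : Y)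
    (c : R[i]) (f g : X -> R[i]) :
  linear_at S T y -> S (reF f) -> S (imF f) -> S (reF g) -> S (imF g) ->
  extC T (fun x => c * f x + g x) y = c * extC T f y + extC T g y.
Proof.
move=> [HS HT] rf jf rg jg; set a := complex.Re c; set b := complex.Im c.
(* The factors 1 write both parts as nested two-term combinations, the shape that [linear_at]
   handles. *)
have E1 : reF (fun x => c * f x + g x) =
    (fun x => 1 * (a * reF f x + (- b) * imF f x) + 1 * reF g x).
  by apply/funext => x; rewrite /reF cReD cReM !mul1r mulNr.
have E2 : imF (fun x => c * f x + g x) =
    (fun x => 1 * (a * imF f x + b * reF f x) + 1 * imF g x).
  by apply/funext => x; rewrite /imF cImD cImM !mul1r.
rewrite /extC E1 E2; do 2 (rewrite HT; [|by apply: HS|by []]); rewrite !HT// !mul1r.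
by apply: complex_ext; rewrite ?cReD ?cImD ?cReM ?cImM/= -/a -/b ?mulNr.
Qed.

Lemma extC_conj (X Y : Type) (S : (X -> R) -> Prop) (T : (X -> R) -> Y -> R) (y : Y)
    (f : X -> R[i]) :
  linear_at S T y -> S (imF f) -> extC T (fun x => (f x)^*%C) y = (extC T f y)^*%C.
Proof.
move=> [HS HT] jf; have E1 : reF (fun x => (f x)^*%C) = reF f.
  by apply/funext => x; rewrite /reF; case: (f x).
have E2 : imF (fun x => (f x)^*%C) = (fun x => -1 * imF f x + 0 * imF f x).
  by apply/funext => x; rewrite /imF mul0r addr0 mulN1r; case: (f x).
by rewrite /extC E1 E2 HT// mul0r addr0 mulN1r.
Qed.

End ExtC.

Local Open Scope complex_scope.

(** * Linearity of iterated partial derivatives *)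

Section PartialsLinear.
Variables (R : realType) (n : nat) (U : set 'rV[R]_n).
Hypothesis oU : open U.
Implicit Types f g : 'rV[R]_n -> R.

Definition smooth_at f (y : 'rV[R]_n) : Prop := forall k, Cnear k f y.
Definition smooth_over f : Prop := forall y, U y -> smooth_at f y.

Lemma smooth_over_lin (a b : R) f g : smooth_over f -> smooth_over g ->
  smooth_over (fun x => a * f x + b * g x).
Proof.
move=> sf sg y Uy k; apply: CnearD; (apply: CnearM; first exact: Cnear_cst).
  exact: sf.
exact: sg.
Qed.

Lemma partials_smooth s f : smooth_over f -> smooth_over (partials s f).
Proof.
move=> sf; elim: s => [|i s IH] //= y Uy k.
by apply: Cnear_partial; exact: IH.
Qed.

Lemma partials_lin s (a b : R) f g y : U y -> smooth_over f -> smooth_over g ->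
  partials s (fun x => a * f x + b * g x) y = a * partials s f y + b * partials s g y.
Proof.
move=> + sf sg; elim: s y => [|i s IH] //= y Uy.
have N : \forall z \near y, U z by apply: open_nbhs_nbhs.
rewrite /partial (@near_eq_derive _ _ _ _ (fun z => a * partials s f z + b * partials s g z)); last first.
  by apply: (near_imp N) => z Uz; exact: IH.
have df := derivableP (@Cnear_derivable _ _ 0%N _ _ i (partials_smooth s sf Uy 1%N)).
have dg := derivableP (@Cnear_derivable _ _ 0%N _ _ i (partials_smooth s sg Uy 1%N)).
have dfg := is_deriveD (is_deriveZ a df) (is_deriveZ b dg).
by have [_ E] := dfg; exact: E.
Qed.

Lemma partials_linear_at s y : U y -> linear_at smooth_over (partials s) y.
Proof.
by move=> Uy; split; [move=> *; exact: smooth_over_lin|move=> *; exact: partials_lin].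
Qed.

End PartialsLinear.

(** * Complex-valued smooth functions *)

Section SmoothC.
Variables (R : realType) (M : premanifold R).
Hypothesis hM : has_charts M.
Implicit Types f g : M -> R[i].

Lemma smoothC_lin (c : R[i]) f g : smoothC f -> smoothC g -> smoothC (fun x => c * f x + g x).
Proof.
move=> [rf jf] [rg jg]; split.
  rewrite (_ : reF _ = (fun x => (complex.Re c * reF f x + - (complex.Im c * imF f x)) + reF g x)).
    do 2 apply: smoothR_add => //; first exact: smoothR_scale.
    by apply: smoothR_opp => //; exact: smoothR_scale.
  by apply/funext => x; rewrite /reF cReD cReM.
rewrite (_ : imF _ = (fun x => (complex.Re c * imF f x + complex.Im c * reF f x) + imF g x)).
  by do 2 apply: smoothR_add => //; exact: smoothR_scale.
by apply/funext => x; rewrite /imF cImD cImM.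
Qed.

Lemma smoothC_toC (f : M -> R) : smoothR f -> smoothC (toC f).
Proof. by move=> sf; split => //; exact: smoothR_cst. Qed.

Lemma smoothC0 : smoothC (fun _ : M => 0 : R[i]).
Proof. by split; exact: smoothR_cst. Qed.

Lemma smoothC_mul f g : smoothC f -> smoothC g -> smoothC (fun x => f x * g x).
Proof.
move=> [rf jf] [rg jg]; split.
  rewrite (_ : reF _ = (fun x => reF f x * reF g x + - (imF f x * imF g x))).
    apply: smoothR_add => //; first exact: smoothR_mul.
    by apply: smoothR_opp => //; exact: smoothR_mul.
  by apply/funext => x; rewrite /reF cReM.
rewrite (_ : imF _ = (fun x => reF f x * imF g x + imF f x * reF g x)).
  by apply: smoothR_add => //; exact: smoothR_mul.
by apply/funext => x; rewrite /imF cImM.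
Qed.

Lemma smoothC_conj f : smoothC f -> smoothC (fun x => (f x)^*%C).
Proof.
move=> [rf jf]; split.
  by rewrite (_ : reF _ = reF f)//; apply/funext => x; rewrite /reF; case: (f x).
rewrite (_ : imF _ = (fun x => - imF f x)); first exact: smoothR_opp.
by apply/funext => x; rewrite /imF; case: (f x).
Qed.

Lemma smoothC_add f g : smoothC f -> smoothC g -> smoothC (fun x => f x + g x).
Proof.
move=> sf sg; rewrite (_ : (fun x => f x + g x) = (fun x => 1 * f x + g x)).
  exact: smoothC_lin.
by apply/funext => x; rewrite mul1r.
Qed.

Lemma smoothC_scale (c : R[i]) f : smoothC f -> smoothC (fun x => c * f x).
Proof.
move=> sf; rewrite (_ : (fun x => c * f x) = (fun x => c * f x + 0)).
  by apply: smoothC_lin => //; exact: smoothC0.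
by apply/funext => x; rewrite addr0.
Qed.

Lemma smoothC_sum (I : Type) (r : seq I) (P : pred I) (F : I -> M -> R[i]) :
  (forall i, smoothC (F i)) -> smoothC (fun x => \sum_(i <- r | P i) F i x).
Proof.
move=> sF; elim: r => [|i r IH].
  rewrite (_ : (fun x => _) = (fun=> 0)); first exact: smoothC0.
  by apply/funext => x; rewrite big_nil.
case: (boolP (P i)) => Pi.
  rewrite (_ : (fun x => _) = (fun x => F i x + \sum_(i <- r | P i) F i x)).
    exact: smoothC_add.
  by apply/funext => x; rewrite big_cons Pi.
rewrite (_ : (fun x => _) = (fun x => \sum_(i <- r | P i) F i x))//.
by apply/funext => x; rewrite big_cons (negbTE Pi).
Qed.

Lemma extC_smooth (T : (M -> R) -> M -> R) f :
  (forall g : M -> R, smoothR g -> smoothR (T g)) -> smoothC f -> smoothC (extC T f).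
Proof. by move=> HT [rf jf]; split; exact: HT. Qed.

End SmoothC.

Section CnearC.
Variables (R : realType) (n : nat).
Implicit Types f g : 'rV[R]_n -> R[i].

Definition CnearC k f y := Cnear k (reF f) y /\ Cnear k (imF f) y.

Lemma CnearC_mul k f g y : CnearC k f y -> CnearC k g y -> CnearC k (fun x => f x * g x) y.
Proof.
move=> [rf jf] [rg jg]; split.
  rewrite (_ : reF _ = (fun x => reF f x * reF g x + - (imF f x * imF g x))).
    by apply: CnearD; [apply: CnearM|apply: CnearN; apply: CnearM].
  by apply/funext => x; rewrite /reF cReM.
rewrite (_ : imF _ = (fun x => reF f x * imF g x + imF f x * reF g x)).
  by apply: CnearD; apply: CnearM.
by apply/funext => x; rewrite /imF cImM.
Qed.

Lemma CnearC_sum k (I : Type) (r : seq I) (P : pred I) (F : I -> 'rV[R]_n -> R[i]) y :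
  (forall i, CnearC k (F i) y) -> CnearC k (fun x => \sum_(i <- r | P i) F i x) y.
Proof.
move=> CF; split.
  rewrite (_ : reF _ = (fun x => \sum_(i <- r | P i) reF (F i) x)).
    by apply: Cnear_sum => i; have [] := CF i.
  apply/funext => x; rewrite /reF.
  by elim/big_rec2: _ => // i u v _ <-; rewrite cReD.
rewrite (_ : imF _ = (fun x => \sum_(i <- r | P i) imF (F i) x)).
  by apply: Cnear_sum => i; have [] := CF i.
apply/funext => x; rewrite /imF.
by elim/big_rec2: _ => // i u v _ <-; rewrite cImD.
Qed.

End CnearC.

(** * Bilinearity and smoothness of bidifferential operators *)

Section Bidifferential.
Variables (R : realType) (M : premanifold R).
Hypothesis hM : has_charts M.
Implicit Types f g h : M -> R[i].
Variable B : (M -> R[i]) -> (M -> R[i]) -> M -> R[i].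
Hypothesis bB : bidifferential B.

Lemma chart_smooth_over (f : M -> R) (phi : chart R M (mdim M)) : matlas M phi -> smoothR f ->
  smooth_over (cimg phi) (fun y => f (cinv phi y)).
Proof.
move=> aphi /(smoothRP _ hM) sf y [x xd <-] k; exact: sf.
Qed.

(** Linearity is read off the local expression of B term by term, from the linearity of iterated
    partials on smooth functions. *)
Lemma bidiff_linl (c : R[i]) f g h p : smoothC f -> smoothC g -> smoothC h ->
  B (fun x => c * f x + g x) h p = c * B f h p + B g h p.
Proof.
move=> sf sg sh; have [k Hk] := bB; have [hC hcov] := hM.
have [phi aphi pd] := hcov p; have [co [_ E]] := Hk _ aphi.
have [_ oi K _ _] := hC _ aphi.
have pi : cimg phi (cmap phi p) by exists p.
rewrite -(K _ pd) !E//; last exact: smoothC_lin.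
rewrite mulr_sumr -big_split/=; apply: eq_bigr => i _.
rewrite mulr_sumr -big_split/=; apply: eq_bigr => s _.
rewrite mulr_sumr -big_split/=; apply: eq_bigr => j _.
rewrite mulr_sumr -big_split/=; apply: eq_bigr => t _.
have [[rf jf] [rg jg]] := (sf, sg).
rewrite (extC_lin (S := smooth_over (cimg phi)) c (f := fun z => f (cinv phi z))
  (g := fun z => g (cinv phi z))); first ring.
- exact: partials_linear_at.
- exact: (chart_smooth_over aphi rf).
- exact: (chart_smooth_over aphi jf).
- exact: (chart_smooth_over aphi rg).
- exact: (chart_smooth_over aphi jg).
Qed.

Lemma bidiff_linr (c : R[i]) f g h p : smoothC f -> smoothC g -> smoothC h ->
  B h (fun x => c * f x + g x) p = c * B h f p + B h g p.
Proof.
move=> sf sg sh; have [k Hk] := bB; have [hC hcov] := hM.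
have [phi aphi pd] := hcov p; have [co [_ E]] := Hk _ aphi.
have [_ oi K _ _] := hC _ aphi.
have pi : cimg phi (cmap phi p) by exists p.
rewrite -(K _ pd) !E//; last exact: smoothC_lin.
rewrite mulr_sumr -big_split/=; apply: eq_bigr => i _.
rewrite mulr_sumr -big_split/=; apply: eq_bigr => s _.
rewrite mulr_sumr -big_split/=; apply: eq_bigr => j _.
rewrite mulr_sumr -big_split/=; apply: eq_bigr => t _.
have [[rf jf] [rg jg]] := (sf, sg).
rewrite (extC_lin (S := smooth_over (cimg phi)) c (f := fun z => f (cinv phi z))
  (g := fun z => g (cinv phi z))); first ring.
- exact: partials_linear_at.
- exact: (chart_smooth_over aphi rf).
- exact: (chart_smooth_over aphi jf).
- exact: (chart_smooth_over aphi rg).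
- exact: (chart_smooth_over aphi jg).
Qed.

Lemma bidiff_smooth f g : smoothC f -> smoothC g -> smoothC (B f g).
Proof.
move=> sf sg; have [k Hk] := bB; have [hC hcov] := hM.
suff H : forall phi, matlas M phi -> forall y, cimg phi y -> forall l,
    CnearC l (fun y => B f g (cinv phi y)) y.
  by split=> phi aphi; apply: Cnear_Csmooth => y yi l; have [] := H _ aphi _ yi l.
move=> phi aphi y yi l; have [co [sco E]] := Hk _ aphi.
have [_ oi _ _ _] := hC _ aphi.
have [[rf jf] [rg jg]] := (sf, sg).
have N : \forall z \near y, cimg phi z by apply: open_nbhs_nbhs.
suff [H1 H2] : CnearC l (fun y => \sum_(i < k.+1) \sum_(s : i.-tuple 'I_(mdim M))
         \sum_(j < k.+1) \sum_(t : j.-tuple 'I_(mdim M))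
           co s t y * extC (partials s) (fun z => f (cinv phi z)) y
                   * extC (partials t) (fun z => g (cinv phi z)) y) y.
  split.
    by apply: Cnear_eq H1; apply: (near_imp N) => z zi; rewrite /reF E.
  by apply: Cnear_eq H2; apply: (near_imp N) => z zi; rewrite /imF E.
apply: CnearC_sum => i; apply: CnearC_sum => s; apply: CnearC_sum => j; apply: CnearC_sum => t.
apply: CnearC_mul; first apply: CnearC_mul.
- have [s1 s2] := sco s t; split.
    by apply: Csmooth_Cnear s1; apply: open_nbhs_nbhs.
  by apply: Csmooth_Cnear s2; apply: open_nbhs_nbhs.
- split.
    exact: (partials_smooth s (chart_smooth_over aphi rf) yi l).
  exact: (partials_smooth s (chart_smooth_over aphi jf) yi l).
- split.
    exact: (partials_smooth t (chart_smooth_over aphi rg) yi l).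
  exact: (partials_smooth t (chart_smooth_over aphi jg) yi l).
Qed.

End Bidifferential.

(** * Formal series *)

Section StarSeries.
Variables (R : realType) (M : premanifold R).
Hypothesis hM : has_charts M.
Variable Cr : nat -> (M -> R[i]) -> (M -> R[i]) -> M -> R[i].
Hypothesis bCr : forall r, bidifferential (Cr r).
Implicit Types F G H : formal_series R M.
Local Notation "F ** G" := (star Cr F G) (at level 40).

Lemma smoothS_scale (c : R[i]) F : smoothS F -> smoothS (fun n p => c * F n p).
Proof. by move=> sF n; exact: smoothC_scale. Qed.

Lemma smoothS_sum (I : Type) (r : seq I) (F : I -> formal_series R M) :
  (forall i, smoothS (F i)) -> smoothS (fun n p => \sum_(i <- r) F i n p).
Proof. by move=> sF n; apply: smoothC_sum => // i; exact: sF. Qed.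

Lemma smoothS_lambda F : smoothS F -> smoothS (lambdaS F).
Proof. by move=> sF [|n] //=; exact: smoothC0. Qed.

Lemma smoothS_const (f : M -> R[i]) : smoothC f -> smoothS (constS f).
Proof. by move=> sf [|n] //=; exact: smoothC0. Qed.

Lemma smoothS_star F G : smoothS F -> smoothS G -> smoothS (F ** G).
Proof.
move=> sF sG n; apply: smoothC_sum => // r; apply: smoothC_sum => // j.
exact: bidiff_smooth.
Qed.

Lemma smoothS_conj F : smoothS F -> smoothS (conjS F).
Proof. by move=> sF n; exact: smoothC_conj. Qed.

Lemma star_linl (c : R[i]) F F' G : smoothS F -> smoothS F' -> smoothS G ->
  (fun n p => c * F n p + F' n p) ** G = (fun n p => c * (F ** G) n p + (F' ** G) n p).
Proof.
move=> sF sF' sG; apply/funext => n; apply/funext => p; rewrite /star.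
rewrite mulr_sumr -big_split/=; apply: eq_bigr => r _.
rewrite mulr_sumr -big_split/=; apply: eq_bigr => j _.
exact: bidiff_linl.
Qed.

Lemma star_linr (c : R[i]) F F' G : smoothS F -> smoothS F' -> smoothS G ->
  G ** (fun n p => c * F n p + F' n p) = (fun n p => c * (G ** F) n p + (G ** F') n p).
Proof.
move=> sF sF' sG; apply/funext => n; apply/funext => p; rewrite /star.
rewrite mulr_sumr -big_split/=; apply: eq_bigr => r _.
rewrite mulr_sumr -big_split/=; apply: eq_bigr => j _.
exact: bidiff_linr.
Qed.

Definition zeroS : formal_series R M := fun _ _ => 0.

Lemma smoothS0 : smoothS zeroS.
Proof. by move=> n; exact: smoothC0. Qed.

Lemma star0l G : smoothS G -> zeroS ** G = zeroS.
Proof.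
move=> sG; have := star_linl (-1) smoothS0 smoothS0 sG.
rewrite (_ : (fun n p => -1 * zeroS n p + zeroS n p) = zeroS).
  move=> {1}->; apply/funext => n; apply/funext => p.
  by rewrite mulN1r addNr.
by apply/funext => n; apply/funext => p; rewrite /zeroS mulr0 addr0.
Qed.

Lemma star0r G : smoothS G -> G ** zeroS = zeroS.
Proof.
move=> sG; have := star_linr (-1) smoothS0 smoothS0 sG.
rewrite (_ : (fun n p => -1 * zeroS n p + zeroS n p) = zeroS).
  move=> {1}->; apply/funext => n; apply/funext => p.
  by rewrite mulN1r addNr.
by apply/funext => n; apply/funext => p; rewrite /zeroS mulr0 addr0.
Qed.

Lemma star_suml (I : Type) (r : seq I) (c : I -> R[i]) (F : I -> formal_series R M) G :
  (forall i, smoothS (F i)) -> smoothS G ->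
  (fun n p => \sum_(i <- r) c i * F i n p) ** G = (fun n p => \sum_(i <- r) c i * (F i ** G) n p).
Proof.
move=> sF sG; elim: r => [|i r IH].
  rewrite (_ : (fun n p => _) = zeroS); last first.
    by apply/funext => n; apply/funext => p; rewrite big_nil.
  by rewrite star0l//; apply/funext => n; apply/funext => p; rewrite big_nil.
rewrite (_ : (fun n p => \sum_(i <- i :: r) c i * F i n p) =
    (fun n p => c i * F i n p + (fun n p => \sum_(i <- r) c i * F i n p) n p)); last first.
  by apply/funext => n; apply/funext => p; rewrite big_cons.
rewrite star_linl//; last by apply: smoothS_sum => j; exact: smoothS_scale.
by rewrite IH; apply/funext => n; apply/funext => p; rewrite big_cons.
Qed.

Lemma star_sumr (I : Type) (r : seq I) (c : I -> R[i]) (F : I -> formal_series R M) G :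
  (forall i, smoothS (F i)) -> smoothS G ->
  G ** (fun n p => \sum_(i <- r) c i * F i n p) = (fun n p => \sum_(i <- r) c i * (G ** F i) n p).
Proof.
move=> sF sG; elim: r => [|i r IH].
  rewrite (_ : (fun n p => _) = zeroS); last first.
    by apply/funext => n; apply/funext => p; rewrite big_nil.
  by rewrite star0r//; apply/funext => n; apply/funext => p; rewrite big_nil.
rewrite (_ : (fun n p => \sum_(i <- i :: r) c i * F i n p) =
    (fun n p => c i * F i n p + (fun n p => \sum_(i <- r) c i * F i n p) n p)); last first.
  by apply/funext => n; apply/funext => p; rewrite big_cons.
rewrite star_linr//; last by apply: smoothS_sum => j; exact: smoothS_scale.
by rewrite IH; apply/funext => n; apply/funext => p; rewrite big_cons.
Qed.

Lemma Cr0l r (g : M -> R[i]) p : smoothC g -> Cr r (fun=> 0) g p = 0.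
Proof.
move=> sg; have := bidiff_linl hM (bCr r) (-1) p (smoothC0 M) (smoothC0 M) sg.
rewrite (_ : (fun x => -1 * 0 + 0) = (fun=> 0)); first by rewrite mulN1r addNr.
by apply/funext => x; rewrite mulr0 addr0.
Qed.

Lemma Cr0r r (g : M -> R[i]) p : smoothC g -> Cr r g (fun=> 0) p = 0.
Proof.
move=> sg; have := bidiff_linr hM (bCr r) (-1) p (smoothC0 M) (smoothC0 M) sg.
rewrite (_ : (fun x => -1 * 0 + 0) = (fun=> 0)); first by rewrite mulN1r addNr.
by apply/funext => x; rewrite mulr0 addr0.
Qed.

Lemma star_lambdal F G n p : smoothS F -> smoothS G ->
  (lambdaS F ** G) n.+1 p = (F ** G) n p.
Proof.
(* The summand r = n.+1 contains only the degree 0 coefficient of [lambdaS F], which is 0; in the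
   other summands the index j = 0 drops for the same reason. *)
move=> sF sG; rewrite /star big_ord_recr/= subnn.
rewrite [X in _ + X]big_ord_recl [X in _ + (_ + X)]big_ord0 /= addr0 Cr0l// addr0.
apply: eq_bigr => r _; rewrite subSn; last by rewrite -ltnS.
rewrite big_ord_recl/= Cr0l// add0r; apply: eq_bigr => j _.
by rewrite subSS.
Qed.

Lemma star_lambdar F G n p : smoothS F -> smoothS G ->
  (F ** lambdaS G) n.+1 p = (F ** G) n p.
Proof.
move=> sF sG; rewrite /star big_ord_recr/= subnn.
rewrite [X in _ + X]big_ord_recl [X in _ + (_ + X)]big_ord0 /= addr0 Cr0r// addr0.
apply: eq_bigr => r _; rewrite subSn; last by rewrite -ltnS.
rewrite big_ord_recr/= subnn Cr0r// addr0; apply: eq_bigr => j _.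
by rewrite subSn//; rewrite -ltnS.
Qed.

(** In degree n of F star f the coefficient F_n enters through C_0 (F_n, f) = F_n f alone.
    Subtracting this product leaves an expression in the lower coefficients of F, which is what
    makes S equal to id + O(lambda). *)
Lemma star_const_top (f : M -> R[i]) F F' n p : smoothC f -> smoothS F -> smoothS F' ->
  (forall g h q, smoothC g -> smoothC h -> Cr 0 g h q = g q * h q) ->
  (forall j, (j < n)%N -> F j = F' j) ->
  (F ** constS f) n p - F n p * f p = (F' ** constS f) n p - F' n p * f p.
Proof.
move=> sf sF sF' C0 E.
have H K : smoothS K -> (K ** constS f) n p - K n p * f p =
    \sum_(j < n) Cr 0 (K j) (constS f (n - j)%N) p +
    \sum_(r < n) \sum_(j < (n - r.+1).+1) Cr r.+1 (K j) (constS f (n - r.+1 - j)%N) p.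
  move=> sK; rewrite /star big_ord_recl /= subn0 big_ord_recr /= subnn /= C0//.
  by rewrite /bump/=; ring.
rewrite !H//; congr (_ + _).
  by apply: eq_bigr => j _; rewrite E.
apply: eq_bigr => r _; apply: eq_bigr => j _; rewrite E//.
by have := ltn_ord j; have := ltn_ord r; lia.
Qed.

End StarSeries.

(** * The fundamental vector fields and h_0 on complex functions *)

Section HamiltonianOperators.
Variables (R : realType) (D : reduction_data R).
Local Notation M := (rdM D).
Local Notation d := (mdim (rdG D)).
Local Notation pb := (@rd_pb R D).
Local Notation e := (@rd_e R D).
Local Notation Phi := (@rd_Phi R D).
Local Notation Psi := (@rd_Psi R D).

Let hM : has_charts M := manifold_has_charts (rd_M_manifold D).
Let hC : has_charts (rdC D) := manifold_has_charts (rd_C_manifold D).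

Lemma Cnear_fiber k (f : M -> R) p (s : R) : smoothR f -> s \in `[0, 1] ->
  Cnear k (fun mu : 'rV[R]_d => f (Psi ((Phi p).1, mu))) (s *: (Phi p).2).
Proof.
move=> sf s01; have [cC hcovC] := hC; have [psi apsi cd] := hcovC (Phi p).1.
have [_ _ Kpsi _ _] := cC _ apsi.
have Ct := Cnear_tube_fun k sf apsi (star01 p s01) cd.
have := @Cnear_comp _ k _ _ (tube_fun psi f) (fun nu : 'rV[R]_d => row_mx (cmap psi (Phi p).1) nu) _ Ct.
have -> : (fun z => tube_fun psi f (row_mx (cmap psi (Phi p).1) z)) =
    (fun mu : 'rV[R]_d => f (Psi ((Phi p).1, mu))).
  by apply/funext => nu; rewrite /tube_fun row_mxKl row_mxKr Kpsi.
by apply; apply: Cnear_row_mx => j; [exact: Cnear_cst|exact: Cnear_coord].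
Qed.

Lemma smoothR_lin2 (a b : R) (f g : M -> R) : smoothR f -> smoothR g ->
  smoothR (fun x => a * f x + b * g x).
Proof. by move=> sf sg; apply: smoothR_add => //; exact: smoothR_scale. Qed.

Lemma fiber_deriv_continuous a (f : M -> R) p (s : R) : smoothR f -> s \in `[0, 1] ->
  {for s, continuous (fun s : R =>
    'D_(delta_mx 0 a) (fun mu : 'rV[R]_d => f (Psi ((Phi p).1, mu))) (s *: (Phi p).2))}.
Proof.
move=> sf s01.
apply: (@continuous_comp _ _ _ (fun s : R => s *: (Phi p).2)
  (partial a (fun mu : 'rV[R]_d => f (Psi ((Phi p).1, mu))))).
  exact: scalel_continuous.
apply: (Cnear_cont (k := 0%N)); apply: Cnear_partial; exact: (Cnear_fiber 1 p sf s01).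
Qed.

Lemma h0R_lin a (x y : R) (f g : M -> R) p : smoothR f -> smoothR g ->
  h0R a (fun q => x * f q + y * g q) p = x * h0R a f p + y * h0R a g p.
Proof.
move=> sf sg.
have cf := fun s s01 => @fiber_deriv_continuous a f p s sf s01.
have cg := fun s s01 => @fiber_deriv_continuous a g p s sg s01.
rewrite /h0R -(Rintegral01_scale x cf) -(Rintegral01_scale y cg).
rewrite -RintegralD//; last 2 first.
- by apply: integrable01 => s s01; apply: continuousM; [exact: cst_continuous|exact: cf].
- by apply: integrable01 => s s01; apply: continuousM; [exact: cst_continuous|exact: cg].
apply: eq_Rintegral => s; rewrite inE => s01.
have df := derivableP (@Cnear_derivable _ _ 0%N _ _ a (Cnear_fiber 1 p sf s01)).
have dg := derivableP (@Cnear_derivable _ _ 0%N _ _ a (Cnear_fiber 1 p sg s01)).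
by have [_ E] := is_deriveD (is_deriveZ x df) (is_deriveZ y dg); exact: E.
Qed.

Lemma h0R_linear_at a p : linear_at (@smoothR R M) (@h0R R D a) p.
Proof. by split=> *; [exact: smoothR_lin2|exact: h0R_lin]. Qed.

Definition ham xi : (M -> R[i]) -> M -> R[i] := extC (fun g => pb g (Jfun xi)).

Lemma pb_linear_at xi p : linear_at (@smoothR R M) (fun g => pb g (Jfun xi)) p.
Proof. by split=> *; [exact: smoothR_lin2|apply: pb_lin2 => //; exact: Jfun_smooth]. Qed.

Lemma ham_lin xi (c : R[i]) f g p : smoothC f -> smoothC g ->
  ham xi (fun x => c * f x + g x) p = c * ham xi f p + ham xi g p.
Proof. by move=> [rf jf] [rg jg]; exact: (extC_lin c (pb_linear_at xi p)). Qed.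

Lemma ham_smooth xi f : smoothC f -> smoothC (ham xi f).
Proof. by apply: extC_smooth => g sg; apply: pb_smooth => //; exact: Jfun_smooth. Qed.

Lemma ham0 xi p : ham xi (fun=> 0) p = 0.
Proof.
by rewrite /ham /extC /reF /imF/= pb0l//; exact: Jfun_smooth.
Qed.

Lemma ham_sum xi (I : Type) (r : seq I) (F : I -> M -> R[i]) p : (forall i, smoothC (F i)) ->
  ham xi (fun x => \sum_(i <- r) F i x) p = \sum_(i <- r) ham xi (F i) p.
Proof.
move=> sF; elim: r => [|i r IH].
  rewrite big_nil -[RHS](ham0 xi p); congr (ham _ _ _).
  by apply/funext => x; rewrite big_nil.
rewrite big_cons -IH -[ham xi (F i) p]mul1r -ham_lin//; last exact: smoothC_sum.
by congr (ham _ _ _); apply/funext => x; rewrite big_cons mul1r.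
Qed.

Lemma ham_conj xi f p : smoothC f -> ham xi (fun x => (f x)^*%C) p = (ham xi f p)^*%C.
Proof. by move=> [rf jf]; exact: (extC_conj (pb_linear_at xi p)). Qed.

Lemma ham_toC xi (f : M -> R) p : ham xi (toC f) p = (pb f (Jfun xi) p)%:C.
Proof. by apply: complex_ext => //=; rewrite pb0l//; exact: Jfun_smooth. Qed.

Lemma ham_mul_toC xi f (g : M -> R) p : smoothC f -> smoothR g ->
  ham xi (fun x => f x * toC g x) p = ham xi f p * toC g p + f p * ham xi (toC g) p.
Proof.
move=> [rf jf] sg; rewrite ham_toC; have sJ := Jfun_smooth xi.
have E1 : reF (fun x => f x * toC g x) = (fun x => reF f x * g x).
  by apply/funext => x; rewrite /reF cReM /= mulr0 subr0.
have E2 : imF (fun x => f x * toC g x) = (fun x => imF f x * g x).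
  by apply/funext => x; rewrite /imF cImM /= mulr0 add0r.
apply: complex_ext.
  by rewrite cReD !cReM /= E1 pb_mull// !mulr0 !subr0.
by rewrite cImD !cImM /= E2 pb_mull// mulr0 !add0r addrC mulr0 add0r addrC.
Qed.

Lemma pbC_J xi f p : smoothC f -> pbC pb (toC (Jfun xi)) f p = - ham xi f p.
Proof.
move=> [rf jf]; have sJ := Jfun_smooth xi; apply: complex_ext => /=.
  by rewrite pb0l// subr0 pb_anti.
by rewrite pb0l// addr0 pb_anti.
Qed.

Lemma ham_Jbasis xi a p :
  ham xi (toC (Jbasis a)) p = \sum_b (bracket e (delta_mx 0 a) xi 0 b)%:C * toC (@Jbasis R D b) p.
Proof.
rewrite ham_toC /Jbasis -Jfun_bracket /Jfun; rewrite [LHS](rmorph_sum (real_complex R)).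
apply: eq_bigr => b _; rewrite /= [in RHS]/toC -/(Jfun _ _) JfunE.
by rewrite /real_complex_def -[RHS](rmorphM (real_complex R)).
Qed.

Lemma h0C_infinitesimal (f : M -> R[i]) xi a p : smoothC f ->
  ham xi (extC (h0R a) f) p = extC (h0R a) (ham xi f) p
    + \sum_b (- (bracket e (delta_mx 0 b) xi 0 a)%:C) * extC (h0R b) f p.
Proof.
move=> [rf jf].
have E (g : M -> R) : \sum_b bracket e (delta_mx 0 b) xi 0 a * h0R b g p =
   - \sum_b (- bracket e (delta_mx 0 b) xi 0 a * h0R b g p).
  by rewrite -sumrN; apply: eq_bigr => b _; rewrite mulNr opprK.
apply: complex_ext.
  rewrite cReD /= (h0R_infinitesimal _ _ _ rf) E opprK; congr (_ + _).
  elim/big_rec2: _ => // b u v _ ->.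
  by rewrite cReD cReM /= oppr0 mul0r subr0.
rewrite cImD /= (h0R_infinitesimal _ _ _ jf) E opprK; congr (_ + _).
elim/big_rec2: _ => // b u v _ ->.
by rewrite cImD cImM /= oppr0 mul0r addr0.
Qed.

End HamiltonianOperators.

(** * The deformation operator and conjugation *)

Section DoubleSums.
Variables (K : comPzRingType) (I : finType).

(** For structure constants k this is the invariance of a contraction: the two factors transform
    dually, and the two double sums cancel after exchanging the names of the indices. *)
Lemma sum_cancel (k S : I -> I -> K) :
  \sum_a (\sum_b - k b a * S b a) + \sum_a \sum_b k a b * S a b = 0.
Proof.
rewrite exchange_big -big_split big1// => a _.
by rewrite -big_split big1//= => b _; rewrite mulNr addNr.
Qed.

Lemma add_cancel (a b s s' : K) : s = s' -> a + s = b + s' -> a = b.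
Proof. by move=> ->; exact: addIr. Qed.

End DoubleSums.

Section Hermitian.
Variables (R : realType) (D : reduction_data R).
Local Notation M := (rdM D).
Local Notation C := (rdC D).
Local Notation d := (mdim (rdG D)).
Local Notation pb := (@rd_pb R D).
Local Notation e := (@rd_e R D).
Variable Cr : nat -> (M -> R[i]) -> (M -> R[i]) -> M -> R[i].
Hypothesis hstar : is_star_product Cr pb.
Hypothesis hinv : strongly_invariant Cr.
Hypothesis hherm : hermitian_product (star Cr).
Local Notation "F ** G" := (star Cr F G) (at level 40).
Implicit Types F G H : formal_series R M.

Let hM : has_charts M := manifold_has_charts (rd_M_manifold D).

Local Notation Z0 := (@zeroS R M).
Local Notation JS xi := (constS (toC (@Jfun R D xi))).
Local Notation delta a := (delta_mx 0 a : 'rV[R]_d).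

Let bCr r : bidifferential (Cr r).
Proof. by have [H _ _ _ _] := hstar; exact: H. Qed.

Let assoc F G H : smoothS F -> smoothS G -> smoothS H -> F ** (G ** H) = (F ** G) ** H.
Proof. by move=> sF sG sH; have [_ A _ _ _] := hstar; exact: A. Qed.

Let Cr0E (f g : M -> R[i]) p : smoothC f -> smoothC g -> Cr 0 f g p = f p * g p.
Proof. by move=> sf sg; have [_ _ A _ _] := hstar; exact: A. Qed.

Definition hamS xi F : formal_series R M := fun n => ham xi (F n).

Lemma smoothS_ham xi F : smoothS F -> smoothS (hamS xi F).
Proof. by move=> sF n; exact: ham_smooth. Qed.

Lemma smoothS_JS xi : smoothS (JS xi).
Proof. by apply: smoothS_const; apply: smoothC_toC; exact: Jfun_smooth. Qed.

Lemma smoothS_h0 F a : smoothS F -> smoothS (h0 F a).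
Proof. by move=> sF n; apply: extC_smooth => // g; exact: h0R_smooth. Qed.

Lemma JS_star xi F : smoothS F ->
  JS xi ** F = (fun n p => - 'i%C * lambdaS (hamS xi F) n p + (F ** JS xi) n p).
Proof.
move=> sF; apply/funext => n; apply/funext => p.
have := congr1 (fun K : formal_series R M => K n p) (hinv xi sF); rewrite /subS /scaleS => /eqP.
rewrite subr_eq => /eqP ->; congr (_ + _).
case: n => [|n] /=; first by rewrite !mulr0.
by rewrite pbC_J// mulrN mulNr.
Qed.

Lemma star_ham xi F G : smoothS F -> smoothS G ->
  hamS xi (F ** G) = (fun n p => (hamS xi F ** G) n p + (F ** hamS xi G) n p).
Proof.
move=> sF sG; apply/funext => n; apply/funext => p.
have sJ := smoothS_JS xi; have sFG := smoothS_star hM bCr sF sG.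
have slF := smoothS_lambda (smoothS_ham xi sF); have slG := smoothS_lambda (smoothS_ham xi sG).
have := assoc sJ sF sG; rewrite (JS_star xi sFG) (JS_star xi sF).
rewrite (star_linl hM bCr)//; last exact: (smoothS_star hM bCr).
rewrite -(assoc sF sJ sG) (JS_star xi sG) (star_linr hM bCr)//; last exact: (smoothS_star hM bCr).
(* Moving J_xi to the right through the product at once, or past F and then past G, gives the
   derivation identity multiplied by -i lambda; its degree n is therefore read in degree n.+1. *)
rewrite (assoc sF sG sJ) => /(congr1 (fun K : formal_series R M => K n.+1 p)) /=.
rewrite (star_lambdal hM bCr)//; last exact: smoothS_ham.
rewrite (star_lambdar hM bCr)//; last exact: smoothS_ham.
rewrite addrA => /addIr; rewrite -mulrDr; apply: mulfI.
by rewrite oppr_eq0 neq0Ci.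
Qed.

Definition half_i_Delta a : R[i] := 'i%C / 2 * (Delta e (delta a))%:C.

(** [qkoszul] minus [koszul] on arbitrary components: the action of xi_M and conjugation are
    computed from the transformation law of X, and only then specialised to X = h_0 H. *)
Definition correction (X : 'I_d -> formal_series R M) n p : R[i] :=
  \sum_a ((X a ** JS (delta a)) n p - X a n p * toC (Jbasis a) p
          + half_i_Delta a * lambdaS (X a) n p).

Lemma deformationE H n p : deformation Cr H n p = H n p + correction (h0 H) n p.
Proof.
rewrite /deformation /addS /subS /qkoszul /koszul /correction -sumrB; congr (_ + _).
by apply: eq_bigr => a _; rewrite addrAC.
Qed.

Lemma smoothC_Jbasis a : smoothC (toC (@Jbasis R D a)).
Proof. by apply: smoothC_toC; exact: Jfun_smooth. Qed.

Lemma correction_congr (X X' : 'I_d -> formal_series R M) n p :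
  (forall a, smoothS (X a)) -> (forall a, smoothS (X' a)) ->
  (forall a j, (j < n)%N -> X a j = X' a j) ->
  correction X n p = correction X' n p.
Proof.
move=> sX sX' E; apply: eq_bigr => a _.
have E1 := star_const_top p (smoothC_Jbasis a) (sX a) (sX' a) Cr0E (E a).
have -> : lambdaS (X a) n p = lambdaS (X' a) n p.
  by case: n E {E1} => //= m E; rewrite E.
by congr (_ + _); exact: E1.
Qed.

(** Strong induction on the degree: once the lower coefficients of H and H' agree,
    [correction_congr] cancels the corrections and leaves the coefficient of degree n. *)
Lemma deformation_inj H H' : smoothS H -> smoothS H' ->
  deformation Cr H = deformation Cr H' -> H = H'.
Proof.
move=> sH sH' E; apply/funext => n; elim/ltn_ind: n => n IH; apply/funext => p.
have hE a j : (j < n)%N -> h0 H a j = h0 H' a j.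
  by move=> jn; exact: (congr1 (extC (h0R a)) (IH j jn)).
have E' := congr1 (fun K : formal_series R M => K n p) E.
exact: (add_cancel (correction_congr p (fun a => smoothS_h0 a sH) (fun a => smoothS_h0 a sH') hE)
  (etrans (esym (deformationE H n p)) (etrans E' (deformationE H' n p)))).
Qed.

Definition bracketC xi a b : R[i] := (bracket e (delta a) xi 0 b)%:C.

(* The infinitesimal form of the statement that X -> \sum_a X_a e_a intertwines the action. *)
Definition ham_system xi (X Y : 'I_d -> formal_series R M) : Prop :=
  forall a, hamS xi (X a) = (fun n p => 1 * Y a n p + \sum_b (- bracketC xi b a) * X b n p).

Lemma ham_system_h0 xi H : smoothS H -> ham_system xi (h0 H) (h0 (hamS xi H)).
Proof.
move=> sH a; apply/funext => n; apply/funext => p.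
by rewrite mul1r; exact: h0C_infinitesimal.
Qed.

Lemma ham_JbasisE xi a p :
  ham xi (toC (Jbasis a)) p = \sum_b bracketC xi a b * toC (@Jbasis R D b) p.
Proof. exact: ham_Jbasis. Qed.

Lemma hamS_JS xi a : hamS xi (JS (delta a)) =
  (fun n p => \sum_b bracketC xi a b * JS (delta b) n p).
Proof.
apply/funext => -[|n]; apply/funext => p /=; first exact: ham_Jbasis.
by rewrite [LHS]ham0 big1// => b _; rewrite mulr0.
Qed.

Lemma lambda_ham xi F n p : ham xi (lambdaS F n) p = lambdaS (hamS xi F) n p.
Proof. by case: n => [|n] //=; exact: ham0. Qed.

Lemma smoothC_sub (f g : M -> R[i]) : smoothC f -> smoothC g -> smoothC (fun x => f x - g x).
Proof.
move=> sf sg; rewrite (_ : (fun x => f x - g x) = (fun x => -1 * g x + f x)).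
  exact: smoothC_lin.
by apply/funext => x; rewrite mulN1r addrC.
Qed.

Lemma ham_add xi (f g : M -> R[i]) p : smoothC f -> smoothC g ->
  ham xi (fun x => f x + g x) p = ham xi f p + ham xi g p.
Proof.
move=> sf sg; rewrite -[ham xi f p]mul1r -ham_lin//; congr (ham _ _ _).
by apply/funext => x; rewrite mul1r.
Qed.

Lemma ham_sub xi (f g : M -> R[i]) p : smoothC f -> smoothC g ->
  ham xi (fun x => f x - g x) p = ham xi f p - ham xi g p.
Proof.
move=> sf sg; rewrite addrC -[- _]mulN1r -ham_lin//; congr (ham _ _ _).
by apply/funext => x; rewrite mulN1r addrC.
Qed.

Lemma ham_scale xi (c : R[i]) (f : M -> R[i]) p : smoothC f ->
  ham xi (fun x => c * f x) p = c * ham xi f p.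
Proof.
move=> sf; rewrite -[RHS]addr0 -(ham0 xi p) -ham_lin//; last exact: smoothC0.
by congr (ham _ _ _); apply/funext => x; rewrite addr0.
Qed.

Lemma ham_correction_term xi (X : formal_series R M) a n p : smoothS X ->
  ham xi (fun p => (X ** JS (delta a)) n p - X n p * toC (Jbasis a) p
            + half_i_Delta a * lambdaS X n p) p =
  (hamS xi X ** JS (delta a)) n p + (X ** hamS xi (JS (delta a))) n p
  - (hamS xi X n p * toC (Jbasis a) p + X n p * ham xi (toC (Jbasis a)) p)
  + half_i_Delta a * lambdaS (hamS xi X) n p.
Proof.
move=> sX; have sJ := smoothS_JS (delta a); have sJa := smoothC_Jbasis a.
have s1 := smoothS_star hM bCr sX sJ n.
have s2 : smoothC (fun p => X n p * toC (Jbasis a) p) by exact: smoothC_mul.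
have s3 := smoothS_lambda sX n.
rewrite ham_add; [|exact: smoothC_sub|exact: smoothC_scale].
rewrite ham_sub// ham_scale// lambda_ham ham_mul_toC//; last exact: Jfun_smooth.
by rewrite -[ham xi ((_ ** _) n) p]/(hamS xi (_ ** _) n p) star_ham.
Qed.

Lemma smoothC_correction_term (X : formal_series R M) a n : smoothS X ->
  smoothC (fun p => (X ** JS (delta a)) n p - X n p * toC (Jbasis a) p
            + half_i_Delta a * lambdaS X n p).
Proof.
move=> sX; apply: smoothC_add => //; last by apply: smoothC_scale => //; exact: smoothS_lambda.
apply: smoothC_sub; first exact: (smoothS_star hM bCr sX (smoothS_JS (delta a))).
by apply: smoothC_mul => //; exact: smoothC_Jbasis.
Qed.

(** Delta vanishes on [e_b, xi]; this makes the Delta term of [correction] invariant. *)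
Lemma sum_half_i_Delta xi b : \sum_a half_i_Delta a * bracketC xi b a = 0.
Proof.
transitivity ('i%C / 2 * \sum_a ((Delta e (delta a) * bracket e (delta b) xi 0 a)%:C : R[i])).
  rewrite mulr_sumr; apply: eq_bigr => a _.
  by rewrite /half_i_Delta /bracketC [(_ * _)%:C](rmorphM (real_complex R)) mulrA.
have := sum_Delta_bracket b xi => /(congr1 (fun x : R => x%:C)).
by rewrite (rmorph_sum (real_complex R)) => Z; rewrite [X in _ * X]Z mulr0.
Qed.

(** Applying xi_M to a summand gives the summand for Y plus terms with structure constants. In the
    star product and in the pointwise product those coming from X_a cancel those coming from J_a
    after summation, by [sum_cancel]; in the Delta term they vanish by [sum_half_i_Delta]. *)
Lemma ham_correction xi (X Y : 'I_d -> formal_series R M) n p :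
  (forall a, smoothS (X a)) -> (forall a, smoothS (Y a)) -> ham_system xi X Y ->
  ham xi (correction X n) p = correction Y n p.
Proof.
move=> sX sY XY; have sJ a := smoothS_JS (delta a).
rewrite [LHS]ham_sum => [|a]; last exact: smoothC_correction_term.
have sk a : smoothS (fun n p => \sum_b (- bracketC xi b a) * X b n p).
  by apply: smoothS_sum => // b; apply: smoothS_scale => //; exact: sX.
pose k := bracketC xi.
transitivity (\sum_a (((Y a ** JS (delta a)) n p - Y a n p * toC (Jbasis a) p
      + half_i_Delta a * lambdaS (Y a) n p)
   + (\sum_b - k b a * (X b ** JS (delta a)) n p + \sum_b k a b * (X a ** JS (delta b)) n p)
   - (\sum_b - k b a * (X b n p * toC (Jbasis a) p) +
      \sum_b k a b * (X a n p * toC (Jbasis b) p))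
   + \sum_b half_i_Delta a * (- k b a * lambdaS (X b) n p))); last first.
  rewrite !big_split/= !sumrN !big_split/= !sum_cancel subr0 addr0.
  rewrite /correction !big_split/= !sumrN -[RHS]addr0; congr (_ + _).
  rewrite exchange_big/= big1// => b _.
  transitivity ((\sum_a half_i_Delta a * bracketC xi b a) * - lambdaS (X b) n p); last first.
    by rewrite sum_half_i_Delta mul0r.
  by rewrite mulr_suml; apply: eq_bigr => a _; rewrite /k; ring.
apply: eq_bigr => a _; rewrite ham_correction_term// XY hamS_JS ham_JbasisE.
have SL : (fun n p => \sum_b - k b a * X b n p) ** JS (delta a) =
    (fun n p => \sum_b - k b a * (X b ** JS (delta a)) n p).
  exact: (star_suml hM bCr (index_enum _) (fun b => - k b a) sX (sJ a)).
have SR : X a ** (fun n p => \sum_b k a b * JS (delta b) n p) =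
    (fun n p => \sum_b k a b * (X a ** JS (delta b)) n p).
  exact: (star_sumr hM bCr (index_enum _) (fun b => k a b) sJ (sX a)).
rewrite (star_linl hM bCr 1 (sY a) (sk a) (sJ a)) SL SR mul1r.
have -> : lambdaS (fun n p => 1 * Y a n p + \sum_b - bracketC xi b a * X b n p) n p
   = lambdaS (Y a) n p + \sum_b - k b a * lambdaS (X b) n p.
  case: n => [|n] /=; last by rewrite mul1r.
  by rewrite add0r big1// => b _; rewrite mulr0.
have -> : \sum_b - k b a * (X b n p * toC (Jbasis a) p) =
    (\sum_b - k b a * X b n p) * toC (Jbasis a) p.
  by rewrite mulr_suml; apply: eq_bigr => b _; rewrite mulrA.
have -> : \sum_b k a b * (X a n p * toC (Jbasis b) p) =
    X a n p * \sum_b k a b * toC (Jbasis b) p.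
  by rewrite mulr_sumr; apply: eq_bigr => b _; rewrite mulrCA.
rewrite -mulr_sumr /k mul1r; ring.
Qed.

Lemma smoothS_correction (X : 'I_d -> formal_series R M) :
  (forall a, smoothS (X a)) -> smoothS (correction X).
Proof. by move=> sX n; apply: smoothC_sum => // a; exact: smoothC_correction_term. Qed.

Lemma deformation_ham xi H : smoothS H ->
  deformation Cr (hamS xi H) = hamS xi (deformation Cr H).
Proof.
move=> sH; have sh a := smoothS_h0 a sH.
have shh a := smoothS_h0 a (smoothS_ham xi sH).
apply/funext => n; apply/funext => p; rewrite deformationE.
rewrite -(ham_correction n p sh shh (ham_system_h0 xi sH)).
have -> : hamS xi (deformation Cr H) n p = ham xi (fun p => H n p + correction (h0 H) n p) p.
  by congr (ham _ _ _); apply/funext => q; exact: deformationE.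
by rewrite ham_add//; exact: smoothS_correction.
Qed.

Lemma h0_zero a : h0 Z0 a = Z0.
Proof.
have h00 p : h0R a (fun _ : M => 0) p = 0 :> R.
  have := @h0R_lin R D a 0 0 (fun=> 0) (fun=> 0) p (smoothR_cst 0) (smoothR_cst 0).
  rewrite (_ : (fun q : M => 0 * 0 + 0 * 0) = (fun=> 0)); first by rewrite !mul0r addr0.
  by apply/funext => q; rewrite !mul0r addr0.
apply/funext => n; apply/funext => p.
by apply: complex_ext => /=; exact: h00.
Qed.

Lemma deformation_zero : deformation Cr (Z0) = Z0.
Proof.
apply/funext => n; apply/funext => p; rewrite deformationE /correction big1 ?addr0// => a _.
rewrite h0_zero (star0l hM bCr); last exact: smoothS_JS.
by rewrite /zeroS mul0r subr0 add0r; case: n => [|n] /=; rewrite mulr0.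
Qed.

(** h_0 is the complex extension of a real operator. *)
Lemma h0_conj H a : smoothS H -> h0 (conjS H) a = conjS (h0 H a).
Proof.
move=> sH; apply/funext => n; apply/funext => p.
by apply: (extC_conj (h0R_linear_at a p)); have [] := sH n.
Qed.

Definition invariantS H : Prop := forall xi, hamS xi H = Z0.

Lemma invariant_preimage H F : smoothS H -> deformation Cr H = F -> invariantS F -> invariantS H.
Proof.
move=> sH HF iF xi; apply: deformation_inj; first exact: smoothS_ham.
  exact: smoothS0.
by rewrite deformation_ham// HF iF deformation_zero.
Qed.

Lemma conj_lambda F n p : (lambdaS F n p)^*%C = lambdaS (conjS F) n p.
Proof. by case: n => [|n]; [exact: conjc0|]. Qed.

Lemma conj_JS xi : conjS (JS xi) = JS xi.
Proof.
apply/funext => -[|n]; apply/funext => p; last exact: conjc0.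
by rewrite /conjS /toC /= oppr0.
Qed.

Lemma conj_comb (A B c h l : R[i]) :
  (A - B * c + h * l)^*%C = A^*%C - B^*%C * c^*%C + h^*%C * l^*%C.
Proof. by rewrite (rmorphD (@conjc R)) (rmorphB (@conjc R)) !(rmorphM (@conjc R)). Qed.

Lemma conj_half_i_Delta a : (half_i_Delta a)^*%C = - half_i_Delta a.
Proof.
have ci : ('i%C : R[i])^*%C = - 'i%C by apply: complex_ext => /=; rewrite ?oppr0.
have c2 : ((2 : R[i])^-1)^*%C = 2^-1 by rewrite fmorphV rmorph_nat.
have cD : ((Delta e (delta a))%:C : R[i])^*%C = (Delta e (delta a))%:C.
  by apply: complex_ext => /=; rewrite ?oppr0.
have -> : (half_i_Delta a)^*%C = ('i%C)^*%C * ((2 : R[i])^-1)^*%C * ((Delta e (delta a))%:C : R[i])^*%C.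
  by rewrite /half_i_Delta !(rmorphM (@conjc R)).
by rewrite ci c2 cD !mulNr.
Qed.

Lemma sum_bracketC b : \sum_a bracketC (delta a) b a = (Delta e (delta b))%:C.
Proof. by rewrite Delta_deltaE (rmorph_sum (real_complex R)). Qed.

(* Conjugation turns X_a * J_a into J_a * conj X_a, and moving J_a back to the right costs
   i lambda {J_a, conj X_a}, which sums to i lambda Delta(e_a) conj X_a when X is invariant:
   twice the term (i lambda / 2) Delta(e_a) conj X_a, whose conjugate is its opposite. *)
Lemma correction_conj (X : 'I_d -> formal_series R M) n p :
  (forall a, smoothS (X a)) -> (forall xi, ham_system xi X (fun=> Z0)) ->
  correction (fun a => conjS (X a)) n p = (correction X n p)^*%C.
Proof.
move=> sX iX.
pose lX b := lambdaS (conjS (X b)) n p.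
have starC a : ((X a ** JS (delta a)) n p)^*%C =
    - 'i%C * lambdaS (hamS (delta a) (conjS (X a))) n p + (conjS (X a) ** JS (delta a)) n p.
  have := congr1 (fun K : formal_series R M => K n p) (hherm (sX a) (smoothS_JS (delta a))).
  rewrite conj_JS JS_star; last exact: smoothS_conj.
  by [].
have hamC a m q : ham (delta a) (conjS (X a) m) q =
    \sum_b (- bracketC (delta a) b a) * conjS (X b) m q.
  have HX : hamS (delta a) (X a) m q = \sum_b (- bracketC (delta a) b a) * X b m q.
    by rewrite (iX (delta a) a) /zeroS mulr0 add0r.
  transitivity ((hamS (delta a) (X a) m q)^*%C).
    by apply: ham_conj; exact: sX.
  rewrite HX (rmorph_sum (@conjc R)); apply: eq_bigr => b _.
  rewrite (rmorphM (@conjc R)); congr (_ * _).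
  by apply: complex_ext => /=; rewrite /bracketC /= ?oppr0.
have lamE a : lambdaS (hamS (delta a) (conjS (X a))) n p =
    \sum_b (- bracketC (delta a) b a) * lX b.
  rewrite /lX; case: n {starC lX} => [|m] /=; first by rewrite big1// => b _; rewrite mulr0.
  exact: hamC.
(* After exchanging the sums, the coefficient of X_b is the sum over a of the a-components of
   [e_b, e_a], the trace of ad e_b; the two minus signs cancel. *)
have total : \sum_a (- 'i%C * \sum_b (- bracketC (delta a) b a) * lX b) =
    \sum_a 'i%C * (Delta e (delta a))%:C * lX a.
  rewrite -mulr_sumr exchange_big/= mulr_sumr; apply: eq_bigr => b _.
  rewrite -mulr_suml sumrN sum_bracketC; ring.
have two a : 'i%C * (Delta e (delta a))%:C = half_i_Delta a + half_i_Delta a :> R[i].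
  by rewrite /half_i_Delta -mulrDl -splitr.
rewrite /correction (rmorph_sum (@conjc R)).
transitivity (\sum_a ((conjS (X a) ** JS (delta a)) n p - conjS (X a) n p * toC (Jbasis a) p
   - half_i_Delta a * lX a) + \sum_a 'i%C * (Delta e (delta a))%:C * lX a).
  rewrite -big_split/=; apply: eq_bigr => a _; rewrite -/(lX a) two; ring.
rewrite -total -big_split/=; apply: eq_bigr => a _.
rewrite conj_comb starC lamE conj_lambda -/(lX a) conj_half_i_Delta.
have -> : (toC (@Jbasis R D a) p)^*%C = toC (Jbasis a) p by rewrite /toC /= oppr0.
rewrite /conjS; ring.
Qed.

Lemma deformation_conj H : smoothS H -> invariantS H ->
  deformation Cr (conjS H) = conjS (deformation Cr H).
Proof.
move=> sH iH; have sh a := smoothS_h0 a sH.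
(* Invariance of H removes the inhomogeneous part h_0 {H, J_xi} of the system. *)
have sys xi : ham_system xi (h0 H) (fun=> Z0).
  move=> a; rewrite (ham_system_h0 xi sH a) iH h0_zero.
  by [].
apply/funext => n; apply/funext => p; rewrite deformationE.
have -> : conjS (deformation Cr H) n p = (H n p)^*%C + (correction (h0 H) n p)^*%C.
  by rewrite /conjS deformationE rmorphD.
congr (_ + _); rewrite -(correction_conj n p sh sys).
by congr correction; apply/funext => a; exact: h0_conj.
Qed.

End Hermitian.

(** * Pullbacks from the reduced space *)

Section Invariants.
Variables (R : realType) (D : reduction_data R).
Local Notation M := (rdM D).
Local Notation C := (rdC D).
Local Notation Mred := (rdMred D).
Local Notation d := (mdim (rdG D)).
Local Notation pb := (@rd_pb R D).
Local Notation L := (@rd_L R D).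
Local Notation Phi := (@rd_Phi R D).
Local Notation pi := (@rd_pi R D).
Local Notation CxRn := (prodm C (Rn R d)).

Let hM : has_charts M := manifold_has_charts (rd_M_manifold D).
Let hC : has_charts C := manifold_has_charts (rd_C_manifold D).
Let hMred : has_charts Mred := manifold_has_charts (rd_Mred_manifold D).
Let hCR : has_charts CxRn := prod_has_charts hC (Rn_has_charts R d).

Lemma prolR_smooth (f : Mred -> R) : smoothR f -> smoothR (fun p : M => f (pi (Phi p).1)).
Proof.
move=> sf.
have sfC : smoothR (fun c : C => f (pi c)) := smoothR_comp hC hMred (rd_pi_smooth D) sf.
have sfCR : @smoothR R CxRn (fun q => f (pi q.1)).
  move=> _ [psi [chi [apsi _ ->]]]; apply: Cnear_Csmooth => _ [[c mu] [/= cd _] <-] k.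
  apply: (@Cnear_comp _ _ _ _ (fun z => f (pi (cinv psi z)))
    (fun y : 'rV[R]_(mdim C + d) => lsubmx y)).
    rewrite row_mxKl; exact: ((smoothRP _ hC).1 sfC c k psi apsi cd).
  by move=> j; exact: Cnear_lsubmx.
exact: (smoothR_comp hM hCR (rd_Phi_smooth D) sfCR).
Qed.

Lemma prolR_orbit (f : Mred -> R) g p : f (pi (Phi (L g p)).1) = f (pi (Phi p).1).
Proof.
congr f; rewrite rd_Phi_equivariant; apply/esym/rd_pi_orbits.
by exists g.
Qed.

(** By equivariance of Phi the function is constant on orbits, so the derivative along exp (t xi)
    that computes the bracket is 0. *)
Lemma pb_prolR (f : Mred -> R) xi p : smoothR f ->
  pb (fun p : M => f (pi (Phi p).1)) (Jfun xi) p = 0.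
Proof.
move=> sf; rewrite [LHS](rd_J_hamiltonian xi (prolR_smooth sf)).
rewrite (_ : (fun t : R => _) = cst (f (pi (Phi p).1))); first by rewrite derive1_cst.
by apply/funext => t; exact: prolR_orbit.
Qed.

Lemma smoothS_prol (u : formal_series R Mred) : smoothS u -> smoothS (prol (pullpi u)).
Proof.
by move=> su n; have [ru ju] := su n; split; [exact: (prolR_smooth ru)|exact: (prolR_smooth ju)].
Qed.

Lemma invariant_prol (u : formal_series R Mred) : smoothS u -> invariantS (prol (pullpi u)).
Proof.
move=> su xi; apply/funext => n; apply/funext => p; have [ru ju] := su n.
by apply: complex_ext; [exact: (pb_prolR xi p ru)|exact: (pb_prolR xi p ju)].
Qed.

End Invariants.

(** * Conjugation and the choice of solutions *)

Section Choice.
Variables (R : realType) (X Y : Type).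

Lemma conjSK (F : formal_series R X) : (fun n p => ((F n p)^*%C)^*%C) = F.
Proof. by apply/funext => n; apply/funext => p; exact: conjcK. Qed.

(** If P has a solution, uniqueness transfers to Q through the involution and the two choices
    correspond. If P has none, neither has Q, and both choices are the default 0, which conjugation
    fixes. *)
Lemma xget_conj (P Q : formal_series R X -> Prop) :
  let c := fun F : formal_series R X => (fun n p => (F n p)^*%C) : formal_series R X in
  (forall F, P F -> Q (c F)) -> (forall F, Q F -> P (c F)) ->
  (forall F F', P F -> P F' -> F = F') ->
  c (xget (fun _ _ => 0) P) = xget (fun _ _ => 0) Q.
Proof.
move=> c PQ QP uP.
have [[F PF]|nP] := pselect (exists F, P F).
  have uQ F1 F2 : Q F1 -> Q F2 -> F1 = F2.
    move=> Q1 Q2; have E := congr1 c (uP _ _ (QP _ Q1) (QP _ Q2)).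
    exact: (etrans (esym (conjSK F1)) (etrans E (conjSK F2))).
  by apply: uQ; [apply: PQ; exact: (xgetI _ PF)|exact: (xgetI _ (PQ _ PF))].
rewrite !xgetPN.
- by apply/funext => n; apply/funext => p; exact: conjc0.
- by move=> F QF; apply: nP; exists (c F); exact: QP.
- by move=> F PF; apply: nP; exists F.
Qed.

End Choice.

Theorem proposition4p7 (R : realType) (D : reduction_data R)
  (Cr : nat -> (rdM D -> R[i]) -> (rdM D -> R[i]) -> rdM D -> R[i])
  (hstar : is_star_product Cr (@rd_pb R D))
  (hinv : strongly_invariant Cr)
  (hherm : hermitian_product (star Cr)) :
  hermitian_product (star_red Cr).
Proof.
move=> u v su sv.
have hM : has_charts (rdM D) := manifold_has_charts (rd_M_manifold D).
have bCr r : bidifferential (Cr r) by case: hstar.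
have sPu := smoothS_prol su; have sPv := smoothS_prol sv.
set A := star Cr (prol (pullpi u)) (prol (pullpi v)).
set B := star Cr (prol (pullpi (conjS v))) (prol (pullpi (conjS u))).
have AB : conjS A = B by exact: hherm.
have sA : smoothS A := smoothS_star hM bCr sPu sPv.
have iA : invariantS A.
  move=> xi; rewrite (star_ham hstar hinv xi sPu sPv) !invariant_prol//.
  rewrite (star0l hM bCr sPv) (star0r hM bCr sPu).
  by apply/funext => n; apply/funext => p; rewrite /zeroS addr0.
have sB : smoothS B by rewrite -AB; exact: smoothS_conj.
have iB : invariantS B.
  move=> xi; apply/funext => n; apply/funext => p.
  rewrite -AB [LHS]ham_conj// -[ham xi (A n) p]/(hamS xi A n p) iA; exact: conjc0.
have BA : conjS B = A by rewrite -AB; exact: conjSK.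
(* Conjugation maps preimages under S of an invariant series to preimages of its conjugate. Stated
   for general F and G because it serves from A to B and from B to A. *)
have pre F G : invariantS F -> conjS F = G -> forall H, smoothS H /\ deformation Cr H = F ->
    smoothS (conjS H) /\ deformation Cr (conjS H) = G.
  move=> iF FG H [sH HF]; split; first exact: smoothS_conj.
  have iH := invariant_preimage hstar hinv sH HF iF.
  by rewrite (deformation_conj hinv hherm sH iH) HF.
have inv_conj : conjS (deformation_inv Cr A) = deformation_inv Cr B.
  apply: xget_conj; [exact: pre|exact: pre|].
  by move=> H H' [sH HE] [sH' HE']; exact: (deformation_inj hstar sH sH' (etrans HE (esym HE'))).
have qconj : conjS (qrestr Cr A) = qrestr Cr B by rewrite /qrestr -inv_conj.
have qconj' : conjS (qrestr Cr B) = qrestr Cr A by rewrite -qconj; exact: conjSK.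
(* The same principle for the defining equation of [star_red]. Pullback along pi commutes with
   conjugation, and pi is onto, so a series on the reduced space is determined by its pullback. *)
apply: xget_conj.
- move=> w [sw wE]; split; first exact: smoothS_conj (manifold_has_charts (rd_Mred_manifold D)) _ sw.
  by rewrite -[RHS]qconj -wE.
- move=> w [sw wE]; split; first exact: smoothS_conj (manifold_has_charts (rd_Mred_manifold D)) _ sw.
  by rewrite -[RHS]qconj' -wE.
- move=> w w' [_ wE] [_ wE']; apply/funext => n; apply/funext => x.
  have [c <-] := rd_pi_surj x.
  exact: (congr1 (fun K => K n c) (etrans wE (esym wE'))).
Qed.
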